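(* Let $\varphi$ be a quasi-concave function for which there is a constant $c_0>0$ with $\varphi(t)\ge c_0\,t\log(1+1/t)$ for all $t>0$. The following conditions are equivalent: (i) There exists an r.i. Banach space $X$ such that $R(X)=\Lambda_\varphi$. (ii) There exists a constant $C>0$ such that, for any $t>0$, if a decreasing function $g_t$ satisfies $$\int_0^s g_t(u)\log\Big(\frac su\Big)\,du\ \ge\ t\log\Big(1+\frac st\Big)\quad\text{for every } s>0,$$ then $\int_0^\infty g_t(u)\,d\varphi(u)\ge C\varphi(t)$. (iii) There is a constant $C>0$ such that, if $g$ is a decreasing function with $$\int_0^s g(u)\log\Big(\frac su\Big)\,du\ \ge\ \log(1+s)\quad\text{for every } s>0,$$ then for every $t>0$ it also satisfies $\int_0^\infty g\big(\frac ut\big)\,d\varphi(u)\ge C\varphi(t)$.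
   Context: All function spaces consist of measurable functions on $(0,\infty)$ with Lebesgue measure; ''r.i.'' means rearrangement invariant, and r.i. Banach spaces are rearrangement invariant Banach function spaces in the sense of Bennett–Sharpley. Equality of spaces means equality as sets with equivalent norms. ''Increasing'' and ''decreasing'' are in the weak sense; the decreasing functions $g_t$, $g$ on $(0,\infty)$ are nonnegative. $f^*$ is the decreasing rearrangement of $f$. A function $\varphi:(0,\infty)\to(0,\infty)$ is quasi-concave if it is increasing and $\varphi(t)/t$ is decreasing; we put $\varphi(0)=0$. For nonnegative decreasing $g$, $\int_0^\infty g\,d\varphi$ is the Stieltjes integral including the mass $\varphi(0+)$ at the origin, i.e. $\varphi(0+)g(0+)+\int_0^\infty g(t)\varphi'(t)\,dt$ (with $0\cdot\infty=0$). The Lorentz space $\Lambda_\varphi$ consists of all $f$ with $\|f\|_{\Lambda_\varphi}=\int_0^\infty f^*(t)\,d\varphi(t)<\infty$. For an r.i. space $X$, $W_X(t)=\big\|\frac{1}{1+\cdot/t}\big\|_X$ and $R(X)=\Lambda_{W_X}$; if $1/(1+s)\notin X$ then $R(X)=\{0\}$. *)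

(* Defs.v *)
From HB Require Import structures.
From mathcomp Require Import all_boot all_order all_algebra.
From mathcomp Require Import all_classical all_reals all_analysis.
From mathcomp Require Import measurable_realfun.

Set Implicit Arguments.
Unset Strict Implicit.
Unset Printing Implicit Defensive.

Import Order.TTheory GRing.Theory Num.Theory.
Import numFieldNormedType.Exports.

Local Open Scope classical_set_scope.
Local Open Scope ring_scope.
Local Open Scope ereal_scope.

(* The underlying measure space is (0,oo) with Lebesgue measure.  Functions on
   it are represented by functions on R of which only the values on (0,oo)
   matter. *)
Definition halfline (R : realType) : set R := [set x | (0 < x)%R].
Arguments halfline : clear implicits.

Definition ae_halfline (R : realType) (P : R -> Prop) : Prop :=
  {ae @lebesgue_measure R, forall x : R, halfline R x -> P x}.

(* M^+ : measurable functions (0,oo) -> [0,oo] *)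
Definition Mplus (R : realType) (f : R -> \bar R) : Prop :=
  measurable_fun (halfline R) f /\ forall x, halfline R x -> 0 <= f x.

Definition distribution_fun (R : realType) (f : R -> \bar R) (l : R) : \bar R :=
  @lebesgue_measure R (halfline R `&` [set x | l%:E < `|f x|]).

Definition equimeasurable (R : realType) (f g : R -> \bar R) : Prop :=
  forall l : R, (0 <= l)%R -> distribution_fun f l = distribution_fun g l.

(* f^*(t) = inf {l >= 0 : mu_f(l) <= t}, with inf of the empty set = +oo *)
Definition rearrangement (R : realType) (f : R -> \bar R) (t : R) : \bar R :=
  ereal_inf [set l%:E | l in [set l : R |
    (0 <= l)%R /\ distribution_fun f l <= t%:E]].

(* Rearrangement-invariant Banach function norms on (0,oo), after
   Bennett and Sharpley, Interpolation of Operators, Chapters 1 and 2: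
   (P1)-(P5) together with rearrangement invariance. *)
Record ri_function_norm (R : realType) := RiFunctionNorm {
  fnorm :> (R -> \bar R) -> \bar R ;
  fnorm_ge0 : forall f, Mplus f -> 0 <= fnorm f ;
  fnorm_eq0 : forall f, Mplus f ->
    (fnorm f = 0 <-> ae_halfline (fun x => f x = 0)) ;
  fnormZ : forall (a : R) f, (0 <= a)%R -> Mplus f ->
    fnorm (fun x => a%:E * f x) = a%:E * fnorm f ;
  fnormD : forall f g, Mplus f -> Mplus g ->
    fnorm (fun x => f x + g x) <= fnorm f + fnorm g ;
  fnorm_le : forall f g, Mplus f -> Mplus g ->
    ae_halfline (fun x => g x <= f x) -> fnorm g <= fnorm f ;
  fnorm_fatou : forall (f_ : nat -> R -> \bar R) f,
    (forall n, Mplus (f_ n)) -> Mplus f ->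
    ae_halfline (fun x => (forall n, f_ n x <= f_ n.+1 x) /\
                          f_ n x @[n --> \oo] --> f x) ->
    fnorm (f_ n) @[n --> \oo] --> fnorm f ;
  fnorm_indic : forall E : set R, measurable E -> E `<=` halfline R ->
    @lebesgue_measure R E < +oo ->
    fnorm (fun x => (\1_E x)%:E) < +oo ;
  fnorm_integral : forall E : set R, measurable E -> E `<=` halfline R ->
    @lebesgue_measure R E < +oo ->
    exists2 C : R, (0 < C)%R & forall f, Mplus f ->
      \int[@lebesgue_measure R]_(x in E) f x <= C%:E * fnorm f ;
  fnorm_ri : forall f g, Mplus f -> Mplus g ->
    ae_halfline (fun x => f x < +oo) -> ae_halfline (fun x => g x < +oo) ->
    equimeasurable f g -> fnorm f = fnorm g
}.

(* A function space is given by its (quasi-)norm N, a functional equal to +oo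
   outside the space; [carrier N] is the space as a set of functions. *)
Definition carrier (R : realType) (N : (R -> \bar R) -> \bar R) :
    set (R -> \bar R) :=
  [set f | measurable_fun (halfline R) f /\ N f < +oo].

Definition same_space (R : realType) (N1 N2 : (R -> \bar R) -> \bar R) : Prop :=
  carrier N1 = carrier N2 /\
  exists c C : R, [/\ (0 < c)%R, (0 < C)%R &
    forall f, carrier N1 f -> c%:E * N1 f <= N2 f /\ N2 f <= C%:E * N1 f].

Definition ri_norm (R : realType) (X : ri_function_norm R) (f : R -> \bar R) :
    \bar R := X (fun x => `|f x|).

Definition zero_space_norm (R : realType) (f : R -> \bar R) : \bar R :=
  if `[< ae_halfline (fun x => f x = 0) >] then 0 else +oo.

Definition quasi_concave (R : realType) (phi : R -> R) : Prop :=
  [/\ forall t : R, (0 < t)%R -> (0 < phi t)%R,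
      forall s t : R, (0 < s)%R -> (s <= t)%R -> (phi s <= phi t)%R &
      forall s t : R, (0 < s)%R -> (s <= t)%R -> (phi t / t <= phi s / s)%R].

(* int_0^oo g dphi, for phi quasi-concave and g nonnegative and decreasing on
   (0,oo); such a phi is locally Lipschitz on (0,oo), so that phi' exists
   almost everywhere.  The mass phi(0+) at the origin is included. *)
Definition stieltjes (R : realType) (phi : R -> R) (g : R -> \bar R) : \bar R :=
  (lim (phi x @[x --> 0%R^'+]))%:E * lim (g x @[x --> 0%R^'+]) +
  \int[@lebesgue_measure R]_(u in halfline R) (g u * (derive1 phi u)%:E).

Definition lorentz_norm (R : realType) (phi : R -> R) (f : R -> \bar R) :
    \bar R :=
  stieltjes phi (rearrangement f).

Definition W (R : realType) (X : ri_function_norm R) (t : R) : \bar R :=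
  ri_norm X (fun s => ((1 + s / t)^-1)%:E).

(* When 1/(1+s) belongs to X, W X t is finite for every t > 0, because
   1/(1+s/t) <= max(1,t)/(1+s); so [fine] loses nothing below. *)
Definition Rspace_norm (R : realType) (X : ri_function_norm R) :
    (R -> \bar R) -> \bar R :=
  if `[< carrier (ri_norm X) (fun s => ((1 + s)^-1)%:E) >]
  then lorentz_norm (fun t => fine (W X t))
  else @zero_space_norm R.

Definition decreasing_halfline (R : realType) (g : R -> R) : Prop :=
  (forall u : R, (0 < u)%R -> (0 <= g u)%R) /\
  (forall u v : R, (0 < u)%R -> (u <= v)%R -> (g v <= g u)%R).

(* int_0^s g(u) log(s/u) du *)
Definition log_integral (R : realType) (g : R -> R) (s : R) : \bar R :=
  \int[@lebesgue_measure R]_(u in [set u : R | (0 < u < s)%R])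
    (g u * ln (s / u))%:E.

(* Main.v *)
Require Import Defs.
From HB Require Import structures.
From mathcomp Require Import all_boot all_order all_algebra all_fingroup.
From mathcomp Require Import all_classical all_reals all_analysis.
From mathcomp Require Import measurable_realfun ring lra.

(* For quasi-concave phi the functional g |-> int g dphi is the layer-cake
   integral of sup phi over the superlevel sets of g, so it is monotone in phi
   up to constants, and R(X) = Lambda_phi holds iff W_X and phi are equivalent.

   (i) => (ii).  The part of g that matters on dyadic scales is bounded below by
   a step function G = sum_i a_i 1_(0,r_i], whose logarithmic transform is
   sum_i a_i m(r_i, s) with m(r, s) = int_0^s min(1, r/u) du.  The hypothesis on
   g then says that t/(t+u) is majorized, in the sense of Hardy-Littlewood-Polya
   and up to a constant, by h(u) = sum_i a_i min(1, r_i/u).  Hence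
   W_X(t) <~ ||h||_X <~ sum_i a_i W_X(r_i) = int G dW_X <= int g dW_X, and W_X is
   comparable to phi.

   (ii) => (i).  The space X has norm rho(f) = the least cost sum_i a_i phi(r_i)
   of a step function whose logarithmic transform dominates the K-functional
   K(f, s) = inf_a (a s + int (f-a)^+) = int_0^s f^*, relaxed to finitely many s
   so that the Fatou property holds.  Here W_X <= phi is clear, and (ii) gives
   phi <~ W_X; phi(t) >= c_0 t log(1+1/t) makes m(., s) <~ phi, which puts
   X inside L^1 on sets of finite measure.

   (ii) and (iii) are exchanged by the dilation u |-> u/t. *)

Set Implicit Arguments.
Unset Strict Implicit.
Unset Printing Implicit Defensive.

Import Order.TTheory GRing.Theory Num.Theory.
Import numFieldNormedType.Exports.

Local Open Scope classical_set_scope.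
Local Open Scope ring_scope.

(** Three obstacles shape the constructions. A bound [phi1 <= K * phi2] says nothing about
    derivatives, while [stieltjes] is defined through [derive1 phi]; hence the densities and the
    passage to superlevel sets. The norm axioms grant invariance under equimeasurability only, so
    monotonicity under majorization is obtained on step functions over equal cells, by moving mass
    between two cells. Finally, each step function produced is controlled at finitely many scales
    [2 ^+ j * t], [j <= J], and depends on [J]. From (i) to (ii) this is harmless: the bound is
    uniform in [J] and the Fatou property passes to the limit. From (ii) to (i) the step function
    must be completed beyond T = 2^J t, by a tail (t/T) 1_(0,T] of cost (t/T) phi(T). Either this
    cost is small against phi(t) for some J, or phi(r) >= k r for all r; in the latter case a cheap
    step function has so small an integral that its transform cannot keep up with t log(1 + s/t),
    which is absurd for large J. *)

(** * Stieltjes measures of Lipschitz functions and their densities *)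

Lemma lebesgue_stieltjes_itv (R : realType) (F : cumulative R R) (a b : R) : a <= b ->
  lebesgue_stieltjes_measure F `]a, b] = (F b - F a)%:E.
Proof.
move=> ab; rewrite /lebesgue_stieltjes_measure /measure_extension.
rewrite measurable_mu_extE/=; last exact: is_ocitv.
by rewrite wlength_itv_bnd.
Qed.

Lemma lipschitz_right_continuous (R : realType) (f : R -> R) (L : R) :
  0 <= L -> (forall x y, x <= y -> `|f y - f x| <= L * (y - x)) ->
  right_continuous f.
Proof.
move=> L0 Lip x; apply/cvgrPdist_le => e e0.
near=> y.
have xy : x <= y by apply: ltW; near: y; exact: nbhs_right_gt.
rewrite distrC (le_trans (Lip _ _ xy))//.
have : y - x <= e / (L + 1).
  rewrite lerBlDl; near: y; apply: nbhs_right_le; rewrite ltrDl divr_gt0//.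
  by rewrite ltr_wpDl.
move=> /(ler_wpM2l L0)/le_trans; apply.
rewrite mulrA ler_pdivrMr ?ltr_wpDl// mulrC.
by rewrite ler_pM2l// lerDl.
Unshelve. all: by end_near. Qed.

(** The function [L * x - F x] is again nondecreasing and right continuous, so it generates a
    measure; added to that of [F] it gives [L] times Lebesgue measure, by uniqueness on half-open
    intervals. *)
Lemma lebesgue_stieltjes_lipschitz_le (R : realType) (F : cumulative R R) (L : R) : 0 <= L ->
  (forall x y, x <= y -> F y - F x <= L * (y - x)) ->
  forall A, measurable A ->
  (lebesgue_stieltjes_measure F A <= L%:E * @lebesgue_measure R A)%E.
Proof.
move=> L0 Lip A mA.
have Fnd : forall x y, x <= y -> F x <= F y by exact: cumulative_is_nondecreasing.
pose g x := L * x - F x.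
have gnd : nondecreasing g.
  by move=> x y xy; have := Lip _ _ xy; rewrite /g mulrBr; lra.
have grc : right_continuous g.
  apply: (@lipschitz_right_continuous _ _ L) => // x y xy.
  rewrite ger0_norm ?subr_ge0 ?gnd// /g.
  by have := Fnd _ _ xy; rewrite mulrBr; lra.
pose G : cumulative R R := HB.pack g (isCumulative.Build R _ R g gnd grc).
pose h x : R := L * x.
have hnd : nondecreasing h by move=> x y xy; rewrite /h ler_wpM2l.
have hrc : right_continuous h.
  apply: (@lipschitz_right_continuous _ _ L) => // x y xy.
  by rewrite ger0_norm ?subr_ge0 ?hnd// /h mulrBr.
pose H : cumulative R R := HB.pack h (isCumulative.Build R _ R h hnd hrc).
pose Ln := NngNum L0.
have E1 : lebesgue_stieltjes_measure H A = mscale Ln (@lebesgue_measure R) A.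
  apply: lebesgue_stieltjes_measure_unique => //= X [[a b] _ <-] /=.
  have [ab|ba] := leP a b; last first.
    by rewrite set_itv_ge ?bnd_simp -?leNgt ?ltW// !measure0.
  by rewrite lebesgue_stieltjes_itv// /mscale/= [lebesgue_measure _]lebesgue_stieltjes_itv//= /h -EFinM mulrBr.
have E2 : lebesgue_stieltjes_measure H A =
   measure_add (lebesgue_stieltjes_measure F) (lebesgue_stieltjes_measure G) A.
  apply: lebesgue_stieltjes_measure_unique => //= X [[a b] _ <-] /=.
  have [ab|ba] := leP a b; last first.
    by rewrite set_itv_ge ?bnd_simp -?leNgt ?ltW// !measure0.
  apply: etrans (esym (measure_addE _ _ _)).
  rewrite (lebesgue_stieltjes_itv H ab)
    [X in (X + _)%E](lebesgue_stieltjes_itv F ab)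
    [X in (_ + X)%E](lebesgue_stieltjes_itv G ab) -EFinD /=.
  by rewrite /h /g; congr EFin; lra.
move: E1; rewrite E2 measure_addE /mscale/= => <-.
by rewrite leeDl.
Qed.

(** Radon-Nikodym for the Stieltjes measure of [f], restricted to []a, b]] to make it finite; the
    Lipschitz domination gives absolute continuity. *)
Lemma lipschitz_density (R : realType) (f : R -> R) (L : R) (a b : R) : 0 <= L ->
  nondecreasing f -> (forall x y, x <= y -> f y - f x <= L * (y - x)) ->
  exists d : R -> R, [/\ (forall x, 0 <= d x),
    (@lebesgue_measure R).-integrable setT (EFin \o d) &
    forall x y, a <= x -> x <= y -> y <= b ->
     (\int[@lebesgue_measure R]_(u in `]x, y]) (d u)%:E = (f y - f x)%:E)%E].
Proof.
move=> L0 nd Lip.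
have rc : right_continuous f.
  apply: (@lipschitz_right_continuous _ _ L) => // x y xy.
  by rewrite ger0_norm ?subr_ge0 ?nd// Lip.
pose F : cumulative R R := HB.pack f (isCumulative.Build R _ R f nd rc).
pose nu := lebesgue_stieltjes_measure F.
have mD : measurable (`]a, b] : set (measurableTypeR R)) by exact: measurable_itv.
have fD : (nu `]a, b]%classic < +oo)%E.
  rewrite /nu; have [ab|ba] := leP a b; last first.
    by rewrite set_itv_ge ?bnd_simp -?leNgt ?ltW// measure0.
  by rewrite lebesgue_stieltjes_itv// ltry.
have dom : mfrestr mD fD `<< (@lebesgue_measure R).
  apply/null_content_dominatesP => A mA A0.
  apply/eqP; rewrite eq_le measure_ge0 andbT.
  rewrite /mfrestr /mrestr /=.
  apply: (@le_trans _ _ (nu A)).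
    by apply: le_measure; rewrite ?inE//; exact: measurableI.
  apply: (le_trans (lebesgue_stieltjes_lipschitz_le L0 _ mA)) => //.
  by rewrite A0 mule0.
have [d [d0 dfin dint dE]] := radon_nikodym_sigma_finite dom.
exists (fine \o d); split.
- by move=> x; apply: fine_ge0.
- by rewrite (_ : EFin \o _ = d)//; apply/funext => x /=; rewrite fineK.
- move=> x y ax xy yb.
  transitivity (\int[@lebesgue_measure R]_(u in `]x, y]) (d u)%E)%E.
    by apply: eq_integral => u _ /=; rewrite fineK.
  rewrite -dE//.
  transitivity (nu `]x, y]%classic); last by rewrite /nu lebesgue_stieltjes_itv.
  rewrite /mfrestr /mrestr; congr (nu _); apply: setIidl => z /=.
  rewrite !in_itv/= => /andP[xz zy].
  by rewrite (le_lt_trans ax xz) (le_trans zy yb).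
Qed.

(** * Quasi-concave functions as integrals of their derivatives *)

Section QuasiConcave.
Variables (R : realType) (phi : R -> R).
Hypothesis qc : quasi_concave phi.

Lemma qc_gt0 t : 0 < t -> 0 < phi t.
Proof. by case: qc => h _ _; exact: h. Qed.

Lemma qc_le s t : 0 < s -> s <= t -> phi s <= phi t.
Proof. by case: qc => _ h _; exact: h. Qed.

Lemma qc_div s t : 0 < s -> s <= t -> phi t / t <= phi s / s.
Proof. by case: qc => _ _ h; exact: h. Qed.

Lemma qc_lip a s t : 0 < a -> a <= s -> s <= t ->
  phi t - phi s <= phi a / a * (t - s).
Proof.
move=> a0 as_ st.
have s0 : 0 < s by exact: lt_le_trans as_.
have t0 : 0 < t by exact: lt_le_trans st.
apply: (@le_trans _ _ (phi s / s * (t - s))); last first.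
  by rewrite ler_wpM2r ?subr_ge0// qc_div.
have := qc_div s0 st; rewrite ler_pdivrMr// => h.
by rewrite mulrBr divfK ?gt_eqF// lerB.
Qed.

(** Near 0 [phi] need not be Lipschitz. Frozen to the left of [a], it becomes the globally Lipschitz
    [psi], with the same increments to the right of [a]. The fundamental theorem of calculus then
    identifies the density with [derive1 phi] almost everywhere. *)
Lemma qc_local_density a b : 0 < a -> exists d : R -> R,
  [/\ (forall x, 0 <= d x),
    measurable_fun setT d,
    {ae @lebesgue_measure R, forall x, a < x < b -> derive1 phi x = d x} &
    forall x y, a <= x -> x <= y -> y <= b ->
     (\int[@lebesgue_measure R]_(u in `]x, y]) (d u)%:E = (phi y - phi x)%:E)%E].
Proof.
move=> a0; pose psi x := phi (Num.max a x).
have mgt0 x : 0 < Num.max a x by rewrite lt_max a0.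
have psind : nondecreasing psi.
  move=> x y xy; rewrite /psi qc_le//.
  by rewrite ge_max !le_max lexx xy/= orbT.
have L0 : 0 <= phi a / a by rewrite divr_ge0 ?ltW// qc_gt0.
have psiL x y : x <= y -> psi y - psi x <= phi a / a * (y - x).
  move=> xy; have mxy : Num.max a x <= Num.max a y.
    by rewrite ge_max !le_max lexx xy/= orbT.
  apply: (@le_trans _ _ (phi a / a * (Num.max a y - Num.max a x))).
    by apply: qc_lip => //; rewrite le_max lexx.
  rewrite ler_wpM2l// lerBlDr.
  rewrite ge_max; apply/andP; split.
    have : a <= Num.max a x by rewrite le_max lexx.
    by lra.
  have : x <= Num.max a x by rewrite le_max lexx orbT.
  lra.
have [d [d0 dint dE]] := lipschitz_density a b L0 psind psiL.
exists d; split => //.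
- by apply/measurable_EFinP; exact: measurable_int dint.
- have dint' y : (@lebesgue_measure R).-integrable
      [set` Interval (BRight a) (BRight y)] (EFin \o d).
    by apply: integrableS dint => //; exact: measurableT.
  have dloc : locally_integrable [set: R] d.
    by apply: open_integrable_locally => //; exact: openT.
  have := FTC1 dint' dloc; apply: filterS.
    exact: (ae_filter_ringOfSetsType (@lebesgue_measure R)).
  move=> x /= dx /andP[ax xb].
  have [df fE] := dx ax.
  have E : \near x, \int[@lebesgue_measure R]_(t in `]a, x]) (d t) = phi x - phi a.
    near=> y.
    have ay : a <= y.
      by apply: ltW; near: y; exact: lt_nbhsr.
    have yb : y <= b.
      by apply: ltW; near: y; exact: lt_nbhsl.
    rewrite /Rintegral dE//= /psi maxxx.
    by rewrite (max_idPr _).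
  have E' : \near x, phi x = (fun y => \int[@lebesgue_measure R]_(t in `]a, y]) (d t) + phi a) x.
    by apply: filterS E => y /= ->; rewrite subrK.
  rewrite -fE !derive1E.
  rewrite (near_eq_derive _ E') deriveD// derive_cst addr0//.
- move=> x y ax xy yb; rewrite dE// /psi !(max_idPr _)//.
  exact: le_trans xy.
Unshelve. all: by end_near. Qed.

(** The local densities are glued through [derive1 phi] itself, set to 0 off the half-line and on
    one null set containing all the exceptional points. Off that set it coincides with every local
    density, which yields measurability and sign. *)
Lemma qc_density : exists d : R -> R,
  [/\ (forall x, 0 <= d x),
    measurable_fun setT d,
    ae_halfline (fun x => derive1 phi x = d x) &
    forall x y, 0 < x -> x <= y ->
     (\int[@lebesgue_measure R]_(u in `]x, y]) (d u)%:E = (phi y - phi x)%:E)%E].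
Proof.
have n0 n : 0 < n.+1%:R^-1 :> R by rewrite invr_gt0 ltr0n.
have /choice[D DP] n := qc_local_density n.+1%:R (n0 n).
pose bad n := ~` [set x | n.+1%:R^-1 < x < n.+1%:R -> derive1 phi x = D n x].
have : (@lebesgue_measure R).-negligible (\bigcup_n bad n).
  by apply: negligible_bigcup => n; case: (DP n).
move=> [N [mN N0 badN]].
pose I n := `]n.+1%:R^-1, n.+1%:R[%classic : set R.
have IU : \bigcup_n I n = halfline R.
  apply/seteqP; split => [x [n _]|x] /=; rewrite /halfline /I /= ?in_itv/=.
    by move=> /andP[h _]; exact: lt_trans h.
  move=> x0; exists (Num.truncn (Num.max x x^-1)).+1 => //=; rewrite in_itv/=.
  have M0 : 0 <= Num.max x x^-1 by rewrite le_max ltW.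
  have h : Num.max x x^-1 < (Num.truncn (Num.max x x^-1)).+2%:R.
    by rewrite (lt_trans (truncnS_gt _))// ltr_nat.
  move: h; rewrite gt_max => /andP[h1 h2]; rewrite h1 andbT.
  by rewrite invf_plt ?posrE.
pose d := (derive1 phi) \_ (halfline R `\` N).
have mI n : measurable (I n) by exact: measurable_itv.
have mh : measurable (halfline R) by rewrite -IU; exact: bigcup_measurable.
have dD n x : I n x -> ~ N x -> d x = D n x.
  move=> Inx Nx; rewrite /d patchE mem_set; last first.
    by split=> //; rewrite -IU; exists n.
  apply: contrapT => h; apply: Nx; apply: badN; exists n => //= h'.
  by apply: h; apply: h'; move: Inx; rewrite /I/= in_itv.
have dN x : N x -> d x = 0.
  by move=> Nx; rewrite /d patchE memNset// => -[].
have mdI n : measurable_fun (I n) d.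
  have -> : I n = (I n `\` N) `|` (I n `&` N).
    by rewrite setUC setUIDK.
  apply/measurable_funU; [exact: measurableD|exact: measurableI|split].
    apply: (@eq_measurable_fun _ _ _ _ _ (D n)).
      by move=> x; rewrite inE => -[Ix Nx]; rewrite (dD n).
    by apply: measurable_funTS; case: (DP n).
  apply: (@eq_measurable_fun _ _ _ _ _ (fun=> 0 : R)).
    by move=> x; rewrite inE => -[Ix Nx]; rewrite dN.
  exact: measurable_cst.
exists d; split.
- move=> x; have [[x0 Nx]|] := pselect ((halfline R `\` N) x).
    move: (x0); rewrite -IU => -[n _ Ix]; rewrite (dD n)//.
    by case: (DP n).
  by move=> h; rewrite /d patchE memNset.
- have -> : [set: R] = halfline R `|` ~` halfline R by rewrite setUv.
  apply/measurable_funU => //; first exact: measurableC.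
  split; first by rewrite -IU; apply/measurable_fun_bigcup.
  apply: (@eq_measurable_fun _ _ _ _ _ (fun=> 0 : R)).
    by move=> x; rewrite inE => h; rewrite /d patchE memNset// => -[].
  exact: measurable_cst.
- exists N; split => // x /= h; apply: contrapT => Nx; apply: h => x0.
  by rewrite /d patchE mem_set.
- move=> x y x0 xy.
  (* One membership serves both ends: 1/(n+1) lies below [x] and below [y^-1], so []x, y]] is inside
     [I n]. *)
  have : (\bigcup_n I n) (Num.min x y^-1)
    by rewrite IU /halfline/= lt_min x0 invr_gt0 (lt_le_trans x0).
  move=> [n _]; rewrite /I/= in_itv/= lt_min => /andP[/andP[nx ny] _].
  have y0 : 0 < y by exact: lt_le_trans xy.
  have yn : y < n.+1%:R by move: ny; rewrite ltf_pV2 ?posrE// ltr0n.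
  have [_ mD _ <-//] := DP n; [|exact: ltW|exact: ltW].
  have mO : measurable (`]x, y] : set R) by exact: measurable_itv.
  apply: ae_eq_integral => //.
  + apply/measurable_EFinP; apply: measurable_funS (mdI n) => // z /=.
    by rewrite /I/= !in_itv/= => /andP[xz zy]; rewrite (lt_trans nx)// (le_lt_trans zy).
  + by apply/measurable_EFinP; exact: measurable_funTS.
  + exists N; split => // z /= h; apply: contrapT => Nz; apply: h.
    rewrite in_itv/= => /andP[xz zy]; congr EFin; apply: dD => //.
    by rewrite /I/= in_itv/= (lt_trans nx)// (le_lt_trans zy).
Qed.

End QuasiConcave.

(** * The layer-cake formula with a weight *)

Section LayerCake.
Local Open Scope ereal_scope.

Lemma measurable_halfline (R : realType) : measurable (halfline R).
Proof.
have -> : halfline R = `]0%R, +oo[%classic.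
  by apply/seteqP; split=> x /=; rewrite /halfline/= in_itv/= andbT.
exact: measurable_itv.
Qed.

Lemma integral_lt_indic (R : realType) (c : \bar R) : 0 <= c ->
  \int[@lebesgue_measure R]_l (\1_([set l : R | (0 < l)%R /\ (l%:E < c)%E]) l)%:E = c.
Proof.
move=> c0.
have mh := @measurable_halfline R.
have mE : measurable_fun (halfline R) (@EFin R) by exact: measurable_funTS.
rewrite integral_indic ?setIT//; last exact: (emeasurable_fun_infty_o mh mE c).
case: c c0 => [c|_|//].
- rewrite lee_fin => c0.
  transitivity (@lebesgue_measure R (`]0%R, c[%classic : set R)).
    congr (lebesgue_measure _).
    apply/seteqP; split=> x /=; rewrite in_itv/= lte_fin; first by case=> -> ->.
    by move=> /andP[].
  rewrite lebesgue_measure_itv/= lte_fin; case: ltP => c0'; first by rewrite oppr0 adde0.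
  by apply/eqP; rewrite eq_le lee_fin c0 lee_fin c0'.
- transitivity (@lebesgue_measure R (`]0%R, +oo[%classic : set R)).
    congr (lebesgue_measure _).
    apply/seteqP; split=> x /=; rewrite in_itv/= ltry; first by case=> ->.
    by move=> /andP[].
  by rewrite lebesgue_measure_itv/= ltry.
Qed.

(** [h x] is the length of []0, h x[]; Tonelli on the region 0 < l < h x exchanges the two
    integrations, the value [+oo] of [h] included. *)
Lemma layer_cake (R : realType) (A : set R) (h w : R -> \bar R) :
  measurable A -> measurable_fun A h -> measurable_fun A w ->
  (forall x, A x -> 0 <= h x) -> (forall x, A x -> 0 <= w x) ->
  \int[@lebesgue_measure R]_(x in A) (h x * w x) =
  \int[@lebesgue_measure R]_(l in halfline R)
     \int[@lebesgue_measure R]_(x in A `&` [set x | l%:E < h x]) w x.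
Proof.
move=> mA mh mw h0 w0.
pose H := h \_ A; pose V := w \_ A.
have mH : measurable_fun setT H by exact: (measurable_restrictT _ mA).1.
have mV : measurable_fun setT V by exact: (measurable_restrictT _ mA).1.
have H0 x : 0 <= H x by apply: erestrict_ge0.
have V0 x : 0 <= V x by apply: erestrict_ge0.
pose B := [set z : measurableTypeR R * measurableTypeR R | (0 < z.1)%R /\ z.1%:E < H z.2].
have mB : measurable B.
  have -> : B = (halfline R `*` setT) `&` [set z | z.1%:E < H z.2].
    by apply/seteqP; split => -[x y]/=; rewrite /B/= /halfline/=; tauto.
  rewrite -[_ `*` _]setIid -setIA; apply: measurableI.
    by apply: measurableX => //; exact: measurable_halfline.
  apply: measurable_lte.
  - by apply: measurableX => //; exact: measurable_halfline.
  - by apply/measurable_EFinP; apply: measurable_funTS; exact: measurable_fst.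
  - by apply: measurable_funTS; apply: measurableT_comp => //; exact: measurable_snd.
pose F (z : measurableTypeR R * measurableTypeR R) : \bar R := (\1_B z)%:E * V z.2.
have mF : measurable_fun setT F.
  apply: emeasurable_funM.
    by apply/measurable_EFinP; exact: measurable_indic.
  by apply: measurableT_comp => //; exact: measurable_snd.
have F0 z : 0 <= F z by rewrite /F mule_ge0// lee_fin.
have := @fubini_tonelli _ _ _ _ R (@lebesgue_measure R) (@lebesgue_measure R) F mF F0.
have -> : \int[@lebesgue_measure R]_y \int[@lebesgue_measure R]_x F (x, y) =
    \int[@lebesgue_measure R]_(x in A) (h x * w x).
  rewrite [RHS]integral_mkcond; apply: eq_integral => x _.
  transitivity (H x * V x); last first.
    by rewrite /H /V !patchE; case: ifP => //; rewrite mule0.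
  under eq_integral do rewrite /F/= muleC.
  have mh' := @measurable_halfline R.
  have mE : measurable_fun (halfline R) (@EFin R) by exact: measurable_funTS.
  have mi : measurable_fun setT
      (\1_(halfline R `&` [set l : R | (l%:E < H x)%E]) : measurableTypeR R -> R).
    exact: measurable_indic (emeasurable_fun_infty_o mh' mE (H x)).
  rewrite ge0_integralZl//; last exact: ((measurable_EFinP _ _).2 mi).
  rewrite muleC; congr (_ * _).
  by rewrite -[RHS](@integral_lt_indic R (H x)).
move=> <-.
rewrite [RHS]integral_mkcond; apply: eq_integral => l _.
rewrite patchE; case: ifPn => [|]; rewrite ?inE => l0.
  rewrite [RHS]integral_mkcond; apply: eq_integral => x _.
  rewrite /F /V /B /H !patchE indicE /=.
  case: (pselect (A x)) => Ax; last first.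
    by rewrite [x \in A]memNset// mule0 memNset// => -[].
  have EB : ((l, x) \in [set z : R * R | (0 < z.1)%R /\ ((z.1)%:E < (h \_ A) z.2)%E]) = (l%:E < h x).
    by apply/idP/idP; rewrite inE/= patchE mem_set//; case.
  have EA : (x \in A `&` [set x | l%:E < h x]) = (l%:E < h x).
    by apply/idP/idP; rewrite inE//=; case.
  rewrite EB EA (@mem_set _ A x Ax).
  by case: (_ < _); rewrite ?mul1e ?mul0e.
apply: integral0_eq => x _; rewrite /F/= indicE memNset ?mul0e//.
by move=> -[/= l1 _]; move: l0; rewrite mem_set.
Qed.

End LayerCake.

(** * The Stieltjes integral as an integral over superlevel sets *)

Section StieltjesLayerCake.
Local Open Scope ereal_scope.
Import HBNNSimple.

(** The integral of a nonnegative function is a supremum over simple functions below it, so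
    monotonicity requires no measurability. *)
Lemma le_integral_ge0 d (T : measurableType d) (R : realType)
    (mu : {measure set T -> \bar R}) (f g : T -> \bar R) :
  (forall x, 0 <= f x) -> (forall x, f x <= g x) ->
  \int[mu]_x f x <= \int[mu]_x g x.
Proof.
move=> f0 fg; have g0 x : 0 <= g x by exact: le_trans (fg x).
rewrite !ge0_integralTE//; apply: ereal_sup_le => _ [h hf <-].
by exists h => // x; exact: le_trans (hf x) (fg x).
Qed.

(* This is applied to [f := g * derive1 phi], where [derive1 phi] may fail to be
   measurable: hence an arbitrary [f]. *)
Lemma integral_eq_ae_measurable d (T : measurableType d) (R : realType)
    (mu : {measure set T -> \bar R}) (D : set T) (f h : T -> \bar R) :
  measurable D -> measurable_fun D h -> (forall x, D x -> 0 <= h x) ->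
  {ae mu, forall x, D x -> f x = h x} ->
  \int[mu]_(x in D) f x = \int[mu]_(x in D) h x.
Proof.
move=> mD mh h0 [N [mN N0 fh]].
rewrite 2!(integral_mkcond D).
set F := f \_ D; set H := h \_ D.
have mH : measurable_fun setT H by exact: (measurable_restrictT _ mD).1.
have H0 x : 0 <= H x by apply: erestrict_ge0.
have FH x : ~ N x -> F x = H x.
  move=> Nx; rewrite /F /H !patchE; case: ifPn => // /[1!inE] Dx.
  by apply: contrapT => ne; apply: Nx; apply: fh => /= /(_ Dx).
(* [ooN] is measurable with integral 0 and dominates whatever [f] does on [N]. *)
pose ooN := (cst (+oo : \bar R)) \_ N.
have mooN : measurable_fun setT ooN by apply: (measurable_restrictT _ mN).1.
have ooN0 x : 0 <= ooN x by apply: erestrict_ge0 => y _; exact: leey.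
have iooN : \int[mu]_x ooN x = 0.
  rewrite /ooN -integral_mkcond integral_cst// [mu N]N0.
  by rewrite mule0.
have ooNE x : N x -> ooN x = +oo by move=> Nx; rewrite /ooN patchE mem_set.
rewrite integralE.
have -> : \int[mu]_x F^\- x = 0.
  apply/eqP; rewrite eq_le integral_ge0// andbT.
  rewrite -[leRHS]iooN; apply: le_integral_ge0 => // x.
  have [Nx|Nx] := pselect (N x); first by rewrite ooNE// leey.
  by rewrite funenegE FH// (le_trans _ (ooN0 x))// ge_max lexx oppe_le0 H0.
rewrite sube0; apply/eqP; rewrite eq_le; apply/andP; split.
  rewrite -[leRHS]adde0 -[in leRHS]iooN -ge0_integralD//.
  apply: le_integral_ge0 => // x.
  have [Nx|Nx] := pselect (N x).
    by rewrite ooNE// addey ?leey// gt_eqF// (lt_le_trans _ (H0 x)).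
  by rewrite funeposE FH// (le_trans _ (leeDl _ _))// ge_max lexx H0.
rewrite (ge0_negligible_integral mN measurableT mH)// setTD integral_mkcond.
apply: le_integral_ge0 => x.
  by apply: erestrict_ge0.
rewrite patchE funeposE; case: ifPn => [|_]; last by rewrite le_max lexx orbT.
by rewrite inE => Nx; rewrite FH// le_max lexx.
Qed.

Definition noninc_halfline (R : realType) (g : R -> \bar R) :=
  (forall u, (0 < u)%R -> 0 <= g u) /\
  (forall u v, (0 < u)%R -> (u <= v)%R -> g v <= g u).

Definition superlevel (R : realType) (g : R -> \bar R) (l : R) : set R :=
  halfline R `&` [set x | l%:E < g x].

Lemma noninc_measurable (R : realType) (g : R -> \bar R) :
  noninc_halfline g -> measurable_fun (halfline R) g.
Proof.
move=> [g0 gni]; have mh := @measurable_halfline R.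
apply: (measurability _ (ErealGenOInfty.measurableE R)) => // _ [_ [l ->] <-].
apply: is_interval_measurable => x y [x0 gx] [y0 gy] z /andP[xz zy].
have z0 : (0 < z)%R by exact: lt_le_trans xz.
split => //=; move: gy; rewrite /= !in_itv/= !andbT => /lt_le_trans; apply.
exact: gni.
Qed.

Lemma superlevel_measurable (R : realType) (g : R -> \bar R) l :
  noninc_halfline g -> measurable (superlevel g l).
Proof.
move=> gn; apply: emeasurable_fun_o_infty; first exact: measurable_halfline.
exact: noninc_measurable.
Qed.

(* The increment over A of phi, the mass at the origin included, when A is an
   interval starting at 0; 0 when A is empty and possibly +oo. *)
Definition qc_sup (R : realType) (phi : R -> R) (A : set R) : \bar R :=
  ereal_sup (0 |` [set (phi x)%:E | x in A]).

Lemma qc_sup_ge0 (R : realType) (phi : R -> R) A : 0 <= qc_sup phi A.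
Proof. by apply: ereal_sup_ubound; left. Qed.

Lemma qc_sup_le (R : realType) (phi psi : R -> R) (K : R) A : (0 <= K)%R ->
  (forall x, A x -> phi x <= K * psi x)%R ->
  qc_sup phi A <= K%:E * qc_sup psi A.
Proof.
move=> K0 h; apply: ge_ereal_sup => _ [->|[x Ax <-]].
  by rewrite mule_ge0// qc_sup_ge0.
apply: (@le_trans _ _ (K%:E * (psi x)%:E)).
  by rewrite -EFinM lee_fin h.
by rewrite lee_wpmul2l// ereal_sup_ubound//; right; exists x.
Qed.

Section Stieltjes.
Variables (R : realType) (phi : R -> R).
Hypothesis qc : quasi_concave phi.

Lemma qc_at0 : exists p0 : R, [/\ (phi x @[x --> 0%R^'+] --> p0)%R, (0 <= p0)%R,
  (forall x, 0 < x -> p0 <= phi x)%R &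
  (forall e, 0 < e -> exists2 x, 0 < x & phi x < p0 + e)%R].
Proof.
have ni : {in Interval (BRight (0:R)%R) +oo%O &, nondecreasing_fun phi}.
  move=> x y; rewrite !in_itv/= !andbT => x0 _ xy; exact: (qc_le qc).
set S := phi @` [set` Interval (BRight (0:R)%R) +oo%O].
have Slb : lbound S 0%R.
  by move=> y [x /=]; rewrite in_itv/= andbT => x0 <-; rewrite ltW// (qc_gt0 qc).
have hS : has_lbound S by exists 0%R.
have hi : has_inf S.
  by split => //; exists (phi 1%R), 1%R => //=; rewrite in_itv/= ltr01.
exists (inf S); split.
- exact: nondecreasing_at_right_cvgr.
- by apply: lb_le_inf => //; case: hi.
- move=> x x0; apply: ge_inf => //; exists x => //=.
  by rewrite in_itv/= x0.
- move=> e e0; have [_ [x /= + <-] h] := inf_adherent e0 hi.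
  by rewrite in_itv/= andbT => x0; exists x.
Qed.

Lemma noninc_at0 (g : R -> \bar R) : noninc_halfline g ->
  lim (g x @[x --> 0%R^'+]) = ereal_sup (g @` halfline R).
Proof.
move=> [g0 gni]; apply/cvg_lim => //.
have -> : halfline R = [set` Interval (BRight (0:R)%R) +oo%O].
  by apply/seteqP; split=> x /=; rewrite /halfline/= in_itv/= andbT.
apply: nonincreasing_at_right_cvge => // x y.
by rewrite !in_itv/= !andbT => x0 _ xy; exact: gni.
Qed.

Variables (d : R -> R) (p0 : R).
Hypotheses (d0 : forall x, (0 <= d x)%R) (md : measurable_fun setT d)
  (dE : ae_halfline (fun x => derive1 phi x = d x))
  (dI : forall x y, (0 < x)%R -> (x <= y)%R ->
     \int[@lebesgue_measure R]_(u in `]x, y]) (d u)%:E = (phi y - phi x)%:E).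
Hypotheses (p0lim : (phi x @[x --> 0%R^'+] --> p0)%R) (p0ge0 : (0 <= p0)%R)
  (p0le : forall x, (0 < x)%R -> (p0 <= phi x)%R)
  (p0inf : forall e, (0 < e)%R -> exists2 x, (0 < x)%R & (phi x < p0 + e)%R).

Let mdE D : measurable_fun D (EFin \o d).
Proof. by apply/measurable_EFinP; exact: measurable_funTS. Qed.

Lemma density_itv0 b : (0 < b)%R ->
  \int[@lebesgue_measure R]_(u in `]0%R, b]) (d u)%:E = (phi b - p0)%:E.
Proof.
move=> b0; pose F n := `](b / n.+1%:R)%R, b]%classic : set R.
have bn0 n : (0 < b / n.+1%:R)%R by rewrite divr_gt0.
have FU : \bigcup_n F n = `]0%R, b]%classic.
  apply/seteqP; split=> [x [n _]|x] /=; rewrite /F/= !in_itv/= => /andP[h1 h2].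
    by rewrite h2 (lt_trans _ h1).
  exists (Num.truncn (b / x)) => //=; rewrite in_itv/= h2 andbT.
  by rewrite ltr_pdivrMr// mulrC -ltr_pdivrMr// truncnS_gt.
have Fnd : nondecreasing_seq F.
  move=> m n mn; apply/subsetPset => x; rewrite /F/= !in_itv/= => /andP[h1 ->].
  rewrite andbT (le_lt_trans _ h1)// ler_pM2l// lef_pV2 ?posrE//.
  by rewrite ler_nat ltnS.
have h : \int[@lebesgue_measure R]_(x in F i) (d x)%:E @[i --> \oo] -->
    \int[@lebesgue_measure R]_(x in \bigcup_i F i) (d x)%:E.
  by apply: ge0_nondecreasing_set_cvg_integral;
    [exact: Fnd|move=> i; exact: measurable_itv|move=> i; exact: mdE
    |move=> i x _; rewrite lee_fin].
rewrite FU in h; rewrite -(cvg_lim _ h)//.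
apply/cvg_lim => //.
rewrite (_ : (fun _ => _) = EFin \o (fun n => phi b - phi (b / n.+1%:R))%R); last first.
  apply/funext => n; rewrite /F [LHS]dI//.
  by rewrite ler_pdivrMr// ler_peMr ?ler1n// ltW.
apply: cvg_EFin; first by near=> n.
apply: cvgB; first exact: cvg_cst.
apply/cvgrPdist_lt => e e0; have [x x0 px] := p0inf e0.
exists (Num.truncn (b / x)) => // n /= hn.
have bx : (b / n.+1%:R <= x)%R.
  rewrite ler_pdivrMr// mulrC -ler_pdivrMr// ltW// (lt_le_trans (truncnS_gt _))//.
  by rewrite ler_nat ltnS.
have := p0le (bn0 n); have := qc_le qc (bn0 n) bx.
by move=> h1 h2; rewrite ler0_norm; lra.
Unshelve. all: by end_near.
Qed.

(** [A] need not contain [sup A]. As [phi x / x] decreases, each [x] in [A] is at most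
    [sup A * (M / phi (sup A))], with [M] the supremum of [phi] over [A]; if [M] were below
    [phi (sup A)], this would be an upper bound of [A] smaller than [sup A]. *)
Lemma qc_sup_bounded (A : set R) b : A !=set0 -> A `<=` `]0%R, b] ->
  (phi (sup A))%:E <= qc_sup phi A.
Proof.
move=> A0 Ab; have hA : has_sup A.
  by split=> //; exists b => x /Ab /=; rewrite in_itv/= => /andP[].
have A_gt0 x : A x -> (0 < x)%R by move=> /Ab /=; rewrite in_itv/= => /andP[].
have s0 : (0 < sup A)%R.
  have [x Ax] := A0; apply: (lt_le_trans (A_gt0 _ Ax)).
  by apply: ub_le_sup => //; case: hA.
rewrite leNgt; apply/negP; set M := qc_sup phi A => Mlt.
have M0 : 0 <= M by exact: qc_sup_ge0.
have Mfin : M \is a fin_num by rewrite ge0_fin_numE// (lt_trans Mlt)// ltry.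
have ps0 := qc_gt0 qc s0.
have : (sup A <= sup A * (fine M / phi (sup A)))%R.
  apply: ge_sup => // x Ax; have x0 := A_gt0 _ Ax.
  have xs : (x <= sup A)%R by apply: ub_le_sup => //; case: hA.
  have pM : (phi x <= fine M)%R.
    by rewrite -lee_fin fineK//; apply: ereal_sup_ubound; right; exists x.
  rewrite mulrA ler_pdivlMr//.
  have := qc_div qc x0 xs; rewrite ler_pdivrMr// mulrAC ler_pdivlMr// => h.
  rewrite mulrC; apply: (le_trans h).
  by rewrite mulrC ler_wpM2l// ltW.
rewrite mulrA ler_pdivlMr// ler_pM2l// leNgt.
by rewrite -lte_fin fineK// Mlt.
Qed.

(** Such an [A] is an interval starting at 0. The density accounts for the increment of [phi] from
    0+ to its right end, and [p0] for the atom at the origin. An unbounded [A] is exhausted by its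
    parts in []0, n]], and [qc_sup_bounded] covers a right end that [A] omits. *)
Lemma density_down (A : set R) : A !=set0 -> measurable A -> A `<=` halfline R ->
  (forall x y, A x -> (0 < y)%R -> (y <= x)%R -> A y) ->
  p0%:E + \int[@lebesgue_measure R]_(u in A) (d u)%:E = qc_sup phi A.
Proof.
move=> A0 mA Ah Ad; have d0E (D : set R) x : D x -> 0 <= (d x)%:E by rewrite lee_fin.
apply/eqP; rewrite eq_le; apply/andP; split.
  have [->|Moo] := eqVneq (qc_sup phi A) +oo; first by rewrite leey.
  have Mfin : qc_sup phi A \is a fin_num by rewrite ge0_fin_numE ?qc_sup_ge0// ltey.
  rewrite -leeBrDl//.
  pose F n := A `&` `]0%R, n%:R]%classic.
  have mF n : measurable (F n) by apply: measurableI.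
  have FA : \bigcup_n F n = A.
    apply/seteqP; split=> [x [n _ []//]|x Ax]; exists (Num.truncn x).+1 => //.
    by split=> //=; rewrite in_itv/= (Ah _ Ax)/= ltW// truncnS_gt.
  have h : \int[@lebesgue_measure R]_(x in F i) (d x)%:E @[i --> \oo] -->
    \int[@lebesgue_measure R]_(x in \bigcup_i F i) (d x)%:E.
    apply: ge0_nondecreasing_set_cvg_integral;
      [|exact: mF|move=> i; exact: mdE|by move=> i x _; rewrite lee_fin].
    move=> m n mn; apply/subsetPset => x [Ax]; rewrite /F/= in_itv/= => /andP[x0 xm].
    by split=> //=; rewrite in_itv/= x0 (le_trans xm)// ler_nat.
  rewrite FA in h; rewrite -(cvg_lim _ h)//; apply: lime_le; first by apply/cvg_ex; eexists; exact: h.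
  apply: nearW => n.
  have [->|/set0P F0] := eqVneq (F n) set0.
    rewrite integral_set0 leeBrDl// adde0.
    have [x Ax] := A0; apply: (@le_trans _ _ (phi x)%:E).
      by rewrite lee_fin p0le//; exact: Ah.
    by apply: ereal_sup_ubound; right; exists x.
  have Fb : F n `<=` `]0%R, n%:R] by move=> x [].
  have hF : has_sup (F n).
    by split=> //; exists n%:R => x /Fb /=; rewrite in_itv/= => /andP[].
  have s0 : (0 < sup (F n))%R.
    have [x Fx] := F0; apply: (@lt_le_trans _ _ x); first by apply: Ah; case: Fx.
    by apply: ub_le_sup => //; case: hF.
  apply: (@le_trans _ _ (\int[@lebesgue_measure R]_(u in `]0%R, sup (F n)]) (d u)%:E)).
    apply: ge0_subset_integral; [exact: mF|exact: measurable_itv|exact: mdE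
      |by move=> x _; rewrite lee_fin|].
    move=> x Fx /=; rewrite in_itv/=; apply/andP; split; first by apply: Ah; case: Fx.
    by apply: ub_le_sup => //; case: hF.
  rewrite density_itv0// EFinB leeB//.
  apply: (le_trans (qc_sup_bounded F0 Fb)).
  by apply: ereal_sup_le => _ [->|[x [Ax _] <-]]; [left|right; exists x].
apply: ge_ereal_sup => _ [->|[x Ax <-]].
  by rewrite adde_ge0 ?lee_fin// integral_ge0// => x _; rewrite lee_fin.
have x0 : (0 < x)%R by exact: Ah.
have -> : (phi x)%:E = p0%:E + \int[@lebesgue_measure R]_(u in `]0%R, x]) (d u)%:E.
  by rewrite density_itv0// -EFinD; congr EFin; lra.
rewrite leeD2l//; apply: ge0_subset_integral;
  [exact: measurable_itv|by []|exact: mdE|by move=> y _; rewrite lee_fin|].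
by move=> y /=; rewrite in_itv/= => /andP[y0 yx]; exact: (Ad x).
Qed.

Lemma qc_sup_set0 : qc_sup phi set0 = 0.
Proof. by rewrite /qc_sup image_set0 setU0 ereal_sup1. Qed.

Lemma stieltjes_density (g : R -> \bar R) : noninc_halfline g ->
  stieltjes phi g = p0%:E * ereal_sup (g @` halfline R) +
    \int[@lebesgue_measure R]_(u in halfline R) (g u * (d u)%:E).
Proof.
move=> gn; rewrite /stieltjes noninc_at0// (cvg_lim _ p0lim)//; congr (_ + _).
apply: integral_eq_ae_measurable.
- exact: measurable_halfline.
- by apply: emeasurable_funM; [exact: noninc_measurable|exact: mdE].
- by move=> x x0; rewrite mule_ge0 ?lee_fin//; case: gn => h _; exact: h.
- case: dE => N [mN N0 hN]; exists N; split => // x hx; apply: hN => /= hh.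
  by apply: hx => x0; rewrite hh.
Qed.

(** The atom contributes [p0] at each level below g(0+), and these are exactly the levels with a
    nonempty superlevel set. So the atom and the layers of the density part merge into one integral
    over levels. *)
Lemma stieltjes_layer (g : R -> \bar R) : noninc_halfline g ->
  stieltjes phi g =
  \int[@lebesgue_measure R]_(l in halfline R) qc_sup phi (superlevel g l).
Proof.
move=> gn; have [g0 gni] := gn; have mh := @measurable_halfline R.
have dge0 x : halfline R x -> 0 <= (d x)%:E by move=> _; rewrite lee_fin.
rewrite stieltjes_density// (layer_cake mh (noninc_measurable gn) (@mdE _) g0 dge0).
set G0 := ereal_sup _.
have G00 : 0 <= G0.
  apply: (le_trans (g0 1%R ltr01)); apply: ereal_sup_ubound.
  by exists 1%R => //; rewrite /halfline/=.
pose L l : \bar R := (\1_([set l : R | (0 < l)%R /\ (l%:E < G0)%E]) l)%:E.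
have mL : measurable_fun (halfline R) L.
  apply: measurable_funTS; apply/measurable_EFinP; apply: measurable_indic.
  rewrite (_ : [set _ | _] = halfline R `&` [set l : R | (l%:E < G0)%E])//.
  by apply: emeasurable_fun_infty_o => //; exact: measurable_funTS.
have EL : \int[@lebesgue_measure R]_(l in halfline R) L l = G0.
  rewrite -[RHS](integral_lt_indic G00) integral_mkcond; apply: eq_integral => l _.
  rewrite patchE /L; case: ifPn => // l0; rewrite indicE memNset// => -[/= h _].
  by move: l0; rewrite mem_set.
have L0 l : halfline R l -> 0 <= L l by move=> _; rewrite lee_fin.
have -> : p0%:E * G0 = \int[@lebesgue_measure R]_(l in halfline R) (p0%:E * L l).
  by rewrite ge0_integralZl ?lee_fin ?EL.
have Dn : noninc_halfline (fun l =>
    \int[@lebesgue_measure R]_(x in superlevel g l) (d x)%:E).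
  split=> [l _|l m l0 lm]; first by apply: integral_ge0 => x _; rewrite lee_fin.
  apply: ge0_subset_integral.
  - exact: superlevel_measurable.
  - exact: superlevel_measurable.
  - exact: mdE.
  - by move=> x _; rewrite lee_fin.
  - by move=> x [x0 /= h]; split => //=; apply: le_lt_trans h; rewrite lee_fin.
rewrite -ge0_integralD//; [|by move=> l _; rewrite mule_ge0 ?lee_fin
  |exact: measurable_funeM|by case: Dn|exact: noninc_measurable Dn].
apply: eq_integral => l /[1!inE] l0.
rewrite /L indicE; case: (pselect (l%:E < G0)) => lG.
  rewrite mem_set ?mule1; last by split.
  apply: density_down.
  - have [_ [x x0 <-] lx] := ereal_sup_gt lG; exists x; split => //.
  - exact: superlevel_measurable.
  - by move=> x [].
  - by move=> x y [x0 /= lx] y0 yx; split=> //=; exact: lt_le_trans (gni _ _ y0 yx).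
have sl0 : superlevel g l = set0.
  rewrite -subset0 => x [x0 /= lx]; apply: lG; apply: (lt_le_trans lx).
  by apply: ereal_sup_ubound; exists x.
rewrite [_ `&` _]sl0 integral_set0 adde0 memNset ?mule0 ?sl0 ?qc_sup_set0//.
by case.
Qed.

End Stieltjes.

End StieltjesLayerCake.

(** * Comparison and linearity of the Stieltjes integral; step functions *)

Section StieltjesTheory.
Local Open Scope ereal_scope.
Variables (R : realType).
Implicit Types (phi : R -> R) (g h : R -> \bar R).

Lemma stieltjesE phi g : quasi_concave phi -> noninc_halfline g ->
  stieltjes phi g =
  \int[@lebesgue_measure R]_(l in halfline R) qc_sup phi (superlevel g l).
Proof.
move=> qc gn.
have [d [d0 md dE dI]] := qc_density qc.
have [p0 [p0lim p0ge0 p0le p0inf]] := qc_at0 qc.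
exact: (stieltjes_layer qc d0 md dE dI p0lim p0ge0 p0le p0inf gn).
Qed.

Lemma qc_sup_noninc phi g : noninc_halfline g ->
  noninc_halfline (fun l => qc_sup phi (superlevel g l)).
Proof.
move=> gn; split=> [l _|l m l0 lm]; first exact: qc_sup_ge0.
apply: ereal_sup_le => _ [->|[x [x0 /= gx] <-]]; [by left|right].
by exists x => //; split => //=; apply: le_lt_trans gx; rewrite lee_fin.
Qed.

Lemma stieltjes_ge0 phi g : quasi_concave phi -> noninc_halfline g ->
  0 <= stieltjes phi g.
Proof.
by move=> qc gn; rewrite stieltjesE// integral_ge0// => l _; exact: qc_sup_ge0.
Qed.

(** The derivatives of [phi1] and [phi2] are not comparable; the comparison is made on each
    superlevel set, where only values of the two functions enter. *)
Lemma stieltjes_cmp phi1 phi2 (K : R) g : quasi_concave phi1 -> quasi_concave phi2 ->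
  (0 <= K)%R -> (forall x, 0 < x -> phi1 x <= K * phi2 x)%R -> noninc_halfline g ->
  stieltjes phi1 g <= K%:E * stieltjes phi2 g.
Proof.
move=> qc1 qc2 K0 h gn; rewrite !stieltjesE//.
have mh := @measurable_halfline R.
have m1 := noninc_measurable (qc_sup_noninc phi1 gn).
have m2 := noninc_measurable (qc_sup_noninc phi2 gn).
rewrite -ge0_integralZl ?lee_fin//; last by move=> l _; exact: qc_sup_ge0.
apply: ge0_le_integral => //.
- by move=> l _; exact: qc_sup_ge0.
- exact: measurable_funeM.
- by move=> l _; apply: qc_sup_le => // x [x0 _]; exact: h.
Qed.

Lemma stieltjes_le phi g h : quasi_concave phi -> noninc_halfline g ->
  noninc_halfline h -> (forall x, (0 < x)%R -> g x <= h x) ->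
  stieltjes phi g <= stieltjes phi h.
Proof.
move=> qc gn hn gh; rewrite !stieltjesE//; apply: ge0_le_integral.
- exact: measurable_halfline.
- by move=> l _; exact: qc_sup_ge0.
- exact: noninc_measurable (qc_sup_noninc phi gn).
- exact: noninc_measurable (qc_sup_noninc phi hn).
- move=> l _; apply: ereal_sup_le => _ [->|[x [x0 /= gx] <-]]; [by left|right].
  by exists x => //; split => //=; apply: lt_le_trans gx (gh _ _).
Qed.

Lemma noninc_cvg0 g : noninc_halfline g -> cvg (g x @[x --> 0%R^'+]).
Proof.
move=> [g0 gni]; apply/cvg_ex; eexists.
apply: (@nonincreasing_at_right_cvge _ g 0%R +oo%O) => // x y.
by rewrite !in_itv/= !andbT => x0 _ xy; exact: gni.
Qed.

Lemma noninc_lim_ge0 g : noninc_halfline g -> 0 <= lim (g x @[x --> 0%R^'+]).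
Proof.
move=> gn; rewrite noninc_at0//; apply: (@le_trans _ _ (g 1%R)).
  by case: gn => h _; exact: h.
by apply: ereal_sup_ubound; exists 1%R => //; rewrite /halfline/=.
Qed.

Lemma nonincD g h : noninc_halfline g -> noninc_halfline h ->
  noninc_halfline (fun x => g x + h x).
Proof.
move=> [g0 gni] [h0 hni]; split=> [u u0|u v u0 uv].
  by rewrite adde_ge0 ?g0 ?h0.
by rewrite leeD ?gni ?hni.
Qed.

Lemma nonincZ (a : R) g : (0 <= a)%R -> noninc_halfline g ->
  noninc_halfline (fun x => a%:E * g x).
Proof.
move=> a0 [g0 gni]; split=> [u u0|u v u0 uv].
  by rewrite mule_ge0 ?g0.
by rewrite lee_wpmul2l ?gni.
Qed.

(** Superlevel sets of a sum do not split, so additivity comes from the density formula rather than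
    from the layers. *)
Lemma stieltjesD phi g h : quasi_concave phi -> noninc_halfline g ->
  noninc_halfline h ->
  stieltjes phi (fun x => g x + h x) = stieltjes phi g + stieltjes phi h.
Proof.
move=> qc gn hn.
have [d [d0 md dE dI]] := qc_density qc.
have [p0 [p0lim p0ge0 p0le p0inf]] := qc_at0 qc.
have E k : noninc_halfline k -> _ :=
  @stieltjes_density R phi d p0 d0 md dE p0lim k.
rewrite !E//; last exact: nonincD.
rewrite -!noninc_at0//; last exact: nonincD.
have -> : lim (g x + h x @[x --> 0%R^'+]) =
    lim (g x @[x --> 0%R^'+]) + lim (h x @[x --> 0%R^'+]).
  apply/cvg_lim => //; apply: cvgeD; [|exact: noninc_cvg0..].
  by apply: ge0_adde_def; rewrite inE noninc_lim_ge0.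
rewrite ge0_muleDr ?noninc_lim_ge0//.
have mh := @measurable_halfline R.
have mE D : measurable_fun D (EFin \o d).
  by apply/measurable_EFinP; exact: measurable_funTS.
have dn k : noninc_halfline k -> forall x, halfline R x -> 0 <= k x * (d x)%:E.
  by move=> [k0 _] x x0; rewrite mule_ge0 ?k0 ?lee_fin.
have mk k : noninc_halfline k -> measurable_fun (halfline R) (fun x => k x * (d x)%:E).
  by move=> kn; apply: emeasurable_funM; [exact: noninc_measurable|exact: mE].
rewrite [RHS]addeACA; congr (_ + _).
transitivity (\int[@lebesgue_measure R]_(u in halfline R)
    (g u * (d u)%:E + h u * (d u)%:E)); last first.
  exact: (ge0_integralD (@lebesgue_measure R) mh (dn _ gn) (mk _ gn) (dn _ hn) (mk _ hn)).
apply: eq_integral => x /[1!inE] x0; rewrite ge0_muleDl//.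
- by case: gn => k _; exact: k.
- by case: hn => k _; exact: k.
Qed.

Lemma stieltjesZ phi (a : R) g : (0 <= a)%R -> quasi_concave phi ->
  noninc_halfline g -> stieltjes phi (fun x => a%:E * g x) = a%:E * stieltjes phi g.
Proof.
move=> a0 qc gn.
have [d [d0 md dE dI]] := qc_density qc.
have [p0 [p0lim p0ge0 p0le p0inf]] := qc_at0 qc.
have E k : noninc_halfline k -> _ :=
  @stieltjes_density R phi d p0 d0 md dE p0lim k.
rewrite !E//; last exact: nonincZ.
rewrite -!noninc_at0//; last exact: nonincZ.
have -> : lim (a%:E * g x @[x --> 0%R^'+]) = a%:E * lim (g x @[x --> 0%R^'+]).
  by apply/cvg_lim => //; apply: cvgeZl => //; exact: noninc_cvg0.
have mh := @measurable_halfline R.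
have mE D : measurable_fun D (EFin \o d).
  by apply/measurable_EFinP; exact: measurable_funTS.
have dn x : halfline R x -> 0 <= g x * (d x)%:E.
  by case: gn => k _ x0; rewrite mule_ge0 ?k ?lee_fin.
have mk : measurable_fun (halfline R) (fun x => g x * (d x)%:E).
  by apply: emeasurable_funM; [exact: noninc_measurable|exact: mE].
rewrite ge0_muleDr; last 2 first.
- by rewrite mule_ge0 ?lee_fin ?noninc_lim_ge0.
- exact: integral_ge0.
rewrite muleCA; congr (_ + _).
transitivity (\int[@lebesgue_measure R]_(u in halfline R) (a%:E * (g u * (d u)%:E))).
  by apply: eq_integral => x _; rewrite muleA.
by rewrite ge0_integralZl ?lee_fin.
Qed.

Definition itv_indic (r u : R) : R := ((u <= r)%R : bool)%:R.

Lemma itv_indic_noninc r : noninc_halfline (fun u => (itv_indic r u)%:E).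
Proof.
split=> [u _|u v _ uv]; rewrite /itv_indic lee_fin ?ler0n// ler_nat.
by case: (leP v r) => // vr; rewrite (le_trans uv).
Qed.

Lemma stieltjes_itv_indic phi r : quasi_concave phi -> (0 < r)%R ->
  stieltjes phi (fun u => (itv_indic r u)%:E) = (phi r)%:E.
Proof.
move=> qc r0; have gn := itv_indic_noninc r.
have [d [d0 md dE dI]] := qc_density qc.
have [p0 [p0lim p0ge0 p0le p0inf]] := qc_at0 qc.
rewrite (stieltjes_density d0 md dE p0lim gn).
have -> : ereal_sup ((fun u => (itv_indic r u)%:E) @` halfline R) = 1.
  apply/eqP; rewrite eq_le; apply/andP; split.
    apply: ge_ereal_sup => _ [x x0 <-]; rewrite /itv_indic lee_fin.
    by case: (x <= r)%R.
  by apply: ereal_sup_ubound; exists r => //; rewrite /itv_indic lexx.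
have -> : \int[@lebesgue_measure R]_(u in halfline R) ((itv_indic r u)%:E * (d u)%:E) =
    \int[@lebesgue_measure R]_(u in `]0%R, r]) (d u)%:E.
  rewrite integral_mkcond [RHS]integral_mkcond; apply: eq_integral => u _.
  rewrite !patchE; case: (ltP 0%R u) => u0; last first.
    rewrite !memNset//=; first by rewrite in_itv/= ltNge u0.
    by move=> u0'; move: u0; rewrite leNgt u0'.
  rewrite mem_set// /itv_indic; case: leP => ur.
    by rewrite mem_set ?mul1e//= in_itv/= u0.
  by rewrite memNset ?mul0e//= in_itv/= u0/= leNgt ur.
by rewrite (density_itv0 qc d0 md dI p0le p0inf r0) mule1 -EFinD; congr EFin; lra.
Qed.

(** A pair (a, r) stands for a times the indicator of (0, r]. Radii may repeat and come in any
    order, so that adding step functions is concatenating lists. *)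
Definition step_fun (G : seq (R * R)) (u : R) : R :=
  (\sum_(p <- G) p.1 * itv_indic p.2 u)%R.

Definition cost phi (G : seq (R * R)) : R := (\sum_(p <- G) p.1 * phi p.2)%R.

Definition wf (G : seq (R * R)) : bool := all (fun p => (0 <= p.1)%R && (0 < p.2)%R) G.

Lemma step_fun_noninc G : wf G -> noninc_halfline (fun u => (step_fun G u)%:E).
Proof.
elim: G => [|[a r] G IH] /=.
  by split=> *; rewrite /step_fun !big_nil.
move=> /andP[/andP[/= a0 r0] wG].
have := nonincD (nonincZ a0 (itv_indic_noninc r)) (IH wG).
by congr noninc_halfline; apply/funext => u; rewrite /step_fun big_cons EFinD EFinM.
Qed.

Lemma stieltjes_step phi G : quasi_concave phi -> wf G ->
  stieltjes phi (fun u => (step_fun G u)%:E) = (cost phi G)%:E.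
Proof.
move=> qc; elim: G => [|[a r] G IH] /=.
  have n0 : noninc_halfline (fun u : R => (itv_indic 1 u)%:E) by exact: itv_indic_noninc.
  move=> _; have := stieltjesZ (lexx 0%R) qc n0.
  rewrite mul0e /cost big_nil; apply: etrans.
  by congr stieltjes; apply/funext => u; rewrite /step_fun big_nil mul0e.
move=> /andP[/andP[/= a0 r0] wG].
have n1 := itv_indic_noninc r.
rewrite /cost big_cons/= EFinD EFinM -(stieltjes_itv_indic qc r0) -(stieltjesZ a0 qc n1).
rewrite -[X in _ = _ + X](IH wG) -(stieltjesD qc (nonincZ a0 n1) (step_fun_noninc wG)).
by congr stieltjes; apply/funext => u; rewrite /step_fun big_cons EFinD EFinM.
Qed.

Lemma rearrangement_noninc (f : R -> \bar R) : noninc_halfline (rearrangement f).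
Proof.
split=> [u _|u v u0 uv].
  by apply: le_ereal_inf_tmp => _ [l [l0 _] <-]; rewrite lee_fin.
apply: le_ereal_inf_tmp => _ [l [l0 h] <-]; apply: ereal_inf_lbound.
exists l => //; split => //.
by rewrite (le_trans h)// lee_fin.
Qed.

End StieltjesTheory.

(** * The logarithmic transform of an indicator *)

Section LogKernel.
Variable R : realType.
Implicit Types r s t u a b : R.

Lemma integral_itvcc_derive (f F : R -> R) a b : a < b ->
  (forall x, a <= x <= b -> is_derive x 1 F (f x)) ->
  (forall x, a <= x <= b -> {for x, continuous f}) ->
  (\int[@lebesgue_measure R]_(x in `[a, b]) (f x)%:E = (F b - F a)%:E)%E.
Proof.
move=> ab dF cf; rewrite EFinB; apply: continuous_FTC2 => //.
- by apply: continuous_in_subspaceT => x; rewrite inE/= in_itv/=; exact: cf.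
- have cF x : a <= x <= b -> {for x, continuous F}.
    move=> xab; apply: differentiable_continuous; apply/derivable1_diffP.
    by have := dF _ xab; case.
  split.
  + move=> x; rewrite in_itv/= => /andP[ax xb].
    by have [] : is_derive x 1 F (f x) by apply: dF; rewrite !ltW.
  + by apply: cvg_at_right_filter; apply: cF; rewrite lexx ltW.
  + by apply: cvg_at_left_filter; apply: cF; rewrite lexx ltW.
- move=> x; rewrite in_itv/= => /andP[ax xb].
  have [_ h] : is_derive x 1 F (f x) by apply: dF; rewrite !ltW.
  by rewrite derive1E.
Qed.

(* [mlog r s] is the integral over 0 < u < s of 1_(u <= r) ln (s / u), and also
   that of min 1 (r / u). *)
Definition mlog r s := if s <= r then s else r * (1 + ln (s / r)).

Lemma integral_ln_itvcc a b s : 0 < s -> 0 < a -> a <= b ->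
  (\int[@lebesgue_measure R]_(u in `[a, b]) (ln (s / u))%:E =
    (b * (1 + ln (s / b)) - a * (1 + ln (s / a)))%:E)%E.
Proof.
move=> s0 a0; rewrite le_eqVlt => /predU1P[<-|ab].
  by rewrite set_itv1 integral_set1 subrr.
apply: (@integral_itvcc_derive (fun u => ln (s / u)) (fun u => u * (1 + ln (s / u)))) => //.
- move=> x /andP[ax xb]; have x0 : 0 < x by exact: lt_le_trans ax.
  have D : is_derive x 1 (fun u => u * (1 + (ln s - ln u))) (ln (s / x)).
    have dln := is_derive1_ln x0.
    apply: is_derive_eq.
    rewrite ln_div ?posrE// /GRing.scale/=; field.
    by rewrite gt_eqF.
  apply: near_eq_is_derive D; near=> y.
  have y0 : 0 < y by near: y; exact: lt_nbhsr.
  by rewrite ln_div ?posrE.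
- move=> x /andP[ax xb]; have x0 : 0 < x by exact: lt_le_trans ax.
  apply: continuous_comp => /=.
    by apply: continuousM; [exact: cvg_cst|apply: continuousV => //; rewrite gt_eqF].
  by apply: continuous_ln; rewrite divr_gt0.
Unshelve. all: by end_near. Qed.

Lemma measurable_ln_div s (D : set R) : 0 < s -> D `<=` halfline R ->
  measurable_fun D (fun u => (ln (s / u))%:E).
Proof.
move=> s0 Dh; apply/measurable_EFinP.
apply: (@eq_measurable_fun _ _ _ _ _ (fun u => ln s - ln u)).
  by move=> u; rewrite inE => /Dh u0; rewrite ln_div ?posrE.
by apply: measurable_funTS; apply: measurable_funB => //; exact: measurable_ln.
Qed.

Lemma integral_ln_itv0 b s : 0 < b -> b <= s ->
  (\int[@lebesgue_measure R]_(u in `]0%R, b]) (ln (s / u))%:E =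
    (b * (1 + ln (s / b)))%:E)%E.
Proof.
move=> b0 bs; have s0 : 0 < s by exact: lt_le_trans bs.
(* The square makes [e n * (1 + ln (s / e n))] tend to 0 with no more than the bound ln(n+1) <= n+1:
   the worst term, [e n] times 2(n+1), is 2b/(n+1). *)
pose e n : R := b / n.+1%:R ^+ 2.
have n1 n : 1 <= n.+1%:R ^+ 2 :> R by rewrite exprn_ege1// ler1n.
have n0 n : 0 < n.+1%:R ^+ 2 :> R by exact: lt_le_trans (n1 n).
have e0 n : 0 < e n by rewrite divr_gt0.
have eb n : e n <= b by rewrite ler_pdivrMr// ler_peMr// ltW.
pose F n := `[e n, b]%classic : set R.
have FU : \bigcup_n F n = `]0%R, b]%classic.
  apply/seteqP; split=> [x [n _]|x] /=; rewrite /F/= !in_itv/= => /andP[h1 h2].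
    by rewrite h2 (lt_le_trans _ h1).
  exists (Num.truncn (b / x)) => //=; rewrite in_itv/= h2 andbT.
  rewrite ler_pdivrMr// mulrC -ler_pdivrMr//.
  rewrite (le_trans (ltW (truncnS_gt _)))//.
  by rewrite expr2 ler_peMr// ler1n.
have ml D : D `<=` halfline R -> measurable_fun D (fun u => (ln (s / u))%:E).
  exact: measurable_ln_div.
have ln0 x : 0 < x -> x <= b -> 0 <= ln (s / x).
  by move=> x0 xb; rewrite ln_ge0// ler_pdivlMr// mul1r (le_trans xb).
have h : (\int[@lebesgue_measure R]_(x in F i) (ln (s / x))%:E @[i --> \oo] -->
    \int[@lebesgue_measure R]_(x in \bigcup_i F i) (ln (s / x))%:E)%E.
  apply: ge0_nondecreasing_set_cvg_integral;
    [|move=> i; exact: measurable_itv|move=> i; apply: ml => x; rewrite /F/= in_itv/= => /andP[+ _]; exact: lt_le_trans|].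
    move=> m n mn; apply/subsetPset => x; rewrite /F/= !in_itv/= => /andP[h1 ->].
    rewrite andbT (le_trans _ h1)// ler_pM2l// lef_pV2 ?posrE//.
    by rewrite lerXn2r ?nnegrE// ler_nat ltnS.
  move=> i x; rewrite /F/= in_itv/= => /andP[ex xb]; rewrite lee_fin ln0//.
  exact: lt_le_trans ex.
rewrite FU in h; rewrite -(cvg_lim _ h)//; apply/cvg_lim => //.
rewrite (_ : (fun _ => _) = EFin \o
    (fun n => b * (1 + ln (s / b)) - e n * (1 + ln (s / e n)))); last first.
  by apply/funext => n; rewrite /F [LHS]integral_ln_itvcc.
apply: cvg_EFin; first by near=> n.
rewrite -[X in _ --> X]subr0; apply: cvgB; first exact: cvg_cst.
pose B := b * (1 + ln (s / b)) + 2 * b.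
apply: (@squeeze_cvgr _ _ _ _ (cst 0) (fun n => B * n.+1%:R^-1)).
- apply: nearW => n; rewrite /cst; apply/andP; split.
    by rewrite mulr_ge0 ?ltW// ltr_pwDl// ln0.
  have L : ln (s / e n) <= ln (s / b) + 2 * n.+1%:R.
    have -> : s / e n = s / b * n.+1%:R ^+ 2.
      by rewrite /e; field; rewrite ?gt_eqF// exprn_gt0.
    rewrite lnM ?posrE ?divr_gt0// lerD2l lnXn//.
    have := @ln_sublinear R n.+1%:R (ltr0Sn _ _); rewrite mulr2n; lra.
  apply: (@le_trans _ _ (e n * (1 + (ln (s / b) + 2 * n.+1%:R)))).
    by rewrite ler_pM2l// lerD2l.
  have p0 : 0 < n.+1%:R :> R by [].
  have -> : e n * (1 + (ln (s / b) + 2 * n.+1%:R)) =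
     (b * (1 + ln (s / b)) / n.+1%:R + 2 * b) * n.+1%:R^-1.
    by rewrite /e; field; rewrite ?gt_eqF// exprn_gt0.
  rewrite ler_pM2r ?invr_gt0// /B lerD2r ler_pdivrMr// ler_peMr ?ler1n//.
  by rewrite mulr_ge0 ?ltW// ltr_pwDl// ln0.
- exact: cvg_cst.
- rewrite -[X in _ --> X](mulr0 B); apply: cvgMl_tmp; exact: cvg_harmonic.
Unshelve. all: by end_near. Qed.

Lemma log_integral_itv_indic r s : 0 < r -> 0 < s ->
  log_integral (itv_indic r) s = (mlog r s)%:E.
Proof.
move=> r0 s0; rewrite /log_integral /mlog.
have setE : [set u : R | 0 < u < s] = `]0%R, s[%classic.
  by apply/seteqP; split=> u /=; rewrite in_itv.
have ml D : D `<=` halfline R -> measurable_fun D (fun u => (ln (s / u))%:E).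
  exact: measurable_ln_div.
rewrite setE; case: leP => sr.
  transitivity (\int[@lebesgue_measure R]_(u in `]0%R, s[) (ln (s / u))%:E)%E.
    apply: eq_integral => u; rewrite inE/= in_itv/= => /andP[u0 us].
    by rewrite /itv_indic (le_trans (ltW us) sr) mul1r.
  rewrite integral_itv_bndo_bndc; last first.
    by apply: ml => x /=; rewrite in_itv/= => /andP[].
  by rewrite integral_ln_itv0// divff ?gt_eqF// ln1 addr0 mulr1.
rewrite -(integral_ln_itv0 r0 (ltW sr)) integral_mkcond [RHS]integral_mkcond.
apply: eq_integral => u _; rewrite !patchE.
case: (ltP 0 u) => u0; last first.
  by rewrite !memNset//= in_itv/= ltNge u0.
rewrite /itv_indic; case: (leP u r) => ur.
  by rewrite !mem_set/= ?in_itv/= ?u0 ?(le_lt_trans ur sr)// mul1r.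
rewrite [X in _ = if X then _ else _]memNset/=; last by rewrite in_itv/= u0 leNgt ur.
by case: ifP => // _; rewrite mul0r.
Qed.

End LogKernel.

(** * Growth of [mlog], and the transform of step functions *)

Section MlogTheory.
Variable R : realType.
Implicit Types r s t u a b : R.

Lemma ln_le_subr1 u : 0 < u -> ln u <= u - 1.
Proof.
move=> u0; have := @le_ln1Dx R (u - 1); rewrite (_ : 1 + (u - 1) = u); last by ring.
by apply; lra.
Qed.

Lemma ln_ge_1subV u : 0 < u -> 1 - u^-1 <= ln u.
Proof.
move=> u0; have := @ln_le_subr1 u^-1; rewrite invr_gt0 => /(_ u0).
rewrite lnV ?posrE//; lra.
Qed.

Lemma mlog_le r s s' : 0 < r -> 0 < s -> s <= s' -> mlog r s <= mlog r s'.
Proof.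
move=> r0 s0 ss'; rewrite /mlog; case: (leP s r) => sr; case: (leP s' r) => s'r //.
- rewrite (le_trans sr)// ler_peMr ?(ltW r0)// lerDl ln_ge0//.
  by rewrite ler_pdivlMr// mul1r ltW.
- by move: s'r; rewrite leNgt (lt_le_trans sr).
- rewrite ler_pM2l// lerD2l ler_ln ?posrE ?divr_gt0//; last exact: lt_le_trans ss'.
  by rewrite ler_pM2r ?invr_gt0.
Qed.

Lemma mlog_ge_min r s : 0 < r -> 0 < s -> Num.min r s <= mlog r s.
Proof.
move=> r0 s0; rewrite /mlog; case: (leP s r) => sr; first by [].
rewrite ler_peMr ?(ltW r0)// lerDl ln_ge0//.
by rewrite ler_pdivlMr// mul1r ltW.
Qed.

Lemma mlog_gt0 r s : 0 < r -> 0 < s -> 0 < mlog r s.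
Proof.
by move=> r0 s0; apply: lt_le_trans (mlog_ge_min r0 s0); rewrite lt_min r0.
Qed.

(** The slope of [mlog r] at [s] is [min 1 (r / s)], which decreases in [s]; by concavity the slope
    at the left end bounds the increment. *)
Lemma mlog_step r s s' : 0 < r -> 0 < s -> s <= s' ->
  mlog r s' - mlog r s <= (s' - s) * Num.min 1 (r / s).
Proof.
move=> r0 s0 ss'; have s'0 : 0 < s' by exact: lt_le_trans ss'.
rewrite /mlog; case: (leP s r) => sr.
  rewrite (min_idPl _); last by rewrite ler_pdivlMr// mul1r.
  rewrite mulr1; case: (leP s' r) => s'r //.
  rewrite lerD2r; have := @ln_le_subr1 (s' / r); rewrite divr_gt0// => /(_ isT).
  move=> /(ler_wpM2l (ltW r0)); rewrite mulrBr mulr1 mulrCA divff ?gt_eqF// mulr1.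
  by rewrite mulrDr mulr1; lra.
rewrite (min_idPr _); last by rewrite ler_pdivrMr// mul1r ltW.
rewrite (leNgt s' r) (lt_le_trans sr ss')/=.
have -> : r * (1 + ln (s' / r)) - r * (1 + ln (s / r)) = r * ln (s' / s).
  by rewrite !ln_div ?posrE//; ring.
have := @ln_le_subr1 (s' / s); rewrite divr_gt0// => /(_ isT).
move=> /(ler_wpM2l (ltW r0))/le_trans; apply.
by rewrite le_eqVlt; apply/orP; left; apply/eqP; field; rewrite gt_eqF.
Qed.

(** The slope at u is at most r/u, and the integral of r/u over [s, s'] is the logarithmic term. *)
Lemma mlog_tail r s s' : 0 < r -> 0 < s -> s <= s' ->
  mlog r s' <= mlog r s + r * ln (s' / s).
Proof.
move=> r0 s0 ss'; have s'0 : 0 < s' by exact: lt_le_trans ss'.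
have lss : 0 <= ln (s' / s) by rewrite ln_ge0// ler_pdivlMr// mul1r.
have key x : s <= x -> x - s <= x * ln (x / s).
  move=> sx; have x0 : 0 < x by exact: lt_le_trans sx.
  have := @ln_ge_1subV (x / s); rewrite divr_gt0// => /(_ isT).
  move=> /(ler_wpM2l (ltW x0)); apply: le_trans.
  by rewrite le_eqVlt; apply/orP; left; apply/eqP; field; rewrite !gt_eqF.
rewrite /mlog; case: (leP s r) => sr; case: (leP s' r) => s'r.
- have := key _ ss'; have := ler_wpM2r lss s'r; lra.
- have := key _ sr; rewrite !ln_div ?posrE//; lra.
- by move: s'r; rewrite leNgt (lt_le_trans sr).
- by rewrite !ln_div ?posrE// le_eqVlt; apply/orP; left; apply/eqP; ring.
Qed.

(** A concave function vanishing at the origin has decreasing ratio to its argument; the proof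
    combines the slope bound with [min r s <= mlog r s]. *)
Lemma mlog_div r s s' : 0 < r -> 0 < s -> s <= s' ->
  s * mlog r s' <= s' * mlog r s.
Proof.
move=> r0 s0 ss'; have := mlog_step r0 s0 ss'.
move=> /(ler_wpM2l (ltW s0)); rewrite mulrCA.
have -> : s * Num.min 1 (r / s) = Num.min r s.
  rewrite minr_pMr ?ltW// mulr1 mulrCA divff ?gt_eqF// mulr1.
  by rewrite minC.
have ss0 : 0 <= s' - s by rewrite subr_ge0.
have := ler_wpM2l ss0 (mlog_ge_min r0 s0).
lra.
Qed.

Lemma mlog_double r s : 0 < r -> 0 < s -> mlog (2 * r) s <= 2 * mlog r s.
Proof.
move=> r0 s0; have r20 : 0 < 2 * r by rewrite mulr_gt0.
rewrite {1}/mlog; case: (leP s (2 * r)) => s2r.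
  have := mlog_ge_min r0 s0; rewrite ge_min => /orP[]; last lra.
  lra.
rewrite /mlog (leNgt s r) (_ : r < s)/=; last by lra.
rewrite -mulrA ler_pM2l// ler_pM2l// lerD2l ler_ln ?posrE ?divr_gt0//.
by rewrite ler_pM2l// lef_pV2 ?posrE//; lra.
Qed.

Definition flog (G : seq (R * R)) s : R := \sum_(p <- G) p.1 * mlog p.2 s.

Lemma ler_sum_wf (G : seq (R * R)) (f g : R -> R) : wf G ->
  (forall r, 0 < r -> f r <= g r) ->
  \sum_(p <- G) p.1 * f p.2 <= \sum_(p <- G) p.1 * g p.2.
Proof.
move=> /allP wG fg; rewrite big_seq [leRHS]big_seq; apply: ler_sum => p /wG /andP[p1 p2].
by rewrite ler_wpM2l// fg.
Qed.

Lemma flog_le G s s' : wf G -> 0 < s -> s <= s' -> flog G s <= flog G s'.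
Proof. move=> wG s0 ss'; rewrite /flog.
exact: (@ler_sum_wf G (fun r => mlog r s) (fun r => mlog r s') wG
  (fun r hr => mlog_le hr s0 ss')).
Qed.

Lemma flog_div G s s' : wf G -> 0 < s -> s <= s' -> s * flog G s' <= s' * flog G s.
Proof.
move=> wG s0 ss'; rewrite /flog !mulr_sumr.
under eq_bigr do rewrite mulrCA; under [leRHS]eq_bigr do rewrite mulrCA.
have := @ler_sum_wf G (fun r => s * mlog r s') (fun r => s' * mlog r s) wG.
by apply => r r0; exact: mlog_div.
Qed.

Lemma flog_cat G H s : flog (G ++ H) s = flog G s + flog H s.
Proof. by rewrite /flog big_cat. Qed.

Lemma cost_cat (phi : R -> R) G H : cost phi (G ++ H) = cost phi G + cost phi H.
Proof. by rewrite /cost big_cat. Qed.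

Lemma wf_cat (G H : seq (R * R)) : wf (G ++ H) = wf G && wf H.
Proof. by rewrite /wf all_cat. Qed.

Definition scale_seq a (G : seq (R * R)) := [seq (a * p.1, p.2) | p <- G].

Lemma flog_scale a G s : flog (scale_seq a G) s = a * flog G s.
Proof.
by rewrite /flog big_map mulr_sumr; apply: eq_bigr => p _ /=; rewrite mulrA.
Qed.

Lemma cost_scale (phi : R -> R) a G : cost phi (scale_seq a G) = a * cost phi G.
Proof.
by rewrite /cost big_map mulr_sumr; apply: eq_bigr => p _ /=; rewrite mulrA.
Qed.

Lemma wf_scale a (G : seq (R * R)) : 0 <= a -> wf G -> wf (scale_seq a G).
Proof.
move=> a0 /allP wG; apply/allP => _ /mapP[p /wG /andP[p1 p2] ->] /=.
by rewrite mulr_ge0.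
Qed.

Lemma log_integral_step G s : wf G -> 0 < s ->
  log_integral (step_fun G) s = (flog G s)%:E.
Proof.
move=> wG s0.
have sE : [set u : R | 0 < u < s] `<=` halfline R by move=> u /andP[].
have mS : measurable [set u : R | 0 < u < s].
  have -> : [set u : R | 0 < u < s] = `]0, s[%classic.
    by apply/seteqP; split=> u /=; rewrite in_itv.
  exact: measurable_itv.
have mi r : measurable_fun [set u : R | 0 < u < s] (fun u => (itv_indic r u * ln (s / u))%:E).
  apply/measurable_EFinP; apply: measurable_funM; apply/measurable_EFinP.
    apply: measurable_funS (noninc_measurable (itv_indic_noninc r)) => //.
    exact: measurable_halfline.
  exact: measurable_ln_div.
have l0 u : 0 < u < s -> 0 <= ln (s / u).
  by move=> /andP[u0 us]; rewrite ln_ge0// ler_pdivlMr// mul1r ltW.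
have i0 r u : 0 < u < s -> (0 <= (itv_indic r u * ln (s / u))%:E)%E.
  by move=> us; rewrite lee_fin mulr_ge0 ?l0 // /itv_indic.
elim: G wG => [|[a r] G IH].
  rewrite /log_integral /flog big_nil => _; apply: integral0_eq => u _.
  by rewrite /step_fun big_nil mul0r.
move=> /= /andP[/andP[/= a0 r0] wG].
rewrite /flog big_cons/= EFinD EFinM -(log_integral_itv_indic r0 s0) -[X in (_ + X)%E](IH wG).
have mk : measurable_fun [set u : R | 0 < u < s] (fun u => (step_fun G u * ln (s / u))%:E).
  apply/measurable_EFinP; apply: measurable_funM; apply/measurable_EFinP.
    apply: measurable_funS (noninc_measurable (step_fun_noninc wG)) => //.
    exact: measurable_halfline.
  exact: measurable_ln_div.
have k0 u : [set u : R | 0 < u < s] u -> (0 <= (step_fun G u * ln (s / u))%:E)%E.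
  move=> us; rewrite lee_fin mulr_ge0 ?l0//.
  by have [h _] := step_fun_noninc wG; rewrite -lee_fin h//; case/andP: us.
have ai0 u : [set u : R | 0 < u < s] u -> (0 <= a%:E * (itv_indic r u * ln (s / u))%:E)%E.
  by move=> us; rewrite mule_ge0 ?lee_fin// -lee_fin i0.
have mai : measurable_fun [set u : R | 0 < u < s]
    (fun u => a%:E * (itv_indic r u * ln (s / u))%:E)%E.
  exact: measurable_funeM.
have -> : (a%:E * log_integral (itv_indic r) s)%E =
    (\int[@lebesgue_measure R]_(u in [set u : R | (0 < u < s)%R])
       (a%:E * (itv_indic r u * ln (s / u))%:E))%E.
  apply/esym; apply: (ge0_integralZl (@lebesgue_measure R) mS (mi r) (i0 r)).
  by rewrite lee_fin.
apply: etrans (ge0_integralD (@lebesgue_measure R) mS ai0 mai k0 mk).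
by apply: eq_integral => u _; rewrite /step_fun big_cons/= mulrDl EFinD -mulrA EFinM.
Qed.

Lemma inv1D_noninc t : 0 < t -> noninc_halfline (fun u => ((1 + u / t)^-1)%:E).
Proof.
move=> t0; have p0 x : 0 < x -> 0 < 1 + x / t.
  by move=> x0; rewrite ltr_pwDl// divr_ge0// ltW.
split=> [u u0|u v u0 uv]; rewrite lee_fin; first by rewrite invr_ge0 ltW// p0.
rewrite lef_pV2 ?posrE ?p0//; last exact: lt_le_trans uv.
by rewrite lerD2l ler_pM2r ?invr_gt0.
Qed.

Lemma min_inv_noninc t : 0 < t -> noninc_halfline (fun u => (Num.min 1 (t / u))%:E).
Proof.
move=> t0; split=> [u u0|u v u0 uv]; rewrite lee_fin.
  by rewrite le_min ler01 divr_ge0// ltW.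
rewrite le_min !ge_min lexx/=; apply/orP; right.
rewrite ler_pM2l// lef_pV2 ?posrE//; exact: lt_le_trans uv.
Qed.

Lemma integral_inv1D t s : 0 < t -> 0 < s ->
  (\int[@lebesgue_measure R]_(u in `]0%R, s]) ((1 + u / t)^-1)%:E =
    (t * ln (1 + s / t))%:E)%E.
Proof.
move=> t0 s0.
have p0 x : 0 <= x -> 0 < 1 + x / t by move=> x0; rewrite ltr_pwDl// divr_ge0// ltW.
have cf x : 0 <= x -> {for x, continuous (fun u : R => (1 + u / t)^-1)}.
  move=> x0; apply: continuousV; first by rewrite gt_eqF// p0.
  apply: continuousD; first exact: cvg_cst.
  by apply: continuousM; [exact: cvg_id|exact: cvg_cst].
rewrite integral_itv_obnd_cbnd; last first.
  apply: measurable_funS (noninc_measurable (inv1D_noninc t0)).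
    exact: measurable_halfline.
  by move=> u /=; rewrite in_itv/= => /andP[].
rewrite [in RHS](_ : t * ln (1 + s / t) = t * ln (1 + s / t) - t * ln (1 + 0 / t)); last first.
  by rewrite mul0r addr0 ln1 mulr0 subr0.
apply: (@integral_itvcc_derive _ (fun u => (1 + u / t)^-1) (fun u => t * ln (1 + u / t))) => //.
- move=> x /andP[x0 _].
  have dln := is_derive1_ln (p0 _ x0).
  have D1 : is_derive x 1 (fun u => 1 + u / t) t^-1.
    by apply: is_derive_eq; rewrite /GRing.scale/= !add0r; ring.
  have D2 := @is_derive1_comp R (@ln R) (fun u => 1 + u / t) x _ _ dln D1.
  have D3 : is_derive x 1 (fun u => t * (@ln R \o (fun u => 1 + u / t)) u) ((1 + x / t)^-1).
    apply: is_derive_eq; rewrite /GRing.scale/=; field.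
    by apply/andP; split; rewrite gt_eqF//; lra.
  exact: D3.
- by move=> x /andP[x0 _]; exact: cf.
Qed.

Lemma integral_min_inv t s : 0 < t -> 0 < s ->
  (\int[@lebesgue_measure R]_(u in `]0%R, s]) (Num.min 1 (t / u))%:E =
    (mlog t s)%:E)%E.
Proof.
move=> t0 s0.
have one x : 0 < x -> x <= t -> (\int[@lebesgue_measure R]_(u in `]0%R, x]) (Num.min 1 (t / u))%:E = x%:E)%E.
  move=> x0 xt; transitivity (\int[@lebesgue_measure R]_(u in `]0%R, x]) (cst 1 u))%E.
    apply: eq_integral => u; rewrite inE/= in_itv/= => /andP[u0 ux].
    by rewrite (min_idPl _)// ler_pdivlMr// mul1r (le_trans ux).
  rewrite integral_cst// mul1e; apply: (etrans (lebesgue_measure_itv `]0%R, x])).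
  by rewrite /= lte_fin x0 oppr0 adde0.
rewrite /mlog; case: (leP s t) => st; first exact: one.
have -> : `]0%R, s]%classic = `]0%R, t] `|` `]t, s] :> set R.
  apply/seteqP; split=> x /=; rewrite !in_itv/=.
    by move=> /andP[x0 xs]; case: (leP x t) => xt; [left|right]; rewrite ?x0.
  by case=> /andP[h1 h2]; rewrite ?h1 ?h2 ?(le_trans h2 (ltW st))// (lt_trans t0).
have mm D : measurable D -> D `<=` halfline R ->
    measurable_fun D (fun u => (Num.min 1 (t / u))%:E).
  move=> mD Dh; apply: measurable_funS (noninc_measurable (min_inv_noninc t0)) => //.
  exact: measurable_halfline.
have h0 u : 0 < u -> (0 <= (Num.min 1 (t / u))%:E)%E.
  by move=> u0; have [h _] := min_inv_noninc t0; exact: h.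
have s1 : `]0, t]%classic `<=` halfline R by move=> u /=; rewrite in_itv/= => /andP[].
have s2 : `]t, s]%classic `<=` halfline R.
  by move=> u /=; rewrite in_itv/= => /andP[tu _]; exact: lt_trans tu.
rewrite ge0_integral_setU//; last 3 first.
- by apply: mm => [|u [/s1|/s2]//]; exact: measurableU.
- by move=> u [/s1|/s2] u0; exact: h0.
- apply/disj_set2P; rewrite -subset0 => u [] /=; rewrite !in_itv/= => /andP[_ ut] /andP[tu _].
  by move: ut; rewrite leNgt tu.
rewrite one// mulrDr mulr1 EFinD; congr (_ + _)%E.
transitivity (\int[@lebesgue_measure R]_(u in `]t, s]) (t / u)%:E)%E.
  apply: eq_integral => u; rewrite inE/= in_itv/= => /andP[tu _].
  by rewrite (min_idPr _)// ler_pdivrMr ?mul1r ?ltW// (lt_trans t0).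
have cf x : 0 < x -> {for x, continuous (fun u : R => t / u)}.
  move=> x0; apply: continuousM; first exact: cvg_cst.
  by apply: continuousV; [rewrite gt_eqF|exact: cvg_id].
rewrite integral_itv_obnd_cbnd; last first.
  apply: (@eq_measurable_fun _ _ _ _ _ (fun u => (Num.min 1 (t / u))%:E)).
    move=> u; rewrite inE/= in_itv/= => /andP[tu _].
    by rewrite (min_idPr _)// ler_pdivrMr ?mul1r ?ltW// (lt_trans t0).
  exact: mm.
rewrite ln_div ?posrE// mulrBr.
apply: (@integral_itvcc_derive _ (fun u => t / u) (fun u => t * ln u)) => //.
- move=> x /andP[tx _]; have x0 : 0 < x by exact: lt_le_trans tx.
  have dln := is_derive1_ln x0.
  by apply: is_derive_eq; rewrite /GRing.scale/=; field; rewrite gt_eqF.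
- by move=> x /andP[tx _]; apply: cf; exact: lt_le_trans tx.
Qed.

End MlogTheory.

(** * Majorization of finite sequences through transfers *)

Section Majorization.
Variables (R : realFieldType) (V : Type) (n : nat).
Implicit Types x y z : 'I_n -> R.

(** Muirhead's T-transform. The relation [P] below is abstract; it will be the inequality between
    the norms of two step functions. *)
Definition transfer (i j : 'I_n) (d : R) y : 'I_n -> R :=
  fun k => if k == i then y i - d else if k == j then y j + d else y k.

Variable P : ('I_n -> R) -> ('I_n -> R) -> Prop.
Hypothesis P_trans : forall x y z, P x y -> P y z -> P x z.
Hypothesis P_le : forall x y, (forall i, 0 <= x i) -> (forall i, x i <= y i) -> P x y.
Hypothesis P_transfer : forall i j d y, (forall k, 0 <= y k) -> i != j ->
  y j < y i -> 0 <= d <= y i - y j -> P (transfer i j d y) y.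

(* Each transfer makes one more coordinate of [y] agree with [x]: [x] being
   decreasing, the first [j] with [x j > y j] is preceded by some [i] with
   [y i > x i]. *)
Lemma majorized_ind x y : (forall i, 0 <= x i) -> (forall i, 0 <= y i) ->
  (forall i j : 'I_n, (i <= j)%N -> x j <= x i) ->
  (forall k : nat, \sum_(i < n | (i < k)%N) x i <= \sum_(i < n | (i < k)%N) y i) ->
  P x y.
Proof.
move=> x0 y0 xni.
have [m] := ubnP #|[pred i | x i != y i]|; elim: m => // m IH in y y0 *.
rewrite ltnS => ym xy.
have [/forallP xley|/forallPn[j0 j0P]] := boolP [forall i, x i <= y i].
  exact: P_le.
rewrite -ltNge in j0P.
pose j : 'I_n := [arg min_(k < j0 | y k < x k) (k : nat)].
have [yxj jmin] : y j < x j /\ forall k : 'I_n, y k < x k -> (j <= k)%N.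
  by rewrite /j; case: arg_minnP.
have xyk (k : 'I_n) : (k < j)%N -> x k <= y k.
  by rewrite leNgt => kj; apply/negP => /jmin; rewrite leqNgt kj.
have [i ij xyi] : exists2 i : 'I_n, (i < j)%N & x i < y i.
  apply: contrapT => h.
  have eqk (k : 'I_n) : (k < j)%N -> x k = y k.
    move=> kj; apply/eqP; rewrite eq_le xyk//= leNgt; apply/negP => xk.
    by apply: h; exists k.
  have := xy j.+1; rewrite (bigD1 j)//= [leRHS](bigD1 j)//=.
  rewrite [X in _ + X <= _](_ : _ = \sum_(k < n | (k < j.+1)%N && (k != j)) y k).
    by rewrite lerD2r leNgt yxj.
  apply: eq_bigr => k /andP[kj nkj]; apply: eqk.
  by rewrite ltn_neqAle nkj -ltnS.
pose d := Num.min (y i - x i) (x j - y j).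
have d0 : 0 < d by rewrite lt_min !subr_gt0 xyi.
have d1 : d <= y i - x i by rewrite ge_min lexx.
have d2 : d <= x j - y j by rewrite ge_min lexx orbT.
have nij : i != j by apply: contraTneq ij => ->; rewrite ltnn.
have xji : x j <= x i by apply: xni; exact: ltnW.
apply: P_trans (P_transfer (d := d) (i := i) (j := j) y0 nij _ _); last 2 first.
- by lra.
- by apply/andP; split; lra.
set y' := transfer i j d y.
have y'i : y' i = y i - d by rewrite /y' /transfer eqxx.
have y'j : y' j = y j + d by rewrite /y' /transfer eq_sym (negbTE nij) eqxx.
have y'k k : k != i -> k != j -> y' k = y k.
  by move=> ki kj; rewrite /y' /transfer (negbTE ki) (negbTE kj).
apply: IH.
- move=> k; have [->|ki] := eqVneq k i; first by rewrite y'i; have := x0 i; lra.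
  have [->|kj] := eqVneq k j; first by rewrite y'j addr_ge0// ltW.
  by rewrite y'k.
- apply: leq_trans ym; apply: proper_card; apply/properP; split.
    apply/fintype.subsetP => k; rewrite !inE.
    have [->|ki] := eqVneq k i; first by rewrite (lt_eqF xyi).
    have [->|kj] := eqVneq k j; first by rewrite (gt_eqF yxj).
    by rewrite y'k.
  have [dd|dd] := leP (y i - x i) (x j - y j).
    exists i; rewrite !inE ?(lt_eqF xyi)// y'i /d (min_idPl dd).
    by rewrite negbK; apply/eqP; ring.
  exists j; rewrite !inE ?(gt_eqF yxj)// y'j /d (min_idPr (ltW dd)).
  by rewrite negbK; apply/eqP; ring.
(* Only prefixes containing [i] but not [j] lose mass. There the comparison is termwise: coordinates
   before [j] satisfy [x <= y] by minimality of [j], and coordinate [i] stays above [x i] by the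
   choice of [d]. *)
- move=> k.
  have [ik|ki] := ltnP i k; last first.
    rewrite (le_trans (xy k))// le_eqVlt; apply/orP; left; apply/eqP.
    apply: eq_bigr => l lk; rewrite y'k//.
      by apply: contraTneq lk => ->; rewrite -leqNgt.
    by apply: contraTneq lk => ->; rewrite -leqNgt (leq_trans ki)// ltnW.
  have [jk|kj] := ltnP j k.
    rewrite (le_trans (xy k))// le_eqVlt; apply/orP; left; apply/eqP.
    have split2 z : \sum_(l < n | (l < k)%N) z l =
        z i + (z j + \sum_(l < n | ((l < k)%N && (l != i)) && (l != j)) z l).
      by rewrite (bigD1 i)//= (bigD1 j)//= jk eq_sym.
    rewrite !split2 y'i y'j [in RHS](eq_bigr y); first by ring.
    by move=> l /andP[/andP[_ li] lj]; rewrite y'k.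
  rewrite (bigD1 i)//= [leRHS](bigD1 i)//= y'i.
  apply: lerD; first by lra.
  apply: ler_sum => l /andP[lk li]; rewrite y'k//; last first.
    by apply: contraTneq lk => ->; rewrite -leqNgt.
  by apply: xyk; exact: leq_trans kj.
Qed.

End Majorization.

(** * The function W of a space, and majorization for its norm *)

Section RiNorm.
Local Open Scope ereal_scope.
Variables (R : realType) (X : ri_function_norm R).
Implicit Types f g : R -> \bar R.

Lemma ae_halfline_all (Q : R -> Prop) : (forall x, (0 < x)%R -> Q x) -> ae_halfline Q.
Proof. by move=> h; apply: aeW => x; exact: h. Qed.

Lemma Mplus_noninc g : noninc_halfline g -> Mplus g.
Proof. by move=> gn; split; [exact: noninc_measurable|case: gn]. Qed.

Lemma MplusZ (a : R) f : (0 <= a)%R -> Mplus f -> Mplus (fun x => a%:E * f x).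
Proof.
move=> a0 [mf f0]; split; first exact: measurable_funeM.
by move=> x x0; rewrite mule_ge0 ?f0.
Qed.

Lemma Mplus_eq f g : Mplus f -> (forall x, (0 < x)%R -> f x = g x) -> Mplus g.
Proof.
move=> [mf f0] fg; split=> [|x x0]; last by rewrite -fg ?f0.
by apply: eq_measurable_fun mf => x; rewrite inE; exact: fg.
Qed.

Lemma fnorm_le_halfline f g : Mplus f -> Mplus g ->
  (forall x, (0 < x)%R -> f x <= g x) -> X f <= X g.
Proof. by move=> Mf Mg fg; apply: fnorm_le => //; exact: ae_halfline_all. Qed.

Lemma fnorm_eq_halfline f g : Mplus f -> (forall x, (0 < x)%R -> f x = g x) ->
  X f = X g.
Proof.
move=> Mf fg; have Mg := Mplus_eq Mf fg.
by apply/eqP; rewrite eq_le !fnorm_le_halfline// => x x0; rewrite fg.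
Qed.

Let kf (t : R) : R -> \bar R := fun s => ((1 + s / t)^-1)%:E.

Lemma Mplus_kf t : (0 < t)%R -> Mplus (kf t).
Proof. by move=> t0; apply: Mplus_noninc; exact: inv1D_noninc. Qed.

Lemma WE t : (0 < t)%R -> W X t = X (kf t).
Proof.
move=> t0; apply/esym/fnorm_eq_halfline; first exact: Mplus_kf.
by move=> x x0; rewrite /kf /= ger0_norm// invr_ge0 addr_ge0// divr_ge0 ?ltW.
Qed.

Lemma W_gt0 t : (0 < t)%R -> 0 < W X t.
Proof.
move=> t0; rewrite WE// lt_def fnorm_ge0 ?andbT; last exact: Mplus_kf.
apply/eqP => /(fnorm_eq0 _ (Mplus_kf t0)) [N [mN N0 hN]].
have hh : halfline R `<=` N.
  move=> x x0; apply: hN => /= /(_ x0)/eqP; rewrite eqe gt_eqF// invr_gt0.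
  by rewrite ltr_pwDl// divr_ge0 ?ltW.
have : @lebesgue_measure R (`]0%R, 1%R]%classic : set R) <= @lebesgue_measure R N.
  apply: le_measure; rewrite ?inE//.
  by apply: subset_trans hh => x /=; rewrite in_itv/= => /andP[].
rewrite [leRHS]N0 lebesgue_measure_itv/= lte_fin ltr01 oppr0 adde0 lee_fin.
by rewrite leNgt ltr01.
Qed.

Lemma W_le s t : (0 < s)%R -> (s <= t)%R -> W X s <= W X t.
Proof.
move=> s0 st; have t0 : (0 < t)%R by exact: lt_le_trans st.
rewrite !WE//; apply: fnorm_le_halfline; [exact: Mplus_kf..|].
move=> x x0; have p r : (0 < r)%R -> (0 < 1 + x / r)%R.
  by move=> r0; rewrite ltr_pwDl// divr_ge0 ?ltW.
rewrite lee_fin lef_pV2 ?posrE ?p//.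
by rewrite lerD2l ler_pM2l// lef_pV2 ?posrE.
Qed.

(** [(1 + x / t)^-1 / t] equals [(t + x)^-1], which decreases in [t]. *)
Lemma W_div s t : (0 < s)%R -> (s <= t)%R -> (t^-1)%:E * W X t <= (s^-1)%:E * W X s.
Proof.
move=> s0 st; have t0 : (0 < t)%R by exact: lt_le_trans st.
have si : (0 <= s^-1)%R by rewrite invr_ge0 ltW.
have ti : (0 <= t^-1)%R by rewrite invr_ge0 ltW.
rewrite !WE// -!fnormZ//; try exact: Mplus_kf.
apply: fnorm_le_halfline; [by apply: MplusZ => //; exact: Mplus_kf..|].
move=> x x0; rewrite -!EFinM lee_fin -!invfM !mulrDr !mulr1 !(mulrC _ (x / _)%R).
rewrite !divfK ?gt_eqF// lef_pV2 ?posrE ?addr_gt0//.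
by rewrite lerD2r.
Qed.

Lemma W_fin t : carrier (ri_norm X) (fun s => ((1 + s)^-1)%:E) -> (0 < t)%R ->
  W X t \is a fin_num.
Proof.
move=> [_ h] t0.
have W1 : W X 1%R < +oo.
  rewrite /W; congr (_ < _) : h; congr (ri_norm X _); apply/funext => s.
  by rewrite divr1.
rewrite ge0_fin_numE; last by rewrite ltW// W_gt0.
have [t1|t1] := leP t 1%R; first exact: le_lt_trans (W_le t0 t1) W1.
have := W_div ltr01 (ltW t1); rewrite invr1 mul1e => h'.
have : (t^-1)%:E * W X t < +oo by exact: le_lt_trans W1.
have := W_gt0 t0; case: (W X t) => [r _ _||//]; first by rewrite ltry.
by move=> _; rewrite gt0_muley ?ltxx// lte_fin invr_gt0.
Qed.

Lemma W_quasi_concave : carrier (ri_norm X) (fun s => ((1 + s)^-1)%:E) ->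
  quasi_concave (fun t => fine (W X t)).
Proof.
move=> hX; split.
- move=> t t0; apply: fine_gt0; apply/andP; split; first exact: W_gt0.
  by rewrite -ge0_fin_numE ?W_fin//; exact/ltW/W_gt0.
- move=> s t s0 st; have t0 : (0 < t)%R by exact: lt_le_trans st.
  by apply: fine_le; rewrite ?W_fin// W_le.
- move=> s t s0 st; have t0 : (0 < t)%R by exact: lt_le_trans st.
  by rewrite -lee_fin !EFinM ?fineK ?W_fin// !(muleC (W X _)) W_div.
Qed.

Section Cells.
Variables (n : nat) (C : 'I_n -> set R) (a : R).
Hypotheses (mC : forall i, measurable (C i)) (Ch : forall i, C i `<=` halfline R)
  (tC : trivIset setT C) (Ca : forall i, @lebesgue_measure R (C i) = a%:E).
Implicit Types y z : 'I_n -> R.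

Definition cell_step y u : \bar R := (\sum_(i < n) y i * \1_(C i) u)%:E.

Lemma cell_stepE y i u : C i u -> cell_step y u = (y i)%:E.
Proof.
move=> Cu; rewrite /cell_step (bigD1 i)//= indicE mem_set// mulr1 big1 ?addr0// => j ji.
rewrite indicE memNset ?mulr0// => Cj.
have : C i `&` C j !=set0 by exists u.
by move/(tC I I) => ij; move: ji; rewrite ij eqxx.
Qed.

Lemma cell_step_out y u : (forall i, ~ C i u) -> cell_step y u = 0.
Proof.
by move=> h; rewrite /cell_step big1// => i _; rewrite indicE memNset ?mulr0.
Qed.

Lemma Mplus_cell_step y : (forall i, 0 <= y i)%R -> Mplus (cell_step y).
Proof.
move=> y0; split.
  apply/measurable_EFinP; apply: measurable_sum => i.
  by apply: measurable_funM; [exact: measurable_cst|exact: measurable_indic].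
by move=> x _; rewrite lee_fin sumr_ge0// => i _; rewrite mulr_ge0.
Qed.

Lemma distribution_cell_step y (l : R) : (forall i, 0 <= y i)%R -> (0 <= l)%R ->
  distribution_fun (cell_step y) l = (\sum_(i < n | (l < y i)%R) a)%:E.
Proof.
move=> y0 l0; rewrite /distribution_fun.
transitivity (@lebesgue_measure R (\big[setU/set0]_(i < n | (l < y i)%R) C i)); last first.
  rewrite measure_bigsetU_ord// -sumEFin; apply: eq_bigr => i _; exact: Ca.
congr (lebesgue_measure _); rewrite -bigcup_pred.
apply/seteqP; split=> [u [u0 lu]|u [i /= lyi Ciu]].
  have {}lu : l%:E < `|cell_step y u| := lu.
  case: (pselect (exists i, C i u)) => [[i Ciu]|nC].
    exists i => //=; move: lu.
    by rewrite (cell_stepE _ Ciu) abse_EFin lte_fin ger0_norm.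
  move: lu; rewrite cell_step_out ?abse0 ?lte_fin ?ltNge ?l0// => i Ci.
  by apply: nC; exists i.
split; first exact: Ch Ciu.
suff : l%:E < `|cell_step y u| by [].
by rewrite (cell_stepE _ Ciu) abse_EFin lte_fin ger0_norm.
Qed.

(** The cells have the same measure, so permuting the values leaves the distribution function
    unchanged. *)
Lemma fnorm_cell_swap y (i j : 'I_n) : (forall i, 0 <= y i)%R ->
  X (cell_step (y \o tperm i j)) = X (cell_step y).
Proof.
move=> y0; apply: fnorm_ri.
- by apply: Mplus_cell_step => k /=.
- exact: Mplus_cell_step.
- by apply: ae_halfline_all => x _; rewrite ltry.
- by apply: ae_halfline_all => x _; rewrite ltry.
move=> l l0; have y'0 k : (0 <= (y \o tperm i j) k)%R by exact: y0.
rewrite (distribution_cell_step y'0 l0) (distribution_cell_step y0 l0); congr EFin.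
by rewrite [RHS](reindex_inj (@perm_inj _ (tperm i j))).
Qed.

(** With [b = d / (y i - y j)], a number in [0, 1], the transferred sequence is the convex
    combination of [y] and of [y] with [i], [j] swapped, with weights 1 - b and b. Both have the
    same norm, and the triangle inequality concludes. *)
Lemma fnorm_cell_transfer (i j : 'I_n) d y : (forall k, 0 <= y k)%R -> i != j ->
  (y j < y i)%R -> (0 <= d <= y i - y j)%R ->
  X (cell_step (transfer i j d y)) <= X (cell_step y).
Proof.
move=> y0 nij yij /andP[d0 dy]; have D0 : (0 < y i - y j)%R by rewrite subr_gt0.
pose b := (d / (y i - y j))%R.
have b0 : (0 <= b)%R by rewrite divr_ge0// ltW.
have b1 : (0 <= 1 - b)%R by rewrite subr_ge0 ler_pdivrMr// mul1r.
pose y' := y \o tperm i j.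
have y'0 k : (0 <= y' k)%R by exact: y0.
have M1 := Mplus_cell_step y0; have M2 := Mplus_cell_step y'0.
have -> : cell_step (transfer i j d y) =
    fun u => (1 - b)%:E * cell_step y u + b%:E * cell_step y' u.
  apply/funext => u; rewrite /cell_step -!EFinM -EFinD; congr EFin.
  rewrite !mulr_sumr -big_split/=; apply: eq_bigr => k _.
  rewrite !mulrA -mulrDl; congr (_ * _)%R; rewrite /y' /= /transfer.
  have bd : (b * (y i - y j) = d)%R by rewrite /b divfK// gt_eqF.
  have [->|ki] := eqVneq k i; first by rewrite tpermL -bd; ring.
  have [->|kj] := eqVneq k j; first by rewrite tpermR -bd; ring.
  by rewrite tpermD 1?eq_sym//; ring.
apply: (le_trans (fnormD _ (MplusZ b1 M1) (MplusZ b0 M2))).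
rewrite !fnormZ// fnorm_cell_swap// -ge0_muleDl ?lee_fin//.
by rewrite -EFinD subrK mul1e.
Qed.

(** The Hardy-Littlewood-Polya principle for functions constant on finitely many cells of equal
    measure, derived from equimeasurability and convexity of the norm. *)
Lemma fnorm_cell_majorized x y : (forall i, 0 <= x i)%R -> (forall i, 0 <= y i)%R ->
  (forall i j : 'I_n, (i <= j)%N -> x j <= x i)%R ->
  (forall k : nat, \sum_(i < n | (i < k)%N) x i <= \sum_(i < n | (i < k)%N) y i)%R ->
  X (cell_step x) <= X (cell_step y).
Proof.
apply: (majorized_ind (P := fun x y => X (cell_step x) <= X (cell_step y))).
- by move=> u v w; exact: le_trans.
- move=> u v u0 uv; have v0 i : (0 <= v i)%R by exact: le_trans (uv i).
  apply: fnorm_le_halfline; [exact: Mplus_cell_step..|move=> z _].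
  by rewrite lee_fin; apply: ler_sum => i _; rewrite ler_wpM2r.
- exact: fnorm_cell_transfer.
Qed.

End Cells.
End RiNorm.

(** * Step functions below a decreasing function *)

Section Minorant.
Variable R : realType.
Implicit Types (g : R -> R) (G : seq (R * R)).

Lemma ln2_ge_half : 1 / 2 <= ln 2 :> R.
Proof. by have := @ln_ge_1subV R 2; lra. Qed.

(** Between consecutive scales [flog] increases and 1 + 2^(J+1) <= (1 + 2^J)^2, which costs a factor
    2 in the logarithm. Below [t], [flog G s / s] decreases and ln(1 + s/t) <= s/t, so the value at
    [t] decides, with ln 2 >= 1/2. *)
Lemma flog_dyadic G (t b : R) (J : nat) : wf G -> 0 < t -> 0 <= b ->
  (forall j, (j <= J)%N -> b * (t * ln (1 + 2 ^+ j)) <= flog G (2 ^+ j * t)) ->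
  forall s, 0 < s -> s <= 2 ^+ J * t -> b / 2 * (t * ln (1 + s / t)) <= flog G s.
Proof.
move=> wG t0 b0; have bt0 : 0 <= b * t by rewrite mulr_ge0// ltW.
elim: J => [|J IH] h s s0.
  rewrite expr0 mul1r => st.
  have := h 0%N isT; rewrite expr0 mul1r => h0.
  have l2 : ln (1 + s / t) <= s / t.
    by apply: le_ln1Dx; rewrite (lt_trans _ (divr_gt0 s0 t0))// oppr_lt0.
  have h1 : b * (t * (1 / 2)) <= flog G t.
    have e2 : 1 + 1 = 2 :> R by ring.
    rewrite e2 in h0; apply: le_trans h0.
    by have := ler_wpM2l bt0 ln2_ge_half; lra.
  have h2 := flog_div wG s0 st.
  have h3 : b / 2 * (t * ln (1 + s / t)) <= b / 2 * s.
    rewrite ler_wpM2l ?divr_ge0// -ler_pdivlMl// mulrC.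
    by rewrite mulrC.
  apply: (le_trans h3); rewrite -(ler_pM2l t0); apply: le_trans h2.
  have := ler_wpM2l (ltW s0) h1; lra.
move=> sJ; have [sJ'|sJ'] := leP s (2 ^+ J * t).
  by apply: IH => // j jJ; apply: h; exact: leqW.
have J0 : 0 < 2 ^+ J :> R by rewrite exprn_gt0.
have := h J (leqnSn _); move=> hJ; apply: (le_trans _ (flog_le wG _ (ltW sJ'))); last first.
  by rewrite mulr_gt0.
apply: le_trans hJ.
have e : ln (1 + s / t) <= ln ((1 + 2 ^+ J) ^+ 2).
  have st0 : 0 < s / t by rewrite divr_gt0.
  rewrite ler_ln ?posrE ?exprn_gt0 ?addr_gt0//.
  have : s / t <= 2 ^+ J.+1 by rewrite ler_pdivrMr.
  rewrite exprS; nra.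
move: e; rewrite lnXn ?addr_gt0// mulr2n => /(ler_wpM2l bt0); lra.
Qed.

(** A telescoping sum: the value is [g e] on (0, e], then g(2^k e) on each (2^(k-1) e, 2^k e] for k
    <= M, and 0 afterwards. Sampling at right ends keeps it below [g]. *)
Fixpoint dyadic_step g (M : nat) (e : R) : seq (R * R) :=
  if M is M'.+1 then (g e - g (2 * e), e) :: dyadic_step g M' (2 * e)
  else [:: (g e, e)].

Lemma step_fun_cons (a r : R) G u :
  step_fun ((a, r) :: G) u = a * itv_indic r u + step_fun G u.
Proof. by rewrite /step_fun big_cons. Qed.

Lemma step_fun_nil (u : R) : step_fun [::] u = 0.
Proof. by rewrite /step_fun big_nil. Qed.

Lemma wf_dyadic_step g M e : decreasing_halfline g -> 0 < e -> wf (dyadic_step g M e).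
Proof.
move=> [g0 gd]; elim: M e => [|M IH] e e0 /=; first by rewrite g0//= e0.
by rewrite e0 subr_ge0 gd ?IH ?mulr_gt0//; lra.
Qed.

Lemma dyadic_step_small g M e u : u <= e -> 0 < e -> step_fun (dyadic_step g M e) u = g e.
Proof.
elim: M e => [|M IH] e ue e0 /=.
  by rewrite step_fun_cons step_fun_nil /itv_indic ue mulr1 addr0.
by rewrite step_fun_cons IH; [rewrite /itv_indic ue mulr1 subrK|lra..].
Qed.

Lemma dyadic_step_le g M e u : decreasing_halfline g -> 0 < e -> 0 < u ->
  step_fun (dyadic_step g M e) u <= g u.
Proof.
move=> gD; have [g0 gd] := gD; elim: M e => [|M IH] e e0 u0.
  have [ue|eu] := leP u e; first by rewrite dyadic_step_small// gd.
  by rewrite step_fun_cons step_fun_nil /itv_indic (leNgt u e) eu mulr0 addr0 g0.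
have [ue|eu] := leP u e; first by rewrite dyadic_step_small// gd.
by rewrite step_fun_cons /itv_indic (leNgt u e) eu mulr0 add0r IH// mulr_gt0.
Qed.

(** Halving [u] moves it to a cell whose right end is at most [u], unless [u / 2] already lies in
    (0, e], where the value is [g e]. *)
Lemma dyadic_step_ge g M e u : decreasing_halfline g -> 0 < e -> e <= u ->
  u <= 2 ^+ M.+1 * e -> g u <= step_fun (dyadic_step g M e) (u / 2).
Proof.
move=> gD; have [g0 gd] := gD; elim: M e => [|M IH] e e0 eu uM.
  rewrite dyadic_step_small//; first exact: gd.
  by rewrite expr1 in uM; lra.
have [ue|ue] := leP u (2 * e); first by rewrite dyadic_step_small ?gd//; lra.
rewrite /= step_fun_cons /itv_indic [_ <= e]leNgt (_ : e < u / 2) ?mulr0 ?add0r; last lra.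
apply: IH; [lra|lra|].
by rewrite exprSr -mulrA in uM.
Qed.

Definition double_seq G := [seq (p.1, 2 * p.2) | p <- G].

Lemma step_fun_double G u : step_fun (double_seq G) u = step_fun G (u / 2).
Proof.
rewrite /step_fun big_map; apply: eq_bigr => p _ /=; rewrite /itv_indic.
by rewrite ler_pdivrMr// (mulrC p.2).
Qed.

Lemma wf_double G : wf G -> wf (double_seq G).
Proof.
move=> /allP wG; apply/allP => _ /mapP[p /wG /andP[p1 p2] ->] /=.
by rewrite p1 mulr_gt0.
Qed.

Lemma flog_double G s : wf G -> 0 < s -> flog (double_seq G) s <= 2 * flog G s.
Proof.
move=> wG s0; rewrite /flog big_map mulr_sumr.
under [leRHS]eq_bigr do rewrite mulrCA.
exact: (@ler_sum_wf R G (fun r => mlog (2 * r) s) (fun r => 2 * mlog r s) wG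
  (fun x hx => mlog_double hx s0)).
Qed.

(** Monotone convergence on sets increasing to (0, s): a cutoff near 0 retains more than half of
    [B], even when the full integral is infinite. *)
Lemma log_integral_approx g (s B : R) : decreasing_halfline g -> 0 < s -> 0 < B ->
  (B%:E <= log_integral g s)%E ->
  exists n0, forall n, (n0 <= n)%N ->
   ((B / 2)%:E <= \int[@lebesgue_measure R]_(u in `[n.+1%:R^-1%R, s[)
      (g u * ln (s / u))%:E)%E.
Proof.
move=> [g0 gd] s0 B0; pose F n := `[n.+1%:R^-1, s[%classic : set R.
have n0 n : 0 < n.+1%:R^-1 :> R by rewrite invr_gt0.
have FU : \bigcup_n F n = [set u : R | 0 < u < s].
  apply/seteqP; split=> [x [n _]|x] /=; rewrite /F/= ?in_itv/= => /andP[h1 h2].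
    by rewrite h2 (lt_le_trans _ h1).
  exists (Num.truncn x^-1) => //=; rewrite in_itv/= h2 andbT.
  by rewrite invf_ple ?posrE// ltW// truncnS_gt.
have gn : noninc_halfline (EFin \o g).
  by split=> [u u0|u v u0 uv]; rewrite lee_fin ?g0 ?gd.
have Fh n : F n `<=` halfline R.
  by move=> u; rewrite /F/= in_itv/= => /andP[+ _]; exact: lt_le_trans.
have mF n : measurable_fun (F n) (fun u => (g u * ln (s / u))%:E).
  apply/measurable_EFinP; apply: measurable_funM; apply/measurable_EFinP.
    apply: measurable_funS (noninc_measurable gn) => //; exact: measurable_halfline.
  exact: measurable_ln_div.
have F0 n u : F n u -> (0 <= (g u * ln (s / u))%:E)%E.
  move=> Fu; have u0 := Fh _ _ Fu; move: Fu; rewrite /F/= in_itv/= => /andP[_ us].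
  by rewrite lee_fin mulr_ge0 ?g0// ln_ge0// ler_pdivlMr// mul1r ltW.
have Fnd : nondecreasing_seq F.
  move=> m n mn; apply/subsetPset => x; rewrite /F/= !in_itv/= => /andP[h1 ->].
  by rewrite andbT (le_trans _ h1)// lef_pV2 ?posrE// ler_nat ltnS.
rewrite /log_integral -FU => hB.
have h : (\int[@lebesgue_measure R]_(x in F i) (g x * ln (s / x))%:E @[i --> \oo] -->
    \int[@lebesgue_measure R]_(x in \bigcup_i F i) (g x * ln (s / x))%:E)%E.
  apply: ge0_nondecreasing_set_cvg_integral;
    [exact: Fnd|move=> i; exact: measurable_itv|exact: mF|exact: F0].
have B2 : ((B / 2)%:E < \int[@lebesgue_measure R]_(x in \bigcup_i F i) (g x * ln (s / x))%:E)%E.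
  by apply: lt_le_trans hB; rewrite lte_fin; lra.
have : \forall n \near \oo, ((B / 2)%:E < \int[@lebesgue_measure R]_(x in F n) (g x * ln (s / x))%:E)%E.
  exact: (h _ (open_ereal_gt' B2)).
move=> [N _ hN]; exists N => n Nn; apply: ltW; exact: hN.
Qed.

(** The constant 1/4 loses one half to the cutoff near 0 and one half to the dilation by 2 that
    lifts the dyadic step function above [g]. Only finitely many [j] are served because one cutoff
    [e] must suit all of them, which is why [n] is a maximum over [j <= J]. *)
Lemma step_minorant g (t : R) (J : nat) : decreasing_halfline g -> 0 < t ->
  (forall s, 0 < s -> ((t * ln (1 + s / t))%:E <= log_integral g s)%E) ->
  exists G, [/\ wf G, (forall u, 0 < u -> step_fun G u <= g u) &
   forall j, (j <= J)%N -> 1 / 4 * (t * ln (1 + 2 ^+ j)) <= flog G (2 ^+ j * t)].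
Proof.
move=> gD t0 hg; have [g0 gd] := gD.
have gn : noninc_halfline (EFin \o g).
  by split=> [u u0|u v u0 uv]; rewrite lee_fin ?g0 ?gd.
have B0 j : 0 < t * ln (1 + 2 ^+ j) by rewrite mulr_gt0// ln_gt0// ltrDl exprn_gt0.
have s0 j : 0 < 2 ^+ j * t by rewrite mulr_gt0// exprn_gt0.
have hgj j : ((t * ln (1 + 2 ^+ j))%:E <= log_integral g (2 ^+ j * t))%E.
  by have := hg _ (s0 j); rewrite mulfK ?gt_eqF.
have /choice[N hN] j := log_integral_approx gD (s0 j) (B0 j) (hgj j).
pose n := (\max_(j < J.+1) N j)%N; pose e : R := n.+1%:R^-1.
have e0 : 0 < e by rewrite invr_gt0.
have [M hM] : exists M, 2 ^+ J * t <= 2 ^+ M.+1 * e.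
  exists (Num.truncn (2 ^+ J * t / e)); rewrite -ler_pdivrMr//.
  set m := Num.truncn _; have -> : 2 ^+ m.+1 = (2 ^ m.+1)%N%:R :> R by rewrite natrX.
  by rewrite (le_trans (ltW (truncnS_gt _)))// ler_nat ltnW// ltn_expl.
pose G := dyadic_step g M e.
have wG : wf G by exact: wf_dyadic_step.
exists G; split => // [u u0|j jJ]; first exact: dyadic_step_le.
have jn : (N j <= n)%N.
  have jJ' : (j < J.+1)%N by [].
  exact: (@leq_bigmax_cond _ xpredT (fun j : 'I_J.+1 => N j) (Ordinal jJ')).
have sj := s0 j; set s := 2 ^+ j * t in sj *.
have sJ : s <= 2 ^+ J * t by rewrite /s ler_pM2r// ler_eXn2l// ltr1n.
have h1 := hN j n jn; rewrite -/e -/s in h1.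
suff h2 : (\int[@lebesgue_measure R]_(u in `[e, s[) (g u * ln (s / u))%:E <=
    log_integral (step_fun (double_seq G)) s)%E.
  have := le_trans h1 h2; rewrite log_integral_step ?wf_double// lee_fin.
  by have := flog_double wG sj; lra.
have sub : `[e, s[ `<=` [set u : R | 0 < u < s].
  by move=> u /=; rewrite in_itv/= => /andP[eu ->]; rewrite (lt_le_trans e0).
have lnm (D : set R) : D `<=` halfline R -> measurable_fun D (fun u => ln (s / u)).
  by move=> Dh; apply/measurable_EFinP; exact: measurable_ln_div.
have ln0 u : 0 < u < s -> 0 <= ln (s / u).
  by move=> /andP[u0 us]; rewrite ln_ge0// ler_pdivlMr// mul1r ltW.
have mD : measurable [set u : R | 0 < u < s].
  have -> : [set u : R | 0 < u < s] = `]0, s[%classic.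
    by apply/seteqP; split=> u /=; rewrite in_itv.
  exact: measurable_itv.
have gm (k : R -> R) (D : set R) : noninc_halfline (EFin \o k) -> measurable D -> D `<=` halfline R ->
    measurable_fun D (fun u => (k u * ln (s / u))%:E).
  move=> kn mD' Dh; apply/measurable_EFinP; apply: measurable_funM; last exact: lnm.
  apply/measurable_EFinP; apply: measurable_funS (noninc_measurable kn) => //.
  exact: measurable_halfline.
have subh : [set u : R | 0 < u < s] `<=` halfline R by move=> u /andP[].
have subh' : `[e, s[ `<=` halfline R by exact: subset_trans subh.
have Gn := step_fun_noninc (wf_double wG).
have G0 u : 0 < u < s -> (0 <= (step_fun (double_seq G) u * ln (s / u))%:E)%E.
  move=> us; rewrite lee_fin mulr_ge0 ?ln0//.
  by have [h _] := Gn; rewrite -lee_fin h//; case/andP: us.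
apply: (@le_trans _ _ (\int[@lebesgue_measure R]_(u in `[e, s[)
    (step_fun (double_seq G) u * ln (s / u))%:E)%E).
  apply: ge0_le_integral.
  - exact: measurable_itv.
  - by move=> u /sub us; rewrite lee_fin mulr_ge0 ?ln0// g0//; case/andP: us.
  - by apply: gm => //; exact: measurable_itv.
  - by apply: gm => //; exact: measurable_itv.
  - move=> u uI; have us := sub _ uI; rewrite lee_fin ler_wpM2r ?ln0//.
    rewrite step_fun_double; move: uI; rewrite /= in_itv/= => /andP[eu us'].
    by apply: dyadic_step_ge => //; rewrite (le_trans (ltW us'))// (le_trans sJ).
apply: ge0_subset_integral; [exact: measurable_itv|exact: mD|exact: gm|exact: G0|exact: sub].
Qed.

End Minorant.

(** * From bounds on transforms to bounds on norms *)

Section KernelBound.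
Variables (R : realType) (X : ri_function_norm R).
Hypothesis hX : carrier (ri_norm X) (fun s => ((1 + s)^-1)%:E).
Implicit Types (g : R -> R) (G : seq (R * R)).

Local Notation Wr := (fun t => fine (W X t)).

Definition kern G (u : R) : R := \sum_(p <- G) p.1 * Num.min 1 (p.2 / u).

Lemma kern_noninc G : wf G -> noninc_halfline (fun u => (kern G u)%:E).
Proof.
elim: G => [|[a r] G IH] /=.
  by split=> *; rewrite /kern !big_nil.
move=> /andP[/andP[/= a0 r0] wG].
have := nonincD (nonincZ a0 (min_inv_noninc r0)) (IH wG).
by congr noninc_halfline; apply/funext => u; rewrite /kern big_cons EFinD EFinM.
Qed.

Lemma fnorm_zero : X (fun=> 0%E) = 0%E.
Proof.
have M : Mplus (fun=> 0%E : \bar R) by split => //; exact: measurable_cst.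
by have := fnormZ X (lexx 0) M; rewrite !mul0e.
Qed.

(** Pointwise [min 1 (r / u)] is at most twice [(1 + u / r)^-1], whose norm is [W X r]; this is the
    factor 2. *)
Lemma fnorm_kern G : wf G -> (X (fun u => (kern G u)%:E) <= (2 * cost Wr G)%:E)%E.
Proof.
elim: G => [|[a r] G IH] /=.
  move=> _; rewrite /cost big_nil mulr0 -[leRHS]fnorm_zero le_eqVlt; apply/orP; left.
  by apply/eqP; congr (fnorm X _); apply/funext => u; rewrite /kern big_nil.
move=> /andP[/andP[/= a0 r0] wG].
have M1 := Mplus_noninc (min_inv_noninc r0).
have M2 := Mplus_noninc (kern_noninc wG).
rewrite (_ : (fun u => (kern ((a, r) :: G) u)%:E) =
  (fun u => a%:E * (Num.min 1 (r / u))%:E + (kern G u)%:E)%E); last first.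
  by apply/funext => u; rewrite /kern big_cons EFinD EFinM.
apply: le_trans (fnormD X (MplusZ a0 M1) M2) _.
rewrite /cost big_cons/= mulrDr EFinD leeD ?IH// fnormZ// mulrCA EFinM.
rewrite lee_wpmul2l ?lee_fin// EFinM fineK; last exact: W_fin.
rewrite WE// -fnormZ//; last exact: Mplus_kf.
apply: fnorm_le_halfline => //; first by apply: MplusZ => //; exact: Mplus_kf.
move=> u u0; rewrite -EFinM lee_fin.
have ru : 0 < 1 + u / r by rewrite ltr_pwDl// divr_ge0 ?ltW.
rewrite ler_pdivlMr//; have [ur|ru'] := leP u r.
  have : u / r <= 1 by rewrite ler_pdivrMr ?mul1r.
  have : Num.min 1 (r / u) <= 1 by rewrite ge_min lexx.
  have : 0 <= Num.min 1 (r / u) by rewrite le_min ler01 divr_ge0// ltW.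
  nra.
apply: (@le_trans _ _ (r / u * (1 + u / r))).
  by apply: ler_wpM2r; [exact: ltW|rewrite ge_min lexx orbT].
have -> : r / u * (1 + u / r) = r / u + 1 by field; rewrite !gt_eqF.
have : r / u <= 1 by rewrite ler_pdivrMr// mul1r ltW.
lra.
Qed.

Lemma seq_lbound G (t : R) : wf G -> 0 < t ->
  exists m, [/\ 0 < m, m <= t & forall p, p \in G -> m <= p.2].
Proof.
elim: G => [|[a r] G IH] /=; first by move=> _ t0; exists t.
move=> /andP[/andP[/= a0 r0] wG] t0; have [m [m0 mt mG]] := IH wG t0.
exists (Num.min m r); split; first by rewrite lt_min m0.
  by rewrite ge_min mt.
by move=> p; rewrite inE => /predU1P[->|/mG h]; rewrite ge_min ?lexx ?orbT// h.
Qed.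

(** [flog G] has the decreasing slope [kern G], so each increment is at most [d] times the slope at
    the left end, hence 2d times that at the right end, since k+1 <= 2k. In the first cell k = 0
    instead, and [d] being below every radius makes all the minima equal to 1. *)
Lemma flog_prefix G (d : R) k : wf G -> 0 < d -> (forall p, p \in G -> d <= p.2) ->
  flog G (k%:R * d) <= 2 * d * \sum_(i < k) kern G (i.+1%:R * d).
Proof.
move=> wG d0 dG; elim: k => [|k IH].
  rewrite mul0r big_ord0 mulr0 /flog big_seq big1// => p /(allP wG) /andP[p1 p2].
  by rewrite /mlog ltW// mulr0.
rewrite big_ord_recr/= mulrDr -lerBlDr.
apply: le_trans IH.
rewrite lerBlDr -lerBlDl /flog -sumrB /kern mulr_sumr.
rewrite big_seq [leRHS]big_seq; apply: ler_sum => p pG.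
have /andP[p1 p2] := allP wG _ pG; have dp := dG _ pG.
rewrite -mulrBr mulrCA ler_wpM2l//.
have [->|k0] := posnP k.
  rewrite mul0r mul1r /mlog dp (ltW p2) subr0 (min_idPl _); last first.
    by rewrite ler_pdivlMr// mul1r.
  lra.
have kd : 0 < k%:R * d by rewrite mulr_gt0// ltr0n.
have kk : k%:R * d <= k.+1%:R * d by rewrite ler_pM2r// ler_nat.
have k1d : 0 < k.+1%:R * d by exact: lt_le_trans kk.
have := mlog_step p2 kd kk; move/le_trans; apply.
have -> : k.+1%:R * d - k%:R * d = d by rewrite -mulrBl -natr1; ring.
rewrite (mulrC 2) -mulrA ler_pM2l//.
have h : p.2 / (k%:R * d) <= 2 * (p.2 / (k.+1%:R * d)).
  rewrite mulrCA ler_pM2l// ler_pdivlMr// ler_pdivrMl//.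
  have : 1 <= k%:R :> R by rewrite ler1n.
  by rewrite -natr1 => k1; nra.
move: (p.2 / (k%:R * d)) (p.2 / (k.+1%:R * d)) h => A B h.
by case: (leP 1 B) => hB; case: (leP 1 A) => hA; lra.
Qed.

(** A right-endpoint Riemann sum of a decreasing function is below its integral; each summand is
    compared by 1 - 1/x <= ln x. *)
Lemma ln_prefix (t d : R) k : 0 < t -> 0 < d ->
  d * \sum_(i < k) (1 + i.+1%:R * d / t)^-1 <= t * ln (1 + k%:R * d / t).
Proof.
move=> t0 d0; elim: k => [|k IH]; first by rewrite big_ord0 !mul0r addr0 ln1 !mulr0.
rewrite big_ord_recr/= mulrDr.
have p0 j : 0 < 1 + j%:R * d / t.
  by rewrite ltr_pwDl// divr_ge0 ?(ltW t0)// mulr_ge0 ?(ltW d0).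
have q0 : 0 < (1 + k.+1%:R * d / t) / (1 + k%:R * d / t) by rewrite divr_gt0.
have := @ln_ge_1subV R _ q0; rewrite ln_div ?posrE// => /(ler_wpM2l (ltW t0)).
suff -> : t * (1 - ((1 + k.+1%:R * d / t) / (1 + k%:R * d / t))^-1) =
    d * (1 + k.+1%:R * d / t)^-1 by lra.
have := p0 k.+1; have : 1 + k.+1%:R * d / t = 1 + k%:R * d / t + d / t.
  by rewrite -natr1; ring.
rewrite invf_div; move: (1 + k.+1%:R * d / t) (1 + k%:R * d / t) => B A BE B0.
have -> : t * (1 - A / B) = t * (B - A) / B by field; rewrite gt_eqF.
by rewrite BE; congr (_ / _); field; rewrite gt_eqF.
Qed.

(** Both functions are sampled at the right ends of equal cells covering (0, T], where the
    hypothesis becomes an inequality of prefix sums. Of the factor 1/4, one half pays for the 2 in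
    [flog_prefix] and one half for moving [(1 + u / t)^-1] to the right end of its cell. *)
Lemma fnorm_kern_ge G (t T b : R) : wf G -> 0 <= b -> 0 < t -> 0 < T ->
  (forall s, 0 < s -> s <= T -> b * (t * ln (1 + s / t)) <= flog G s) ->
  (X (fun u => (b / 4 * (1 + u / t)^-1 * itv_indic T u)%:E) <=
   X (fun u => (kern G u)%:E))%E.
Proof.
move=> wG b0 t0 T0 hb; have [m [m0 mt mG]] := seq_lbound wG t0.
(* The mesh [d] is below every radius of [G], as [flog_prefix] asks, and below [t], so that 1 + u/t
   at most doubles across a cell. *)
pose n := (Num.truncn (T / m)).+1; pose d := T / n%:R.
have n0 : 0 < n%:R :> R by rewrite ltr0n.
have d0 : 0 < d by rewrite divr_gt0.
have dm : d <= m by rewrite ler_pdivrMr// mulrC -ler_pdivrMr// ltW// truncnS_gt.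
have nd : n%:R * d = T by rewrite mulrC divfK// gt_eqF.
pose C (i : 'I_n) : set R := `]i%:R * d, i.+1%:R * d]%classic.
have mC i : measurable (C i) by exact: measurable_itv.
have Ch i : C i `<=` halfline R.
  move=> u; rewrite /C/= in_itv/= => /andP[+ _]; apply: le_lt_trans.
  by rewrite mulr_ge0 ?(ltW d0).
have CE (i : 'I_n) u : C i u -> i%:R < u / d <= i.+1%:R.
  by rewrite /C/= in_itv/= ltr_pdivlMr// ler_pdivrMr.
have tC : trivIset setT C.
  move=> i j _ _ [u [/CE /andP[i1 i2] /CE /andP[j1 j2]]]; apply: val_inj => /=.
  have := lt_le_trans i1 j2; have := lt_le_trans j1 i2; rewrite !ltr_nat !ltnS => a1 a2.
  by apply/eqP; rewrite eqn_leq a1 a2.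
have Ca i : @lebesgue_measure R (C i) = d%:E.
  rewrite /C; apply: (etrans (lebesgue_measure_itv `](i%:R * d), (i.+1%:R * d)])).
  by rewrite /= lte_fin ltr_pM2r// ltr_nat ltnSn -EFinB -natr1; congr EFin; ring.
pose x (i : 'I_n) := b / 2 * (1 + i.+1%:R * d / t)^-1.
pose y (i : 'I_n) := kern G (i.+1%:R * d).
have p0 u : 0 <= u -> 0 < 1 + u / t by move=> u0; rewrite ltr_pwDl// divr_ge0 ?(ltW t0).
have id0 (i : nat) : 0 < i.+1%:R * d by rewrite mulr_gt0.
have pi (i : nat) : 0 < 1 + i.+1%:R * d / t := p0 _ (ltW (id0 i)).
have x0 i : 0 <= x i.
  by rewrite mulr_ge0 ?divr_ge0// invr_ge0 ltW// p0// ltW.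
have [k0 knd] := kern_noninc wG.
have y0 i : 0 <= y i by rewrite -lee_fin k0.
have xni (i j : 'I_n) : (i <= j)%N -> x j <= x i.
  move=> ij; rewrite ler_wpM2l ?divr_ge0// lef_pV2 ?posrE ?pi//.
  by rewrite lerD2l !ler_pM2r ?invr_gt0// ler_nat ltnS.
have xy (k : nat) : \sum_(i < n | (i < k)%N) x i <= \sum_(i < n | (i < k)%N) y i.
  wlog kn : k / (k <= n)%N => [hw|].
    have [/hw//|nk] := leqP k n.
    have kT (i : 'I_n) : (i < k)%N = (i < n)%N by rewrite ltn_ord (ltn_trans (ltn_ord i)).
    by under eq_bigl do rewrite kT; under [leRHS]eq_bigl do rewrite kT; exact: hw.
  rewrite -(big_ord_widen n (fun i => b / 2 * (1 + i.+1%:R * d / t)^-1) kn).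
  rewrite -(big_ord_widen n (fun i => kern G (i.+1%:R * d)) kn).
  have [->|k0'] := posnP k; first by rewrite !big_ord0.
  have d20 : 0 < 2 * d by rewrite mulr_gt0.
  rewrite -mulr_sumr -(ler_pM2l d20).
  apply: le_trans (flog_prefix k wG d0 (fun p pG => le_trans dm (mG p pG))).
  have kd : 0 < k%:R * d by rewrite mulr_gt0// ltr0n.
  apply: le_trans (hb _ kd _); last by rewrite -nd ler_pM2r// ler_nat.
  have := ler_wpM2l b0 (ln_prefix k t0 d0); apply: le_trans.
  by rewrite le_eqVlt; apply/orP; left; apply/eqP; field.
have Mx := Mplus_cell_step mC x0; have My := Mplus_cell_step mC y0.
have Mk := Mplus_noninc (kern_noninc wG).
have h := fnorm_cell_majorized X mC Ch tC Ca x0 y0 xni xy.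
have MT : Mplus (fun u => (b / 4 * (1 + u / t)^-1 * itv_indic T u)%:E).
  have [mk _] := Mplus_kf t0; have [mi _] := Mplus_noninc (itv_indic_noninc T).
  split=> [|u u0]; last by rewrite lee_fin !mulr_ge0 ?divr_ge0 ?invr_ge0// ltW// p0// ltW.
  under eq_fun do rewrite EFinM EFinM; apply: emeasurable_funM => //.
  exact: measurable_funeM.
have find u : 0 < u -> u <= T -> exists i, C i u.
  move=> u0 uT; have ex : exists k : nat, u <= k.+1%:R * d.
    by exists (Num.truncn (T / m)); rewrite nd.
  case: (ex_minnP ex) => k uk kmin.
  have kn : (k < n)%N by rewrite ltnS kmin// nd.
  exists (Ordinal kn); rewrite /C/= in_itv/= uk andbT.
  case: k uk kmin {kn} => [|k] uk kmin; first by rewrite mul0r.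
  by rewrite ltNge; apply/negP => /kmin; rewrite ltnn.
apply: (@le_trans _ _ (X (cell_step C x))).
  apply: fnorm_le_halfline => // u u0.
  rewrite /itv_indic; case: (leP u T) => uT; last first.
    by rewrite mulr0; case: Mx => _; exact.
  have [i Ci] := find _ u0 uT; rewrite (cell_stepE tC _ Ci) mulr1 lee_fin /x.
  have -> : b / 4 = b / 2 / 2 by field.
  rewrite -mulrA ler_wpM2l ?divr_ge0// -invfM lef_pV2 ?posrE ?pi//; last first.
    by rewrite mulr_gt0// p0// ltW.
  move: Ci; rewrite /C/= in_itv/= => /andP[iu ui].
  have h1 : i.+1%:R * d / t <= u / t + 1.
    rewrite -[X in _ <= _ + X](divff (lt0r_neq0 t0)) -mulrDl ler_pM2r ?invr_gt0//.
    by rewrite -natr1 mulrDl mul1r; lra.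
  have : 0 < u / t by rewrite divr_gt0.
  lra.
apply: (le_trans h); apply: fnorm_le_halfline => // u u0.
case: (pselect (exists i, C i u)) => [[i Ci]|nC].
  rewrite (cell_stepE tC _ Ci) /y knd//.
  by move: Ci; rewrite /C/= in_itv/= => /andP[].
by rewrite cell_step_out ?k0// => i Ci; apply: nC; exists i.
Qed.

End KernelBound.

(** * Condition (i) implies condition (ii) *)

Section Necessity.
Local Open Scope ereal_scope.

Section LogTest.
Variables (R : realType) (X : ri_function_norm R).

Lemma decreasing_noninc (g : R -> R) : decreasing_halfline g -> noninc_halfline (EFin \o g).
Proof. by move=> [g0 gd]; split=> [u u0|u v u0 uv]; rewrite lee_fin ?g0 ?gd. Qed.

(** Each [n] has its own minorant of [g], but the bound [B] is common to all; the truncated kernels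
    increase to the kernel and the Fatou property concludes. The constant 1/32 is 1/4 from
    [step_minorant], 1/2 from [flog_dyadic] and 1/4 from [fnorm_kern_ge]; the 2 on the right is that
    of [fnorm_kern]. *)
Lemma W_le_stieltjes (g : R -> R) (t : R) :
  carrier (ri_norm X) (fun s => ((1 + s)^-1)%:E) ->
  decreasing_halfline g -> (0 < t)%R ->
  (forall s, (0 < s)%R -> (t * ln (1 + s / t))%:E <= log_integral g s) ->
  (1 / 32)%:E * W X t <= 2%:E * stieltjes (fun t => fine (W X t)) (EFin \o g).
Proof.
move=> hX gD t0 hg; have gn := decreasing_noninc gD.
have qcW := W_quasi_concave hX.
set B := 2%:E * _.
pose f n (u : R) : \bar R := (1 / 8 / 4 * (1 + u / t)^-1 * itv_indic (2 ^+ n * t) u)%:E.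
have fB n : X (f n) <= B.
  have [G [wG Gg hG]] := step_minorant n gD t0 hg.
  have b0 : (0 <= 1 / 4 :> R)%R by [].
  have hG' := flog_dyadic wG t0 b0 hG.
  have T0 : (0 < 2 ^+ n * t)%R by rewrite mulr_gt0// exprn_gt0.
  have b8 : (0 <= 1 / 8 :> R)%R by [].
  have e8 : (1 / 4 / 2 = 1 / 8 :> R)%R by field.
  rewrite e8 in hG'.
  apply: (le_trans (fnorm_kern_ge X wG b8 t0 T0 hG')).
  apply: (le_trans (fnorm_kern hX wG)).
  rewrite EFinM /B; apply: lee_wpmul2l; first by rewrite lee_fin.
  rewrite -(stieltjes_step qcW wG).
  apply: stieltjes_le => //; exact: step_fun_noninc.
have p0 u : (0 < u -> 0 < 1 + u / t)%R.
  by move=> u0; rewrite ltr_pwDl// divr_ge0 ?ltW.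
pose h (u : R) : \bar R := (1 / 32)%:E * ((1 + u / t)^-1)%:E.
have c0 : (0 <= 1 / 32 :> R)%R by [].
have Mh : Mplus h by apply: MplusZ => //; exact: Mplus_kf.
have Mf n : Mplus (f n).
  have [mk _] := Mplus_kf t0; have [mi _] := Mplus_noninc (itv_indic_noninc (2 ^+ n * t)).
  split=> [|u u0]; last by rewrite lee_fin !mulr_ge0 ?invr_ge0// ltW// p0// ltW.
  rewrite /f; under eq_fun do rewrite EFinM EFinM; apply: emeasurable_funM => //.
  exact: measurable_funeM.
rewrite WE// -(fnormZ X c0 (Mplus_kf t0)).
have lim_f : X (f n) @[n --> \oo] --> X h.
  apply: fnorm_fatou => //; apply: ae_halfline_all => u u0; split.
    move=> n; rewrite lee_fin ler_wpM2l//.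
      by rewrite mulr_ge0// invr_ge0 ltW// p0.
    have : (2 ^+ n * t <= 2 ^+ n.+1 * t)%R.
      by rewrite ler_pM2r// ler_eXn2l// ltr1n.
    by rewrite /itv_indic ler_nat; case: (leP u (2 ^+ n * t)%R) => // un nn; rewrite (le_trans un).
  apply: cvg_near_cst.
  exists (Num.truncn (u / t)%R) => // n /= hn.
  rewrite /f /h /itv_indic (_ : (u <= _)%R); last first.
    rewrite -ler_pdivrMr// (le_trans (ltW (truncnS_gt _)))//.
    have -> : (2 ^+ n = (2 ^ n)%N%:R :> R)%R by rewrite natrX.
    by rewrite ler_nat; apply: leq_trans (ltn_expl n (ltnSn 1)).
  by rewrite mulr1 -EFinM; congr EFin; congr (_ * _)%R; field.
rewrite -[X in X <= _](cvg_lim _ lim_f)//; apply: lime_le.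
  by apply/cvg_ex; eexists; exact: lim_f.
exact: nearW.
Qed.

End LogTest.

Section LorentzIndic.
Variable R : realType.
Implicit Types phi : R -> R.

Let ind (t u : R) : \bar R := (itv_indic t u)%:E.

Lemma rearrangement_ind_le t u : (0 < t)%R -> (0 < u)%R ->
  rearrangement (ind t) u <= ind t u.
Proof.
move=> t0 u0; rewrite /ind /itv_indic; case: (leP u t) => ut.
  apply: ereal_inf_lbound; exists 1%R => //; split => //.
  rewrite /distribution_fun (_ : _ `&` _ = set0) ?measure0 ?lee_fin ?ltW//.
  rewrite -subset0 => x [_] /=; rewrite lte_fin ltNge.
  by case: (x <= t)%R; rewrite ?normr1 ?normr0 ?lexx ?ler01.
apply: ereal_inf_lbound; exists 0%R => //; split => //.
rewrite /distribution_fun; apply: (@le_trans _ _ (@lebesgue_measure R (`]0%R, t]%classic : set R))).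
  apply: le_measure; rewrite ?inE//.
    have -> : halfline R `&` [set x | 0%:E < `|ind t x|] = `]0%R, t]%classic.
      apply/seteqP; split=> x /=; rewrite /halfline/= in_itv/= /ind /itv_indic lte_fin.
        by move=> [x0]; case: (x <= t)%R; rewrite ?normr0 ?ltxx// x0.
      by move=> /andP[-> ->]; rewrite normr1.
    exact: measurable_itv.
  move=> x [/= x0]; rewrite in_itv/= x0/= /ind /itv_indic lte_fin.
  by case: (x <= t)%R; rewrite ?normr0 ?ltxx.
by rewrite lebesgue_measure_itv/= lte_fin t0 oppr0 adde0 lee_fin ltW.
Qed.

(** The rearrangement already vanishes at [t], whereas [itv_indic t] is 1 there. Passing to [t / 2]
    avoids this endpoint; by quasi-concavity it costs a factor 2 in [phi]. *)
Lemma rearrangement_ind_ge t u : (0 < t)%R -> (0 < u)%R ->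
  ind (t / 2) u <= rearrangement (ind t) u.
Proof.
move=> t0 u0; apply: le_ereal_inf_tmp => _ [l [l0 hl] <-].
rewrite /ind /itv_indic lee_fin; case: (leP u (t / 2)%R) => // ut.
rewrite leNgt; apply/negP => l1; move: hl; apply/negP; rewrite -ltNge.
apply: (@lt_le_trans _ _ t%:E); first by rewrite lte_fin; lra.
rewrite /distribution_fun.
rewrite (_ : _ `&` _ = `]0%R, t]%classic).
  by rewrite lebesgue_measure_itv/= lte_fin t0 oppr0 adde0.
apply/seteqP; split=> x /=; rewrite /halfline/= in_itv/= /ind /itv_indic lte_fin.
  by move=> [x0]; case: (x <= t)%R => [_|]; rewrite ?x0// normr0 ltNge l0.
by move=> /andP[-> ->]; rewrite normr1.
Qed.

Lemma lorentz_ind_le phi t : quasi_concave phi -> (0 < t)%R ->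
  lorentz_norm phi (ind t) <= (phi t)%:E.
Proof.
move=> qc t0; rewrite -stieltjes_itv_indic//; apply: stieltjes_le => //.
- exact: rearrangement_noninc.
- exact: itv_indic_noninc.
- by move=> x x0; exact: rearrangement_ind_le.
Qed.

Lemma qc_half phi t : quasi_concave phi -> (0 < t)%R -> (phi t / 2 <= phi (t / 2))%R.
Proof.
move=> qc t0; have t2 : (0 < t / 2)%R by rewrite divr_gt0.
have t22 : (t / 2 <= t)%R by lra.
have := qc_div qc t2 t22; rewrite ler_pdivrMr// => h.
have -> : (phi (t / 2) = phi (t / 2) / (t / 2) * t / 2)%R by field; rewrite gt_eqF.
by rewrite ler_pM2r ?invr_gt0.
Qed.

Lemma lorentz_ind_ge phi t : quasi_concave phi -> (0 < t)%R ->
  (phi t / 2)%:E <= lorentz_norm phi (ind t).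
Proof.
move=> qc t0; have t2 : (0 < t / 2)%R by rewrite divr_gt0.
apply: (@le_trans _ _ (phi (t / 2))%:E); first by rewrite lee_fin qc_half.
rewrite -(stieltjes_itv_indic qc t2); apply: stieltjes_le => //.
- exact: itv_indic_noninc.
- exact: rearrangement_noninc.
- by move=> x x0; exact: rearrangement_ind_ge.
Qed.

Lemma carrier_lorentz_ind phi t : quasi_concave phi -> (0 < t)%R ->
  carrier (lorentz_norm phi) (ind t).
Proof.
move=> qc t0; split; first by exact: noninc_measurable (itv_indic_noninc t).
by apply: le_lt_trans (lorentz_ind_le qc t0) _; rewrite ltry.
Qed.

(** The norm inequalities are tested on the indicator of (0, t], whose Lorentz norm determines the
    underlying function up to a factor 2. *)
Lemma lorentz_norm_cmp phi w (c C : R) : quasi_concave phi -> quasi_concave w ->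
  (0 < c)%R -> (0 < C)%R ->
  (forall f, carrier (lorentz_norm w) f ->
     c%:E * lorentz_norm w f <= lorentz_norm phi f /\
     lorentz_norm phi f <= C%:E * lorentz_norm w f) ->
  forall t, (0 < t)%R -> (w t <= 2 / c * phi t)%R /\ (phi t <= 2 * C * w t)%R.
Proof.
move=> qc qcw c0 C0 hcC t t0; have [h1 h2] := hcC _ (carrier_lorentz_ind qcw t0).
have a1 := lorentz_ind_le qc t0; have a2 := lorentz_ind_ge qc t0.
have b1 := lorentz_ind_le qcw t0; have b2 := lorentz_ind_ge qcw t0.
have cE : 0 <= c%:E by rewrite lee_fin ltW.
have CE : 0 <= C%:E by rewrite lee_fin ltW.
split.
  have : c%:E * (w t / 2)%:E <= (phi t)%:E.
    exact: le_trans (lee_wpmul2l cE b2) (le_trans h1 a1).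
  rewrite -EFinM lee_fin => h.
  by rewrite mulrAC ler_pdivlMr//; lra.
have : (phi t / 2)%:E <= C%:E * (w t)%:E.
  exact: le_trans a2 (le_trans h2 (lee_wpmul2l CE b1)).
by rewrite -EFinM lee_fin; lra.
Qed.

Lemma same_space_W phi (X : ri_function_norm R) : quasi_concave phi ->
  same_space (Rspace_norm X) (lorentz_norm phi) ->
  carrier (ri_norm X) (fun s => ((1 + s)^-1)%:E) /\
  exists K1 K2 : R, [/\ (0 < K1)%R, (0 < K2)%R &
    forall t, (0 < t)%R -> (fine (W X t) <= K1 * phi t)%R /\
      (phi t <= K2 * fine (W X t))%R].
Proof.
move=> qc [eqc [c [C [c0 C0 hcC]]]].
(* Otherwise R(X) would be the zero space, whereas the Lorentz space contains the indicator of (0,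
   1]. *)
have hX : carrier (ri_norm X) (fun s => ((1 + s)^-1)%:E).
  apply: contrapT => hX; have := carrier_lorentz_ind qc ltr01.
  rewrite -eqc /Rspace_norm => -[_]; rewrite asboolF// /zero_space_norm.
  rewrite asboolF ?ltxx// => -[N [mN N0 hN]].
  have hh : `]0%R, 1%R]%classic `<=` N.
    move=> x /=; rewrite in_itv/= => /andP[x0 x1]; apply: hN => /= /(_ x0)/eqP.
    by rewrite /ind /itv_indic x1 eqe oner_eq0.
  have : @lebesgue_measure R (`]0%R, 1%R]%classic : set R) <= @lebesgue_measure R N.
    by apply: le_measure; rewrite ?inE.
  rewrite [leRHS]N0 lebesgue_measure_itv/= lte_fin ltr01 oppr0 adde0 lee_fin.
  by rewrite leNgt ltr01.
split => //; have qcW := W_quasi_concave hX.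
have EN : Rspace_norm X = lorentz_norm (fun t => fine (W X t)).
  by rewrite /Rspace_norm asboolT.
rewrite EN in eqc hcC.
exists (2 / c)%R, (2 * C)%R; split; [by rewrite divr_gt0|by rewrite mulr_gt0|].
exact: (lorentz_norm_cmp qc qcW c0 C0 hcC).
Qed.

Lemma stieltjes_ge_of_Rspace_lorentz phi : quasi_concave phi ->
  (exists X : ri_function_norm R, same_space (Rspace_norm X) (lorentz_norm phi)) ->
  exists2 C : R, (0 < C)%R & forall t : R, (0 < t)%R ->
    forall g : R -> R, decreasing_halfline g ->
    (forall s : R, (0 < s)%R -> (t * ln (1 + s / t))%:E <= log_integral g s) ->
    (C * phi t)%:E <= stieltjes phi (fun u => (g u)%:E).
Proof.
move=> qc [X /(same_space_W qc)[hX [K1 [K2 [K10 K20 hK]]]]].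
have qcW := W_quasi_concave hX.
(* 64 is 32 times 2, from [W_le_stieltjes]; [K1] and [K2] pass between [W X] and [phi]. *)
exists (64 * K1 * K2)^-1%R; first by rewrite invr_gt0 !mulr_gt0.
move=> t t0 g gD hg; have gn := decreasing_noninc gD.
have h := W_le_stieltjes hX gD t0 hg.
have cmp := stieltjes_cmp qcW qc (ltW K10) (fun x x0 => (hK x x0).1) gn.
set S := stieltjes phi _; have S0 : 0 <= S by exact: stieltjes_ge0.
have : (1 / 32)%:E * W X t <= 2%:E * (K1%:E * S).
  by apply: (le_trans h); apply: lee_wpmul2l.
have [_ hp] := hK t t0.
rewrite -(fineK (W_fin hX t0)).
case: S S0 => [S|_ _|//]; last by rewrite leey.
rewrite !lee_fin => S0 h'.
rewrite mulrC ler_pdivrMr ?mulr_gt0//.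
have := ler_wpM2l (ltW K20) h'; lra.
Qed.

End LorentzIndic.

End Necessity.

(** * The K-functional between L^1 and L^oo *)

Section KFunctional.
Local Open Scope ereal_scope.
Variable R : realType.
Implicit Types (f g : R -> \bar R) (a s : R).

Local Notation mu := (@lebesgue_measure R).

Definition trunc_sub f a (x : R) : \bar R := maxe (f x - a%:E) 0.

(* [Kfun f s] is the integral of the decreasing rearrangement of [f] over (0,s). *)
Definition Kval f s a : \bar R :=
  (a * s)%:E + \int[mu]_(x in halfline R) trunc_sub f a x.

Definition Kfun f s : \bar R := ereal_inf [set Kval f s a | a in [set a : R | (0 <= a)%R]].

Lemma trunc_sub_ge0 f a x : 0 <= trunc_sub f a x.
Proof. by rewrite /trunc_sub le_max lexx orbT. Qed.

Lemma trunc_sub_measurable f a : measurable_fun (halfline R) f ->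
  measurable_fun (halfline R) (trunc_sub f a).
Proof.
move=> mf; apply: measurable_maxe; last exact: measurable_cst.
by apply: emeasurable_funB => //; exact: measurable_cst.
Qed.

Lemma Kval_ge0 f s a : (0 <= s)%R -> (0 <= a)%R -> 0 <= Kval f s a.
Proof.
move=> s0 a0; rewrite adde_ge0 ?lee_fin ?mulr_ge0//.
by apply: integral_ge0 => x _; exact: trunc_sub_ge0.
Qed.

Lemma Kfun_ge0 f s : (0 <= s)%R -> 0 <= Kfun f s.
Proof. by move=> s0; apply: le_ereal_inf_tmp => _ [a a0 <-]; exact: Kval_ge0. Qed.

Lemma Kfun_le_val f s a : (0 <= a)%R -> Kfun f s <= Kval f s a.
Proof. by move=> a0; apply: ereal_inf_lbound; exists a. Qed.

Lemma Kfun_le f g s : Mplus f -> Mplus g -> ae_halfline (fun x => f x <= g x) ->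
  Kfun f s <= Kfun g s.
Proof.
move=> [mf f0] [mg g0] fg; apply: le_ereal_inf_tmp => _ [a a0 <-].
apply: (le_trans (Kfun_le_val f s a0)); rewrite leeD2l//.
apply: ae_ge0_le_integral; [exact: measurable_halfline|by move=> x _; exact: trunc_sub_ge0
  |exact: trunc_sub_measurable|by move=> x _; exact: trunc_sub_ge0
  |exact: trunc_sub_measurable|].
case: fg => N [mN N0 hN]; exists N; split => // x hx; apply: hN => /= h; apply: hx => x0.
by rewrite /trunc_sub ge_max !le_max lexx orbT andbT leeB// h.
Qed.

(** If [a] and [b] are nearly optimal levels for [f] and [g], then [a + b] serves for the sum,
    because (f + g - a - b)^+ <= (f - a)^+ + (g - b)^+. *)
Lemma KfunD f g s : (0 < s)%R -> Mplus f -> Mplus g ->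
  Kfun (fun x => f x + g x) s <= Kfun f s + Kfun g s.
Proof.
move=> s0 [mf f0] [mg g0].
have Kf0 := Kfun_ge0 f (ltW s0); have Kg0 := Kfun_ge0 g (ltW s0).
have [->|foo] := eqVneq (Kfun f s) +oo; first by rewrite addye ?leey// gt_eqF// (lt_le_trans _ Kg0).
have [->|goo] := eqVneq (Kfun g s) +oo; first by rewrite addey ?leey// gt_eqF// (lt_le_trans _ Kf0).
have ff : Kfun f s \is a fin_num by rewrite ge0_fin_numE// ltey.
have gf : Kfun g s \is a fin_num by rewrite ge0_fin_numE// ltey.
apply/lee_addgt0Pr => e e0.
have e20 : (0 < e / 2)%R by rewrite divr_gt0.
have [_ [a a0 <-] ha] := lb_ereal_inf_adherent e20 ff.
have [_ [b b0 <-] hb] := lb_ereal_inf_adherent e20 gf.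
have ab0 : (0 <= a + b)%R by rewrite addr_ge0.
apply: (le_trans (Kfun_le_val _ s ab0)).
apply: (@le_trans _ _ (Kval f s a + Kval g s b)); last first.
  by rewrite [e]splitr EFinD [leRHS]addeACA; apply: leeD; exact: ltW.
rewrite /Kval [leRHS]addeACA -EFinD -mulrDl leeD2l//.
have mh := @measurable_halfline R.
have tg h c x : halfline R x -> 0 <= trunc_sub h c x by move=> _; exact: trunc_sub_ge0.
have -> : \int[mu]_(x in halfline R) trunc_sub f a x +
    \int[mu]_(x in halfline R) trunc_sub g b x =
    \int[mu]_(x in halfline R) (trunc_sub f a x + trunc_sub g b x).
  apply/esym; exact: (ge0_integralD mu mh (@tg f a) (trunc_sub_measurable a mf)
    (@tg g b) (trunc_sub_measurable b mg)).
apply: ge0_le_integral; [exact: mh|exact: tg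
  |by apply: trunc_sub_measurable; exact: emeasurable_funD
  |by apply: emeasurable_funD; exact: trunc_sub_measurable|].
move=> x x0; rewrite {1}/trunc_sub ge_max; apply/andP; split; last first.
  by apply: adde_ge0; exact: trunc_sub_ge0.
apply: (@le_trans _ _ ((f x - a%:E) + (g x - b%:E))).
  by rewrite EFinD oppeD// addeACA.
by apply: leeD; rewrite /trunc_sub le_max lexx.
Qed.

Lemma KfunZ (c : R) f s : (0 < c)%R -> (0 < s)%R -> Mplus f ->
  Kfun (fun x => c%:E * f x) s <= c%:E * Kfun f s.
Proof.
move=> c0 s0 [mf f0]; have ci0 : (0 < c^-1)%R by rewrite invr_gt0.
have mh := @measurable_halfline R.
have tg h b x : halfline R x -> 0 <= trunc_sub h b x by move=> _; exact: trunc_sub_ge0.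
have h a : (0 <= a)%R -> Kfun (fun x => c%:E * f x) s <= c%:E * Kval f s a.
  move=> a0; have ca0 : (0 <= c * a)%R by rewrite mulr_ge0// ltW.
  apply: (le_trans (Kfun_le_val _ s ca0)).
  rewrite /Kval ge0_muleDr ?lee_fin ?mulr_ge0 ?(ltW s0)//; last first.
    by apply: integral_ge0 => x _; exact: trunc_sub_ge0.
  rewrite -EFinM mulrA leeD2l//.
  have -> : c%:E * \int[mu]_(x in halfline R) trunc_sub f a x =
      \int[mu]_(x in halfline R) (c%:E * trunc_sub f a x).
    apply/esym; apply: (ge0_integralZl mu mh (trunc_sub_measurable a mf) (@tg f a)).
    by rewrite lee_fin ltW.
  rewrite le_eqVlt; apply/orP; left; apply/eqP; apply: eq_integral => x _.
  rewrite /trunc_sub; case: (f x) => [r| |].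
  - rewrite -EFinM -!EFinB -!EFin_max -EFinM; congr EFin.
    by rewrite maxr_pMr ?(ltW c0)// mulr0 mulrBr.
  - by rewrite gt0_muley ?lte_fin// !addye// !(max_idPl _) ?leey// gt0_muley ?lte_fin.
  - by rewrite gt0_muleNy ?lte_fin// !addNye !(max_idPr _) ?leNye// mule0.
rewrite -lee_pdivrMl//; apply: le_ereal_inf_tmp => _ [a a0 <-].
by rewrite lee_pdivrMl// h.
Qed.

Lemma Kfun0 s : (0 < s)%R -> Kfun (fun=> 0) s = 0.
Proof.
move=> s0; apply/eqP; rewrite eq_le Kfun_ge0 ?(ltW s0)// andbT.
apply: (le_trans (Kfun_le_val _ s (lexx 0%R))); rewrite /Kval mul0r add0e.
rewrite integral0_eq// => x _; rewrite /trunc_sub oppe0 adde0 maxxx.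
by [].
Qed.

(** For every level, f <= a + (f - a)^+, and the constant integrates over [E] to at most [a * s]. *)
Lemma Kfun_integral f (E : set R) s : Mplus f -> measurable E -> E `<=` halfline R ->
  mu E <= s%:E -> \int[mu]_(x in E) f x <= Kfun f s.
Proof.
move=> [mf f0] mE Eh Es; apply: le_ereal_inf_tmp => _ [a a0 <-].
have mh := @measurable_halfline R.
have mfE : measurable_fun E f by apply: measurable_funS mf.
have mtE : measurable_fun E (trunc_sub f a).
  exact: measurable_funS (trunc_sub_measurable a mf).
have tg x : E x -> 0 <= trunc_sub f a x by move=> _; exact: trunc_sub_ge0.
have cg x : E x -> 0 <= cst a%:E x by rewrite lee_fin.
have mc : measurable_fun E (cst a%:E) by exact: measurable_cst.
apply: (@le_trans _ _ (\int[mu]_(x in E) (a%:E + trunc_sub f a x))).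
  apply: ge0_le_integral; [exact: mE|by move=> x /Eh; exact: f0|by []
    |by apply: emeasurable_funD|].
  - move=> x /Eh x0; rewrite /trunc_sub; have := f0 _ x0.
    case: (f x) => [r| |//] _; last by rewrite addye// (max_idPl _) ?leey.
    by rewrite -EFinB -EFin_max -EFinD lee_fin -lerBlDl le_max lexx.
rewrite (ge0_integralD mu mE cg mc tg mtE).
rewrite integral_cst// leeD//.
  by rewrite EFinM lee_wpmul2l// lee_fin.
apply: ge0_subset_integral => //.
- exact: trunc_sub_measurable.
- by move=> x _; exact: trunc_sub_ge0.
Qed.

(** By layers, the integral of (f - a)^+ is that of the distribution function of [f] at [l + a] over
    l > 0. *)
Lemma Kfun_equimeasurable f g s : Mplus f -> Mplus g -> equimeasurable f g ->
  Kfun f s = Kfun g s.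
Proof.
move=> [mf f0] [mg g0] fg.
suff h a : (0 <= a)%R -> Kval f s a = Kval g s a.
  by rewrite /Kfun; congr ereal_inf; apply/seteqP; split=> _ [a a0 <-]; exists a => //; rewrite h.
move=> a0; congr (_ + _); have mh := @measurable_halfline R.
have L k : Mplus k -> \int[mu]_(x in halfline R) trunc_sub k a x =
    \int[mu]_(l in halfline R) distribution_fun k (l + a).
  move=> [mk k0].
  have mt := trunc_sub_measurable a mk.
  have tg x : halfline R x -> 0 <= trunc_sub k a x by move=> _; exact: trunc_sub_ge0.
  have cg x : halfline R x -> 0 <= cst 1 x :> \bar R by move=> _; exact: lee01.
  have mc : measurable_fun (halfline R) (cst 1 : R -> \bar R) by exact: measurable_cst.
  transitivity (\int[mu]_(x in halfline R) (trunc_sub k a x * cst 1 x)).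
    by apply: eq_integral => x _; rewrite mule1.
  rewrite (layer_cake mh mt mc tg cg).
  apply: eq_integral => l /[1!inE] l0.
  have E : halfline R `&` [set x | l%:E < trunc_sub k a x] =
           halfline R `&` [set x | (l + a)%:E < `|k x|].
    apply/seteqP; split=> x [x0 /= h]; split => //=; move: h; rewrite gee0_abs ?k0//.
      rewrite /trunc_sub lt_max [X in _ || X]ltNge lee_fin (ltW l0) orbF.
      by rewrite lteBrDr// EFinD.
    by rewrite /trunc_sub lt_max lteBrDr// EFinD => ->.
  rewrite integral_cst ?mul1e ?E//.
  by rewrite -E; exact: (emeasurable_fun_o_infty mh mt).
rewrite !L//; apply: eq_integral => l /[1!inE] l0; apply: fg.
by rewrite addr_ge0// ltW.
Qed.

Lemma Kfun_indic (E : set R) s : (0 < s)%R -> measurable E -> E `<=` halfline R ->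
  Kfun (fun x => (\1_E x)%:E) s <= mine s%:E (mu E).
Proof.
move=> s0 mE Eh; rewrite le_min; apply/andP; split.
  apply: (le_trans (Kfun_le_val _ s ler01)); rewrite /Kval mul1r.
  rewrite integral0_eq ?adde0// => x _; rewrite /trunc_sub -EFinB -EFin_max.
  congr EFin; rewrite (max_idPr _)// indicE; case: (x \in E); rewrite ?subrr//=; lra.
apply: (le_trans (Kfun_le_val _ s (lexx 0%R))); rewrite /Kval mul0r add0e.
rewrite (_ : \int[mu]_(x in halfline R) _ = \int[mu]_(x in halfline R) (\1_E x)%:E).
  rewrite integral_indic//; last exact: measurable_halfline.
  by rewrite (@setIidl R).
apply: eq_integral => x _; rewrite /trunc_sub -EFinB subr0 -EFin_max.
by rewrite (max_idPl _).
Qed.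

(** The level [h s] works: beyond [s] the truncation vanishes, and before [s] the term [h s * s]
    restores what was subtracted. *)
Lemma Kfun_noninc (h : R -> R) s : (0 < s)%R -> noninc_halfline (EFin \o h) ->
  Kfun (EFin \o h) s <= \int[mu]_(x in `]0%R, s]) (h x)%:E.
Proof.
move=> s0 hn; have [h0 hni] := hn.
have a0 : (0 <= h s)%R by rewrite -lee_fin h0.
apply: (le_trans (Kfun_le_val _ s a0)).
have sub : `]0%R, s]%classic `<=` halfline R by move=> u /=; rewrite in_itv/= => /andP[].
have mh := @measurable_halfline R.
have mhs := noninc_measurable hn.
have mI : measurable (`]0%R, s]%classic : set R) by exact: measurable_itv.
have tg x : `]0%R, s]%classic x -> 0 <= trunc_sub (EFin \o h) (h s) x.
  by move=> _; exact: trunc_sub_ge0.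
have mt : measurable_fun `]0%R, s] (trunc_sub (EFin \o h) (h s)).
  exact: measurable_funS (trunc_sub_measurable _ mhs).
have cg x : `]0%R, s]%classic x -> 0 <= cst (h s)%:E x by rewrite lee_fin.
have mc : measurable_fun `]0%R, s] (cst (h s)%:E) by exact: measurable_cst.
rewrite /Kval.
have -> : \int[mu]_(x in halfline R) trunc_sub (EFin \o h) (h s) x =
    \int[mu]_(x in `]0%R, s]) trunc_sub (EFin \o h) (h s) x.
  rewrite integral_mkcond [RHS]integral_mkcond; apply: eq_integral => x _.
  rewrite !patchE; case: (pselect (halfline R x)) => xh; last first.
    by rewrite !memNset// => /sub.
  rewrite mem_set//; case: (pselect (`]0%R, s]%classic x)) => xs.
    by rewrite mem_set.
  rewrite memNset// /trunc_sub (max_idPr _)//= -EFinB lee_fin subr_le0 -lee_fin.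
  apply: hni => //; rewrite leNgt; apply/negP => xs'; apply: xs.
  by rewrite /= in_itv/= (ltW xs') andbT.
have -> : (h s * s)%:E = \int[mu]_(x in `]0%R, s]) (cst (h s)%:E x).
  rewrite integral_cst// EFinM; congr (_ * _); apply/esym.
  apply: (etrans (lebesgue_measure_itv `]0%R, s])).
  by rewrite /= lte_fin s0 oppr0 adde0.
rewrite -(ge0_integralD mu mI cg mc tg mt).
rewrite le_eqVlt; apply/orP; left; apply/eqP; apply: eq_integral => x.
rewrite inE/= in_itv/= => /andP[x0 xs].
rewrite /trunc_sub (max_idPl _)/=; first by rewrite -EFinB -EFinD; congr EFin; ring.
by rewrite -EFinB lee_fin subr_ge0 -lee_fin; exact: hni.
Qed.

Lemma trunc_sub_cvg (f_ : nat -> R -> \bar R) f a x :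
  (forall n, f_ n x <= f_ n.+1 x) -> f_ n x @[n --> \oo] --> f x ->
  trunc_sub (f_ n) a x @[n --> \oo] --> trunc_sub f a x.
Proof.
move=> nd cf.
have nds : nondecreasing_seq (fun n => f_ n x) by exact/nondecreasing_seqP.
have fs : f x = ereal_sup (range (fun n => f_ n x)).
  exact: (cvg_unique _ cf (ereal_nondecreasing_cvgn nds)).
have ndt : nondecreasing_seq (fun n => trunc_sub (f_ n) a x).
  move=> m n mn; rewrite /trunc_sub ge_max !le_max lexx orbT andbT leeB//.
  exact: nds.
rewrite [X in _ --> X](_ : _ = ereal_sup (range (fun n => trunc_sub (f_ n) a x))).
  exact: ereal_nondecreasing_cvgn.
apply/eqP; rewrite eq_le; apply/andP; split.
  rewrite {1}/trunc_sub ge_max; apply/andP; split; last first.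
    by apply: le_trans (trunc_sub_ge0 (f_ 0%N) a x) _; apply: ereal_sup_ubound; exists 0%N.
  rewrite leeBlDr// fs; apply: ge_ereal_sup => _ [n _ <-].
  rewrite -leeBlDr//; apply: (@le_trans _ _ (trunc_sub (f_ n) a x)).
    by rewrite /trunc_sub le_max lexx.
  by apply: ereal_sup_ubound; exists n.
apply: ge_ereal_sup => _ [n _ <-].
rewrite /trunc_sub ge_max !le_max lexx orbT andbT leeB//.
by rewrite fs; apply: ereal_sup_ubound; exists n.
Qed.

Lemma Kval_cvg (f_ : nat -> R -> \bar R) f s a :
  (forall n, Mplus (f_ n)) -> Mplus f -> (0 <= a * s)%R ->
  ae_halfline (fun x => (forall n, f_ n x <= f_ n.+1 x) /\ f_ n x @[n --> \oo] --> f x) ->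
  Kval (f_ n) s a @[n --> \oo] --> Kval f s a.
Proof.
move=> Mf [mf f0] as0 [N [mN N0 hN]].
have mh := @measurable_halfline R.
have mD : measurable (halfline R `\` N) by exact: measurableD.
have IE k : Mplus k -> \int[mu]_(x in halfline R) trunc_sub k a x =
    \int[mu]_(x in halfline R `\` N) trunc_sub k a x.
  move=> [mk _]; apply: ge0_negligible_integral; [exact: mN|exact: mh
    |exact: trunc_sub_measurable|by move=> x _; exact: trunc_sub_ge0|exact: N0].
have hD x : (halfline R `\` N) x ->
    (forall n, f_ n x <= f_ n.+1 x) /\ f_ n x @[n --> \oo] --> f x.
  by move=> [x0 Nx]; apply: contrapT => h; apply: Nx; apply: hN => /= /(_ x0).
rewrite /Kval IE//; under eq_fun do rewrite IE//.
apply: cvgeD; [|exact: cvg_cst|].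
  by apply: ge0_adde_def; rewrite inE ?lee_fin// integral_ge0// => x _; exact: trunc_sub_ge0.
rewrite (_ : \int[mu]_(x in _) trunc_sub f a x =
    \int[mu]_(x in halfline R `\` N) limn (fun n => trunc_sub (f_ n) a x)); last first.
  apply: eq_integral => x; rewrite inE => /hD [nd cf].
  by apply/esym/cvg_lim => //; exact: trunc_sub_cvg.
apply: cvg_monotone_convergence.
- exact: mD.
- move=> n; apply: measurable_funS (trunc_sub_measurable a (Mf n).1) => //.
- by move=> n x _; exact: trunc_sub_ge0.
- move=> x /hD [nd _] m n mn.
  rewrite /trunc_sub ge_max !le_max lexx orbT andbT leeB//.
  by move: m n mn; exact/nondecreasing_seqP.
Qed.

Lemma Kfun_fatou (f_ : nat -> R -> \bar R) f s (v : R) :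
  (forall n, Mplus (f_ n)) -> Mplus f -> (0 < s)%R ->
  ae_halfline (fun x => (forall n, f_ n x <= f_ n.+1 x) /\ f_ n x @[n --> \oo] --> f x) ->
  v%:E < Kfun f s -> exists n0, forall n, (n0 <= n)%N -> v%:E < Kfun (f_ n) s.
Proof.
move=> Mf Mf' s0 hf vK.
have [w vw wK] : exists2 w, (v < w)%R & w%:E < Kfun f s.
  move: vK; case: (Kfun f s) => [r| _|//].
    by rewrite lte_fin => vr; exists ((v + r) / 2)%R; rewrite ?lte_fin; lra.
  by exists (v + 1)%R; [lra|rewrite ltry].
(* Between neighbouring grid levels [Kval] loses at most [e * s], half of the gap between [v] and
   [w]. *)
pose e := ((w - v) / (2 * s))%R.
have e0 : (0 < e)%R by rewrite divr_gt0 ?mulr_gt0// subr_gt0.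
have es : (e * s = (w - v) / 2)%R by rewrite /e; field; rewrite gt_eqF.
(* Above level [M%:R * e] the term [a * s] alone exceeds [w], so the grid may stop there. *)
pose M := (Num.truncn (w / (e * s))).+1.
have Me : (w <= M%:R * e * s)%R.
  rewrite -mulrA -ler_pdivrMr; first by apply: ltW; exact: truncnS_gt.
  exact: mulr_gt0.
have grid j : exists n0, forall n, (n0 <= n)%N -> w%:E < Kval (f_ n) s (j%:R * e).
  have je0 : (0 <= j%:R * e)%R by rewrite mulr_ge0// ltW.
  have jes : (0 <= j%:R * e * s)%R by rewrite mulr_ge0// ltW.
  have lt : w%:E < Kval f s (j%:R * e) by exact: lt_le_trans wK (Kfun_le_val _ _ je0).
  have [N _ hN] := Kval_cvg Mf Mf' jes hf (open_ereal_gt' lt).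
  by exists N => n Nn; exact: hN.
have /choice[n_ hn] := grid.
exists (\max_(j < M.+1) n_ j)%N => n nn.
apply: (@lt_le_trans _ _ (w - e * s)%:E); first by rewrite lte_fin es; lra.
apply: le_ereal_inf_tmp => _ [a a0 <-].
have [Ma|aM] := leP (M%:R * e)%R a.
  rewrite /Kval -[leLHS]adde0 leeD//; last first.
    by apply: integral_ge0 => x _; exact: trunc_sub_ge0.
  rewrite lee_fin; apply: (@le_trans _ _ w); first by rewrite lerBlDr lerDl (mulr_ge0 (ltW e0) (ltW s0)).
  by apply: (le_trans Me); rewrite ler_wpM2r// ltW.
pose j := Num.truncn (a / e).
have ae0 : (0 <= a / e)%R by rewrite divr_ge0// ltW.
have ja : (a <= j.+1%:R * e)%R by rewrite -ler_pdivrMr// ltW// truncnS_gt.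
have aj : (j%:R * e <= a)%R by rewrite -ler_pdivlMr// truncn_le.
have jM : (j.+1 < M.+1)%N.
  by rewrite ltnS -(ltr_nat R) -(ltr_pM2r e0); exact: le_lt_trans aj aM.
have := hn j.+1 n (leq_trans (@leq_bigmax_cond _ xpredT (fun j : 'I_M.+1 => n_ j) (Ordinal jM) isT) nn).
move=> /ltW h; rewrite EFinB leeBlDr//; apply: (le_trans h).
rewrite /Kval addeAC leeD//.
  rewrite -EFinD lee_fin -mulrDl; apply: ler_wpM2r; first exact: ltW.
  by rewrite -natr1 mulrDl mul1r lerD2r.
have mh := @measurable_halfline R.
apply: ge0_le_integral; [exact: mh|by move=> x _; exact: trunc_sub_ge0
  |exact: trunc_sub_measurable (Mf n).1|exact: trunc_sub_measurable (Mf n).1|].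
move=> x _; rewrite /trunc_sub ge_max !le_max lexx orbT andbT leeB// lee_fin.
Qed.

End KFunctional.

(** * The norm built from costs of step functions *)

Section RhoNorm.
Local Open Scope ereal_scope.

Lemma lte_addP (R : realType) (A B : \bar R) (v : R) : 0 <= A -> 0 <= B ->
  v%:E < A + B ->
  exists w : R * R, [/\ (w.1 + w.2 = v)%R, w.1%:E < A & w.2%:E < B].
Proof.
case: A => [a _| _|//]; case: B => [b _| _|//].
- rewrite -EFinD lte_fin => h; exists (a - (a + b - v) / 2, b - (a + b - v) / 2)%R => /=.
  by split; rewrite ?lte_fin; lra.
- by move=> _; exists (a - 1, v - a + 1)%R; split; rewrite /= ?lte_fin ?ltry//; lra.
- by move=> _; exists (v - b + 1, b - 1)%R; split; rewrite /= ?lte_fin ?ltry//; lra.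
- by move=> _; exists (0, v)%R; split; rewrite /= ?ltry// add0r.
Qed.

Section Rho.
Variables (R : realType) (phi : R -> R) (c0 : R).
Hypotheses (qc : quasi_concave phi) (c0_gt0 : (0 < c0)%R)
  (phi_ge : forall t : R, (0 < t)%R -> (c0 * (t * ln (1 + 1 / t)) <= phi t)%R).
Implicit Types (f g : R -> \bar R) (G : seq (R * R)) (L : seq (R * R)).

Local Notation mu := (@lebesgue_measure R).

(** The lower bound on [phi] enters here. If r < s, then 1 + ln(s/r) <= 1 + s + ln(1 + 1/r), and 1 +
    s is absorbed because ln(1 + 1/r) is at least [k]. If r >= s, then [mlog r s] is [s] and
    monotonicity of [phi] suffices. *)
Lemma mlog_le_phi s : (0 < s)%R -> exists2 C : R, (0 < C)%R &
  forall r, (0 < r)%R -> (mlog r s <= C * phi r)%R.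
Proof.
move=> s0; pose k := ln (1 + 1 / s)%R.
have k0 : (0 < k)%R by rewrite ln_gt0// ltrDl divr_gt0.
have ps := qc_gt0 qc s0.
pose C1 := (s / phi s)%R; pose C2 := (((1 + s) / k + 1) / c0)%R.
have C10 : (0 < C1)%R by rewrite divr_gt0.
have C20 : (0 < C2)%R by rewrite divr_gt0// addr_gt0// divr_gt0// addr_gt0.
exists (C1 + C2)%R; first by rewrite addr_gt0.
move=> r r0; have pr := qc_gt0 qc r0.
rewrite /mlog; case: (leP s r) => sr.
  apply: (@le_trans _ _ (C1 * phi r)%R); last by rewrite ler_pM2r// lerDl ltW.
  by rewrite /C1 mulrAC ler_pdivlMr// ler_pM2l// (qc_le qc).
apply: (@le_trans _ _ (C2 * phi r)%R); last by rewrite ler_pM2r// lerDr ltW.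
apply: (@le_trans _ _ (C2 * (c0 * (r * ln (1 + 1 / r))))%R); last first.
  by rewrite ler_pM2l// phi_ge.
set l := ln (1 + 1 / r)%R.
have -> : (C2 * (c0 * (r * l)) = r * (((1 + s) / k + 1) * l))%R.
  by rewrite /C2; field; rewrite !gt_eqF.
rewrite ler_pM2l//.
have kl : (k <= l)%R.
  by rewrite /k /l ler_ln ?posrE ?addr_gt0 ?divr_gt0// lerD2l !mul1r lef_pV2 ?posrE// ltW.
have h1 : (ln (s / r) <= s + l)%R.
  rewrite lnM ?posrE ?invr_gt0// lerD//; first by rewrite ltW// ln_sublinear.
  by rewrite /l mul1r ler_ln ?posrE ?addr_gt0 ?invr_gt0// lerDr.
have h2 : (1 + s <= (1 + s) / k * l)%R.
  by rewrite mulrAC ler_pdivlMr// ler_pM2l// addr_gt0.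
by rewrite mulrDl mul1r; lra.
Qed.

Lemma flog_le_cost s : (0 < s)%R -> exists2 C : R, (0 < C)%R &
  forall G, wf G -> (flog G s <= C * cost phi G)%R.
Proof.
move=> /mlog_le_phi[C C0 hC]; exists C => // G wG; rewrite /cost mulr_sumr.
under [leRHS]eq_bigr do rewrite mulrCA.
exact: (@ler_sum_wf R G (fun r => mlog r s) (fun r => C * phi r)%R wG hC).
Qed.

Lemma cost_ge0 G : wf G -> (0 <= cost phi G)%R.
Proof.
move=> /allP wG; rewrite /cost big_seq sumr_ge0// => p /wG /andP[p1 p2].
by rewrite mulr_ge0// ltW// (qc_gt0 qc).
Qed.

(* The strict inequality and the finiteness of [L] give [rho] the Fatou property
   without any compactness of the set of step functions. *)
Definition admissible f : set (seq (R * R)) :=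
  [set L : seq (R * R) | forall p, p \in L -> (0 < p.1)%R /\ p.2%:E < Kfun f p.1].

Definition feasible L : set (seq (R * R)) :=
  [set G : seq (R * R) | wf G /\ forall p, p \in L -> (p.2 <= flog G p.1)%R].

Definition ecost L : \bar R := ereal_inf [set (cost phi G)%:E | G in feasible L].

Definition rho f : \bar R := ereal_sup [set ecost L | L in admissible f].

Lemma ecost_ge0 L : 0 <= ecost L.
Proof. by apply: le_ereal_inf_tmp => _ [G [wG _] <-]; rewrite lee_fin cost_ge0. Qed.

Lemma ecost_le L G : feasible L G -> ecost L <= (cost phi G)%:E.
Proof. by move=> h; apply: ereal_inf_lbound; exists G. Qed.

Lemma ecost_le_rho f L : admissible f L -> ecost L <= rho f.
Proof. by move=> h; apply: ereal_sup_ubound; exists L. Qed.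

Lemma rho_ge0 f : 0 <= rho f.
Proof. by apply: le_trans (ecost_ge0 [::]) _; apply: ecost_le_rho => p. Qed.

Lemma rho_le_cost f G : wf G ->
  (forall s, (0 < s)%R -> Kfun f s <= (flog G s)%:E) -> rho f <= (cost phi G)%:E.
Proof.
move=> wG h; apply: ge_ereal_sup => _ [L aL <-]; apply: ecost_le; split=> // p /aL[p1 p2].
by rewrite -lee_fin ltW// (lt_le_trans p2)// h.
Qed.

(** A single constraint (s, v) with v < K(f, s) is admissible, and any step function meeting it
    costs at least v / C. The constant depends on [s] alone. *)
Lemma Kfun_le_rho s : (0 < s)%R -> exists2 C : R, (0 < C)%R &
  forall f, Kfun f s <= C%:E * rho f.
Proof.
move=> s0; have [C C0 hC] := flog_le_cost s0; exists C => // f.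
have key (v : R) : v%:E < Kfun f s -> v%:E <= C%:E * rho f.
  move=> vK; have aL : admissible f [:: (s, v)] by move=> p; rewrite inE => /eqP ->.
  rewrite -lee_pdivrMl//; apply: le_trans (ecost_le_rho aL).
  apply: le_ereal_inf_tmp => _ [G [wG hG] <-].
  rewrite -EFinM lee_fin ler_pdivrMl//; apply: le_trans (hC _ wG).
  by have := hG (s, v); apply; rewrite inE.
rewrite leNgt; apply/negP => h.
have r0 : 0 <= C%:E * rho f by rewrite mule_ge0 ?rho_ge0// lee_fin ltW.
move: (h) r0; case: (C%:E * rho f) key {h} => [r| |//] key.
  move=> rK r0; case: (Kfun f s) rK key => [k| |//].
    rewrite lte_fin => rk key.
    have h2 : ((r + k) / 2 < k)%R by lra.
    by have := key ((r + k) / 2)%R; rewrite lte_fin lee_fin h2 => /(_ isT); lra.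
  by move=> _ /(_ (r + 1)%R); rewrite ltry lee_fin => /(_ isT); lra.
by rewrite ltNge leey.
Qed.

Lemma rho_le f g : Mplus f -> Mplus g -> ae_halfline (fun x => g x <= f x) ->
  rho g <= rho f.
Proof.
move=> Mf Mg gf; apply: ereal_sup_le => _ [L aL <-]; exists L => // p /aL[p1 p2].
by split=> //; apply: (lt_le_trans p2); exact: Kfun_le.
Qed.

Lemma rhoZ_le (c : R) f : (0 < c)%R -> Mplus f -> rho (fun x => c%:E * f x) <= c%:E * rho f.
Proof.
move=> c1 Mf; apply: ge_ereal_sup => _ [L aL <-].
pose L' := [seq (p.1, p.2 / c)%R | p <- L].
have aL' : admissible f L'.
  move=> _ /mapP[p /aL[p1 p2] ->] /=; split=> //.
  have := lt_le_trans p2 (KfunZ c1 p1 Mf); rewrite -lte_pdivrMl//.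
  by rewrite -EFinM mulrC.
apply: (@le_trans _ _ (c%:E * ecost L')); last first.
  by rewrite lee_wpmul2l ?ecost_le_rho// lee_fin ltW.
rewrite -lee_pdivrMl//; apply: le_ereal_inf_tmp => _ [G [wG hG] <-].
rewrite lee_pdivrMl// -EFinM -cost_scale; apply: ecost_le; split.
  by apply: wf_scale => //; exact: ltW.
move=> p pL; rewrite flog_scale mulrC -ler_pdivrMr//.
have -> : (p.2 / c = (p.1, p.2 / c).2)%R by [].
by apply: (hG (p.1, p.2 / c)%R); apply/mapP; exists p.
Qed.

Lemma rho_zero f : Mplus f -> ae_halfline (fun x => f x = 0) -> rho f = 0.
Proof.
move=> Mf f0; apply/eqP; rewrite eq_le rho_ge0 andbT.
have -> : 0 = (cost phi [::])%:E :> \bar R by rewrite /cost big_nil.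
apply: rho_le_cost => // s s0; rewrite /flog big_nil.
apply: (@le_trans _ _ (Kfun (fun=> 0) s)); last by rewrite Kfun0.
apply: Kfun_le => //.
case: f0 => N [mN N0 hN]; exists N; split => // x hx; apply: hN => /= h; apply: hx => x0.
by rewrite h.
Qed.

(** A vanishing [rho f] annihilates K(f, n+1), hence the integral of [f] over each []0, n]]. *)
Lemma rho_eq0 f : Mplus f -> rho f = 0 <-> ae_halfline (fun x => f x = 0).
Proof.
move=> Mf; split=> [r0|]; last exact: rho_zero.
have [mf f0] := Mf; have mh := @measurable_halfline R.
pose F n := `]0%R, n%:R]%classic : set R.
have Fh n : F n `<=` halfline R by move=> x; rewrite /F/= in_itv/= => /andP[].
have FU : \bigcup_n F n = halfline R.
  apply/seteqP; split=> [x [n _ /Fh]//|x x0]; exists (Num.truncn x).+1 => //.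
  by rewrite /F/= in_itv/= ltW ?truncnS_gt// andbT.
have F0 n : \int[mu]_(x in F n) f x = 0.
  apply/eqP; rewrite eq_le; apply/andP; split; last first.
    by apply: integral_ge0 => x /Fh; exact: f0.
  have s0 : (0 < n.+1%:R :> R)%R by [].
  have [C _ hC] := Kfun_le_rho s0.
  apply: (@le_trans _ _ (Kfun f n.+1%:R)); last by have := hC f; rewrite r0 mule0.
  apply: Kfun_integral; [exact: Mf|exact: measurable_itv|exact: Fh|rewrite /F].
  apply: (@le_trans _ _ n%:R%:E); last by rewrite lee_fin ler_nat.
  have := lebesgue_measure_itv (`]0%R, n%:R] : interval R); move=> ->/=; rewrite lte_fin.
  by case: ltP => _; rewrite ?oppr0 ?adde0// lee_fin.
have h : \int[mu]_(x in F i) f x @[i --> \oo] --> \int[mu]_(x in \bigcup_i F i) f x.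
  apply: ge0_nondecreasing_set_cvg_integral; [|move=> i; exact: measurable_itv
    |by move=> i; apply: measurable_funS mf|by move=> i x /Fh; exact: f0].
  move=> m n mn; apply/subsetPset => x; rewrite /F/= !in_itv/= => /andP[-> xm].
  by rewrite (le_trans xm)// ler_nat.
have I0 : \int[mu]_(x in halfline R) `|f x| = 0.
  transitivity (\int[mu]_(x in halfline R) f x).
    by apply: eq_integral => x /[1!inE] x0; rewrite gee0_abs// f0.
  rewrite FU in h; rewrite -(cvg_lim _ h)//; under eq_fun do rewrite F0.
  exact: lim_cst.
exact: (ae_eq_integral_abs mu mh mf).1 I0.
Qed.

Lemma rhoZ (c : R) f : (0 <= c)%R -> Mplus f -> rho (fun x => c%:E * f x) = c%:E * rho f.
Proof.
rewrite le_eqVlt => /predU1P[<-|c1] Mf.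
  rewrite mul0e; apply: rho_zero; first by apply: MplusZ.
  by apply: ae_halfline_all => x _; rewrite mul0e.
apply/eqP; rewrite eq_le rhoZ_le//=.
have ci : (0 < c^-1)%R by rewrite invr_gt0.
rewrite -lee_pdivlMl//; apply: le_trans (rhoZ_le ci (MplusZ (ltW c1) Mf)).
rewrite le_eqVlt; apply/orP; left; apply/eqP; congr rho; apply/funext => x.
by rewrite muleA -EFinM mulVf ?gt_eqF// mul1e.
Qed.

(** Every target for [f + g] splits into strict targets for [f] and for [g]; nearly optimal step
    functions for the two lists are concatenated, and both transform and cost add up. *)
Lemma rhoD f g : Mplus f -> Mplus g -> rho (fun x => f x + g x) <= rho f + rho g.
Proof.
move=> Mf Mg; apply: ge_ereal_sup => _ [L aL <-].
have /choice[w hw] (p : R * R) : exists w : R * R, p \in L ->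
    [/\ (w.1 + w.2 = p.2)%R, w.1%:E < Kfun f p.1 & w.2%:E < Kfun g p.1].
  have [pL|pL] := boolP (p \in L); last by exists (0, 0)%R.
  have [p1 p2] := aL _ pL.
  have [w hw] := lte_addP (Kfun_ge0 f (ltW p1)) (Kfun_ge0 g (ltW p1))
    (lt_le_trans p2 (KfunD p1 Mf Mg)).
  by exists w.
pose L1 := [seq (p.1, (w p).1) | p <- L]; pose L2 := [seq (p.1, (w p).2) | p <- L].
have a1 : admissible f L1.
  by move=> _ /mapP[p pL ->] /=; have [p1 _] := aL _ pL; have [] := hw _ pL.
have a2 : admissible g L2.
  by move=> _ /mapP[p pL ->] /=; have [p1 _] := aL _ pL; have [] := hw _ pL.
apply: le_trans (leeD (ecost_le_rho a1) (ecost_le_rho a2)).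
have e1 := ecost_ge0 L1; have e2 := ecost_ge0 L2.
have [->|n1] := eqVneq (ecost L1) +oo; first by rewrite addye ?leey// gt_eqF// (lt_le_trans _ e2).
have [->|n2] := eqVneq (ecost L2) +oo; first by rewrite addey ?leey// gt_eqF// (lt_le_trans _ e1).
have f1 : ecost L1 \is a fin_num by rewrite ge0_fin_numE// ltey.
have f2 : ecost L2 \is a fin_num by rewrite ge0_fin_numE// ltey.
apply/lee_addgt0Pr => e e0.
have e20 : (0 < e / 2)%R by rewrite divr_gt0.
have [_ [G1 [w1 h1] <-] l1] := lb_ereal_inf_adherent e20 f1.
have [_ [G2 [w2 h2] <-] l2] := lb_ereal_inf_adherent e20 f2.
apply: (@le_trans _ _ (cost phi (G1 ++ G2))%:E).
  apply: ecost_le; split; first by rewrite wf_cat w1.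
  move=> p pL; rewrite flog_cat; have [<- _ _] := hw _ pL.
  apply: lerD.
    by apply: (h1 (p.1, (w p).1)); apply/mapP; exists p.
  by apply: (h2 (p.1, (w p).2)); apply/mapP; exists p.
rewrite cost_cat [e]splitr !EFinD [leRHS]addeACA.
by apply: leeD; exact: ltW.
Qed.

Lemma rho_fatou (f_ : nat -> R -> \bar R) f :
  (forall n, Mplus (f_ n)) -> Mplus f ->
  ae_halfline (fun x => (forall n, f_ n x <= f_ n.+1 x) /\ f_ n x @[n --> \oo] --> f x) ->
  rho (f_ n) @[n --> \oo] --> rho f.
Proof.
move=> Mf Mf' hf.
have nd : nondecreasing_seq (fun n => rho (f_ n)).
  apply/nondecreasing_seqP => n; apply: rho_le => //.
  case: hf => N [mN N0 hN]; exists N; split => // x hx; apply: hN => /= h; apply: hx => x0.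
  by have [] := h x0.
rewrite (_ : rho f = ereal_sup (range (fun n => rho (f_ n)))).
  exact: ereal_nondecreasing_cvgn.
apply/eqP; rewrite eq_le; apply/andP; split; last first.
  apply: ge_ereal_sup => _ [n _ <-]; apply: rho_le => //.
  case: hf => N [mN N0 hN]; exists N; split => // x hx; apply: hN => /= h; apply: hx => x0.
  have [ndx cx] := h x0.
  have ndsx : nondecreasing_seq (fun n => f_ n x) by exact/nondecreasing_seqP.
  rewrite (cvg_unique _ cx (ereal_nondecreasing_cvgn ndsx))//.
  by apply: ereal_sup_ubound; exists n.
apply: ge_ereal_sup => _ [L aL <-].
(* Each strict constraint persists for [f_ n] from some index on, and there are finitely many. *)
have [n hn] : exists n0, forall n, (n0 <= n)%N -> admissible (f_ n) L.
  elim: L aL => [_|p L IH aL]; first by exists 0%N => n _ p.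
  have [|n1 h1] := IH; first by move=> q qL; apply: aL; rewrite inE qL orbT.
  have [p1 p2] : (0 < p.1)%R /\ p.2%:E < Kfun f p.1 by apply: aL; rewrite inE eqxx.
  have [n2 h2] := Kfun_fatou Mf Mf' p1 hf p2.
  exists (maxn n1 n2) => n; rewrite geq_max => /andP[m1 m2] q.
  rewrite inE => /predU1P[->|qL]; first by split => //; exact: h2.
  exact: h1 qL.
apply: (le_trans (ecost_le_rho (hn n (leqnn n)))).
by apply: ereal_sup_ubound; exists n.
Qed.

Lemma rho_indic (E : set R) : measurable E -> E `<=` halfline R -> mu E < +oo ->
  rho (fun x => (\1_E x)%:E) < +oo.
Proof.
move=> mE Eh Efin; have Ef : mu E \is a fin_num by rewrite ge0_fin_numE.
(* The added 1 keeps the radius positive when [E] is null. *)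
pose r := (fine (mu E) + 1)%R.
have r0 : (0 < r)%R by rewrite ltr_wpDl ?fine_ge0.
apply: (@le_lt_trans _ _ (cost phi [:: (1%R, r)])%:E); last by rewrite ltry.
apply: rho_le_cost; first by rewrite /wf/= ler01 r0.
move=> s s0; apply: (le_trans (Kfun_indic s0 mE Eh)).
rewrite /flog big_seq1 mul1r; apply: (@le_trans _ _ (Num.min r s)%:E).
  rewrite EFin_min le_min; apply/andP; split; rewrite ge_min ?lexx//.
  by apply/orP; right; rewrite -(fineK Ef) lee_fin /r lerDl.
by rewrite lee_fin mlog_ge_min.
Qed.

Lemma rho_integral (E : set R) : measurable E -> E `<=` halfline R -> mu E < +oo ->
  exists2 C : R, (0 < C)%R & forall f, Mplus f ->
    \int[mu]_(x in E) f x <= C%:E * rho f.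
Proof.
move=> mE Eh Efin; have Ef : mu E \is a fin_num by rewrite ge0_fin_numE.
have r0 : (0 < fine (mu E) + 1)%R by rewrite ltr_wpDl ?fine_ge0.
have [C C0 hC] := Kfun_le_rho r0; exists C => // f Mf.
apply: le_trans (hC f); apply: Kfun_integral => //.
by rewrite -{1}(fineK Ef) lee_fin lerDl.
Qed.

Lemma rho_ri f g : Mplus f -> Mplus g ->
  ae_halfline (fun x => f x < +oo) -> ae_halfline (fun x => g x < +oo) ->
  equimeasurable f g -> rho f = rho g.
Proof.
move=> Mf Mg _ _ fg; rewrite /rho /admissible.
have E s : Kfun f s = Kfun g s by exact: Kfun_equimeasurable.
congr (ereal_sup _); apply/seteqP; split=> _ [L aL <-]; exists L => // p /aL[p1 p2];
  by split=> //; move: p2; rewrite E.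
Qed.

Definition rho_norm : ri_function_norm R :=
  RiFunctionNorm (fun f _ => rho_ge0 f) rho_eq0 rhoZ rhoD rho_le rho_fatou
    rho_indic rho_integral rho_ri.

End Rho.

End RhoNorm.

(** * Condition (ii) implies condition (i) *)

Lemma carrier_sub (R : realType) (N1 N2 : (R -> \bar R) -> \bar R) (K : R) :
  (0 <= K%:E)%E -> (forall f, 0 <= N2 f)%E -> (forall f, N1 f <= K%:E * N2 f)%E ->
  carrier N2 `<=` carrier N1.
Proof.
move=> K0 n0 h f [mf hf]; split; first exact: mf.
by apply: (le_lt_trans (h f)); rewrite lte_mul_pinfty.
Qed.

Lemma lorentz_same_space (R : realType) (w phi : R -> R) (K1 K2 : R) :
  quasi_concave w -> quasi_concave phi -> 0 < K1 -> 0 < K2 ->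
  (forall t, 0 < t -> w t <= K1 * phi t) -> (forall t, 0 < t -> phi t <= K2 * w t) ->
  same_space (lorentz_norm w) (lorentz_norm phi).
Proof.
move=> qcw qc K10 K20 w1 w2.
have c1 f : (lorentz_norm w f <= K1%:E * lorentz_norm phi f)%E.
  exact: (stieltjes_cmp qcw qc (ltW K10) w1 (rearrangement_noninc f)).
have c2 f : (lorentz_norm phi f <= K2%:E * lorentz_norm w f)%E.
  exact: (stieltjes_cmp qc qcw (ltW K20) w2 (rearrangement_noninc f)).
have n1 f : (0 <= lorentz_norm w f)%E := stieltjes_ge0 qcw (rearrangement_noninc f).
have n2 f : (0 <= lorentz_norm phi f)%E := stieltjes_ge0 qc (rearrangement_noninc f).
have K1E : (0 <= K1%:E)%E by rewrite lee_fin ltW.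
have K2E : (0 <= K2%:E)%E by rewrite lee_fin ltW.
split; first
  by apply/seteqP; split; [exact: (carrier_sub K2E n1 c2)|exact: (carrier_sub K1E n2 c1)].
exists K1^-1, K2; split => //; first by rewrite invr_gt0.
by move=> f _; split; [rewrite lee_pdivrMl|exact: c2].
Qed.

Section Sufficiency.
Variables (R : realType) (phi : R -> R) (c0 : R).
Hypotheses (qc : quasi_concave phi) (c0_gt0 : 0 < c0)
  (phi_ge : forall t : R, 0 < t -> c0 * (t * ln (1 + 1 / t)) <= phi t).

Let X := rho_norm qc c0_gt0 phi_ge.

(** The kernel lies below [min 1 (t / u)], whose integral over (0, s] is [mlog t s]. *)
Lemma Kfun_kernel_le (t s : R) : 0 < t -> 0 < s ->
  (Kfun (fun u => ((1 + u / t)^-1)%:E) s <= (mlog t s)%:E)%E.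
Proof.
move=> t0 s0; have mn := min_inv_noninc t0; have kn := inv1D_noninc t0.
rewrite -(integral_min_inv t0 s0).
apply: (@le_trans _ _ (Kfun (EFin \o (fun u => Num.min 1 (t / u))) s)).
  apply: Kfun_le; [exact: Mplus_noninc kn|exact: Mplus_noninc mn|].
  apply: ae_halfline_all => u u0; rewrite lee_fin le_min.
  have ut : 0 < u / t by rewrite divr_gt0.
  apply/andP; split; first by rewrite invf_le1 ?lerDl ?ltW// ltr_pwDl// ltW.
  rewrite -[t / u]invf_div lef_pV2 ?posrE//; last by rewrite ltr_pwDl// ltW.
  by rewrite lerDr.
exact: (@Kfun_noninc R (fun u => Num.min 1 (t / u)) s s0 mn).
Qed.

Lemma Kfun_kernel_ge (t s : R) : 0 < t -> 0 < s ->
  ((t * ln (1 + s / t))%:E <= Kfun (fun u => ((1 + u / t)^-1)%:E) s)%E.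
Proof.
move=> t0 s0; rewrite -(integral_inv1D t0 s0).
have kn := inv1D_noninc t0.
apply: Kfun_integral; [exact: Mplus_noninc kn|exact: measurable_itv| |].
  by move=> u /=; rewrite in_itv/= => /andP[].
have := lebesgue_measure_itv (`]0, s] : interval R); move=> ->/=; rewrite lte_fin s0.
by rewrite oppr0 adde0.
Qed.

Lemma W_rho_le t : 0 < t -> (W X t <= (phi t)%:E)%E.
Proof.
move=> t0; rewrite WE//; apply: (@le_trans _ _ (cost phi [:: (1, t)])%:E).
  apply: rho_le_cost => [|s s0]; first by rewrite /wf/= ler01 t0.
  by rewrite /flog big_seq1 mul1r; exact: Kfun_kernel_le.
by rewrite /cost big_seq1 mul1r.
Qed.

Lemma wf_decreasing (G : seq (R * R)) : wf G -> decreasing_halfline (step_fun G).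
Proof.
move=> /step_fun_noninc [g0 gd]; split=> [u u0|u v u0 uv]; rewrite -lee_fin ?g0//.
exact: gd.
Qed.

Lemma exists_pow2_ge (x t : R) : 0 < t -> exists J : nat, x <= 2 ^+ J * t.
Proof.
move=> t0; exists (Num.truncn (x / t)).+1; rewrite -ler_pdivrMr//.
set m := Num.truncn _; have -> : 2 ^+ m.+1 = (2 ^ m.+1)%N%:R :> R by rewrite natrX.
by rewrite (le_trans (ltW (truncnS_gt _)))// ler_nat ltnW// ltn_expl.
Qed.

(** The list of constraints asks for half of the lower bound for the K-functional of the kernel at
    each scale; the half makes them strict, as [admissible] demands. *)
Lemma rho_near_optimal (t M : R) (J : nat) : 0 < t -> (W X t < M%:E)%E ->
  exists G, [/\ wf G, cost phi G < M &
    forall j, (j <= J)%N -> 1 / 2 * (t * ln (1 + 2 ^+ j)) <= flog G (2 ^+ j * t)].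
Proof.
move=> t0 WM; pose L := [seq (2 ^+ j * t, 1 / 2 * (t * ln (1 + 2 ^+ j))) | j <- iota 0 J.+1].
have s0 j : 0 < 2 ^+ j * t by rewrite mulr_gt0// exprn_gt0.
have l0 j : 0 < t * ln (1 + 2 ^+ j) by rewrite mulr_gt0// ln_gt0// ltrDl exprn_gt0.
have aL : admissible (fun u => ((1 + u / t)^-1)%:E) L.
  move=> _ /mapP[j _ ->] /=; split; first exact: s0.
  apply: lt_le_trans (Kfun_kernel_ge t0 (s0 j)).
  by rewrite mulfK ?gt_eqF// lte_fin; have := l0 j; lra.
have : (ecost phi L < M%:E)%E.
  by apply: le_lt_trans WM; rewrite WE//; exact: ecost_le_rho.
move=> /ereal_inf_lt[_ [G [wG hG] <-]]; rewrite lte_fin => cM.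
exists G; split => // j jJ.
apply: (hG (2 ^+ j * t, 1 / 2 * (t * ln (1 + 2 ^+ j)))); apply/mapP; exists j => //.
by rewrite mem_iota.
Qed.

(** By contradiction: a step function of cost below [C / 8 * phi t] nearly dominates the kernel up
    to scale T = 2^J t. Completed by a tail it would violate the hypothesis, provided that the tail
    is affordable for some [J]. If it never is, [phi] grows at least linearly and the step functions
    are too small for large [J]. *)
Lemma phi_le_W (C : R) : 0 < C ->
  (forall t : R, 0 < t -> forall g : R -> R, decreasing_halfline g ->
    (forall s : R, 0 < s -> ((t * ln (1 + s / t))%:E <= log_integral g s)%E) ->
    ((C * phi t)%:E <= stieltjes phi (fun u => (g u)%:E))%E) ->
  forall t, 0 < t -> ((C / 8 * phi t)%:E <= W X t)%E.
Proof.
move=> C0 hii t t0; rewrite leNgt; apply/negP; set M := C / 8 * phi t => WM.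
have pt := qc_gt0 qc t0; have M0 : 0 < M by rewrite mulr_gt0// divr_gt0.
have s0 j : 0 < 2 ^+ j * t by rewrite mulr_gt0// exprn_gt0.
have [[J hJ]|hJ] := pselect (exists J, t / (2 ^+ J * t) * phi (2 ^+ J * t) <= C / 2 * phi t).
  have [G [wG cG hG]] := rho_near_optimal J t0 WM.
  pose T := 2 ^+ J * t; have T0 : 0 < T := s0 J.
  (* The 4 undoes the 1/2 of [rho_near_optimal] and the 1/2 of [flog_dyadic]. Beyond [T] the last
     entry contributes t + t ln(s/T), and (1 + 2^J)(s/T) >= 1 + s/t. *)
  pose H := scale_seq 4 G ++ [:: (t / T, T)].
  have wH : wf H.
    by rewrite wf_cat wf_scale//= T0 andbT divr_ge0// ltW.
  have fH s : flog H s = 4 * flog G s + t / T * mlog T s.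
    by rewrite flog_cat flog_scale /flog big_seq1.
  have hH s : 0 < s -> ((t * ln (1 + s / t))%:E <= log_integral (step_fun H) s)%E.
    move=> sp; rewrite log_integral_step// lee_fin fH.
    have [sT|Ts] := leP s T.
      have b0 : 0 <= 1 / 2 :> R by [].
      have h1 := flog_dyadic wG t0 b0 hG sp sT.
      have h2 : 0 <= t / T * mlog T s.
        by rewrite mulr_ge0 ?divr_ge0 ?(ltW t0) ?(ltW T0)// ltW// mlog_gt0.
      lra.
    have h1 := flog_le wG T0 (ltW Ts); have h2 := hG J (leqnn J).
    have J1 : 0 < 1 + 2 ^+ J :> R by rewrite addr_gt0// exprn_gt0.
    have h3 : t * ln (1 + s / t) <= t * (ln (1 + 2 ^+ J) + ln (s / T)).
      have sT0 : 0 < s / T by rewrite divr_gt0.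
      have st0 : 0 < 1 + s / t by rewrite addr_gt0// divr_gt0.
      have P0 : 0 < (1 + 2 ^+ J) * (s / T) by rewrite mulr_gt0.
      rewrite ler_pM2l// -lnM ?posrE// ler_ln ?posrE//.
      have -> : (1 + 2 ^+ J) * (s / T) = s / T + s / t.
        by rewrite /T; field; rewrite !gt_eqF ?exprn_gt0.
      by rewrite lerD2r ler_pdivlMr// mul1r ltW.
    have h4 : t / T * mlog T s = t + t * ln (s / T).
      by rewrite /mlog (leNgt s T) Ts/=; field; rewrite gt_eqF.
    have h5 : 0 <= t * ln (1 + 2 ^+ J).
      by rewrite mulr_ge0 ?(ltW t0)// ln_ge0// lerDl ltW// exprn_gt0.
    move: h1 h2 h3 h5; rewrite h4 -/T.
    move: (flog G s) (flog G T) (ln (1 + 2 ^+ J)) (ln (s / T)) (ln (1 + s / t)).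
    by move=> x1 x2 x3 x4 x5 h1 h2 h3 h5; lra.
  (* The cost of [H] is below 4 (C/8) phi(t) + (C/2) phi(t) = C phi(t). *)
  have := hii t t0 _ (wf_decreasing wH) hH.
  rewrite stieltjes_step// lee_fin cost_cat cost_scale /cost big_seq1 /= -/(cost phi G).
  by rewrite -/T in hJ; rewrite /M in cG; lra.
have {}hJ J : C / 2 * phi t < t / (2 ^+ J * t) * phi (2 ^+ J * t).
  by rewrite ltNge; apply/negP => h; apply: hJ; exists J.
(* Since [phi r / r] decreases and exceeds [k] at every 2^J t, it is at least [k] everywhere. *)
pose k := C / 2 * phi t / t; have k0 : 0 < k by rewrite divr_gt0// mulr_gt0// divr_gt0.
have kr r : 0 < r -> k * r <= phi r.
  move=> r0; have [J rJ] := exists_pow2_ge r t0.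
  rewrite -ler_pdivlMr//; apply: le_trans (qc_div qc r0 rJ).
  rewrite /k ler_pdivrMr//; apply: le_trans (ltW (hJ J)) _.
  by rewrite le_eqVlt; apply/orP; left; apply/eqP; ring.
have [D D0 hD] := flog_le_cost qc c0_gt0 phi_ge t0.
have l2 : 0 < ln 2 :> R by rewrite ln_gt0// ltr1n.
(* The integral [S] of the step function is at most M/k = t/4. Its transform then gains at most
   (t/4) ln 2^J from [t] to 2^J t, but must reach (t/2) ln(1 + 2^J) there, and its value at [t] is
   at most [D * M], independently of [J]. *)
have key (J : nat) : t / 4 * (J%:R * ln 2) <= D * M.
  have [G [wG cG hG]] := rho_near_optimal J t0 WM.
  pose S : R := \sum_(p <- G) p.1 * p.2.
  have kS : k * S <= M.
    apply: le_trans (ltW cG); rewrite /S mulr_sumr; under eq_bigr do rewrite mulrCA.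
    exact: (@ler_sum_wf R G (fun r => k * r) phi wG kr).
  have Mk : M = k * (t / 4) by rewrite /M /k; field; rewrite gt_eqF.
  have St : S <= t / 4 by move: kS; rewrite Mk ler_pM2l.
  have tT : t <= 2 ^+ J * t by rewrite ler_peMl ?(ltW t0)// exprn_ege1// ler1n.
  have e2 : 2 ^+ J * t / t = 2 ^+ J by rewrite mulfK// gt_eqF.
  have lJ : ln (2 ^+ J) = J%:R * ln 2 :> R by rewrite lnXn// mulr_natl.
  have h1 : flog G (2 ^+ J * t) <= flog G t + S * ln (2 ^+ J).
    rewrite /flog /S mulr_suml -big_split/= -{2}e2.
    under [leRHS]eq_bigr do rewrite -mulrA -mulrDr.
    exact: (@ler_sum_wf R G (fun r => mlog r (2 ^+ J * t))
      (fun r => mlog r t + r * ln (2 ^+ J * t / t)) wG (fun x hx => mlog_tail hx t0 tT)).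
  have h2 := hG J (leqnn J).
  have h3 : flog G t <= D * M.
    by apply: (le_trans (hD _ wG)); rewrite ler_pM2l// ltW.
  have h4 : ln (2 ^+ J) <= ln (1 + 2 ^+ J) :> R.
    by rewrite ler_ln ?posrE ?addr_gt0 ?exprn_gt0// lerDr.
  have l0 : 0 <= ln (2 ^+ J) :> R by rewrite lJ mulr_ge0// ltW.
  have h5 := ler_wpM2r l0 St.
  have h6 := ler_wpM2l (ltW t0) h4.
  rewrite -lJ; lra.
have tl : 0 < t / 4 * ln 2 by rewrite mulr_gt0// divr_gt0.
have := key (Num.truncn (D * M / (t / 4 * ln 2))).+1.
rewrite mulrCA leNgt => /negP; apply.
by rewrite -ltr_pdivrMr// truncnS_gt.
Qed.

Lemma Rspace_lorentz_of_stieltjes_ge :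
  (exists2 C : R, 0 < C & forall t : R, 0 < t -> forall g : R -> R,
    decreasing_halfline g ->
    (forall s : R, 0 < s -> ((t * ln (1 + s / t))%:E <= log_integral g s)%E) ->
    ((C * phi t)%:E <= stieltjes phi (fun u => (g u)%:E))%E) ->
  exists Y : ri_function_norm R, same_space (Rspace_norm Y) (lorentz_norm phi).
Proof.
move=> [C C0 hC]; exists X.
have hX : carrier (ri_norm X) (fun s => ((1 + s)^-1)%:E).
  split.
    have := (Mplus_kf (@ltr01 R)).1; apply: eq_measurable_fun => x _.
    by rewrite divr1.
  have := W_rho_le (@ltr01 R); rewrite /W => h.
  have -> : (fun s : R => ((1 + s)^-1)%:E) = (fun s => ((1 + s / 1)^-1)%:E).
    by apply/funext => s; rewrite divr1.
  by apply: (le_lt_trans h); rewrite ltry.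
pose w t := fine (W X t).
have qcw : quasi_concave w := W_quasi_concave hX.
have EN : Rspace_norm X = lorentz_norm w by rewrite /Rspace_norm asboolT.
have w1 t : 0 < t -> w t <= 1 * phi t.
  by move=> t0; rewrite mul1r -lee_fin fineK ?W_fin// W_rho_le.
have C8 : 0 < 8 / C by rewrite divr_gt0.
have w2 t : 0 < t -> phi t <= 8 / C * w t.
  move=> t0; have := phi_le_W C0 hC t0; rewrite -{1}(fineK (W_fin hX t0)) lee_fin => h.
  have := ler_wpM2l (ltW C8) h; rewrite (_ : 8 / C * (C / 8 * phi t) = phi t)//.
  by field; rewrite gt_eqF.
rewrite EN; clear EN; clearbody w.
exact: (lorentz_same_space qcw qc ltr01 C8 w1 w2).
Qed.

End Sufficiency.

(** * Dilations, and the equivalence of (ii) and (iii) *)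

Section Dilation.
Variable R : realType.
Implicit Types (g : R -> R) (k s t : R).

(** Scaled by 1/k, the push-forward of Lebesgue measure under division by [k] has the right value on
    half-open intervals, hence is Lebesgue measure by uniqueness. *)
Lemma pushforward_dilation k (A : set R) : 0 < k -> measurable A ->
  (@lebesgue_measure R ((fun u : R => (u / k)%R) @^-1` A) = k%:E * @lebesgue_measure R A)%E.
Proof.
move=> k0 mA.
have mf : measurable_fun setT ((fun u : R => (u / k)%R) : measurableTypeR R -> measurableTypeR R).
  by apply: measurable_funM; [exact: measurable_id|exact: measurable_cst].
have k0' : 0 <= k^-1 by rewrite invr_ge0 ltW.
pose F : measurableTypeR R -> measurableTypeR R := fun u : R => (u / k)%R.
have mF : measurable_fun setT F by exact: mf.
pose m (h : measurable_fun setT F) : {measure set (measurableTypeR R) -> \bar R} :=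
  mscale (NngNum k0')
    (measure_function_pushforward__canonical__measure_function_Measure (@lebesgue_measure R) h).
have E : @lebesgue_measure R A = m mF A.
  apply: lebesgue_measure_unique => // X [[a b] _ <-] /=.
  have pE : (fun u : R => (u / k)%R) @^-1` `]a, b]%classic = `](a * k), (b * k)]%classic.
    by apply/seteqP; split=> u /=; rewrite !in_itv/= ltr_pdivlMr// ler_pdivrMr.
  rewrite /m /mscale/= /pushforward pE !lebesgue_measure_itv/= !lte_fin ltr_pM2r//.
  case: ifP => ab; last by rewrite mule0.
  by rewrite -!EFinB -EFinM; congr EFin; field; rewrite gt_eqF.
rewrite E /m /mscale/= muleA -EFinM divff ?gt_eqF// mul1e.
by [].
Qed.

Lemma ge0_integral_dilation k (D : set R) (f : R -> \bar R) : 0 < k ->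
  measurable D -> measurable_fun D f -> (forall x, D x -> 0 <= f x)%E ->
  (\int[@lebesgue_measure R]_(x in (fun u => (u / k)%R) @^-1` D) f (x / k)%R =
   k%:E * \int[@lebesgue_measure R]_(x in D) f x)%E.
Proof.
move=> k0 mD mf f0.
have k0' : 0 <= k by rewrite ltW.
pose F : measurableTypeR R -> measurableTypeR R := fun u : R => (u / k)%R.
have mF : measurable_fun setT F.
  by apply: measurable_funM; [exact: measurable_id|exact: measurable_cst].
have f0' : {in D, forall x, (0 <= f x)%E} by move=> x /set_mem; exact: f0.
rewrite -(@ge0_integral_mscale _ _ _ (@lebesgue_measure R) D mD (NngNum k0') f mf f0).
rewrite -[LHS](@ge0_integral_pushforward _ _ _ _ _ F mF (@lebesgue_measure R) D f mD mf f0').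
apply: eq_measure_integral => A mA _.
exact: (pushforward_dilation k0 mA).
Qed.

Lemma log_integral_dilation g s t : decreasing_halfline g -> 0 < s -> 0 < t ->
  log_integral (fun u => g (u / t)) s = (t%:E * log_integral g (s / t))%E.
Proof.
move=> gD s0 t0; have st0 : 0 < s / t by rewrite divr_gt0.
have iE (a : R) : [set u : R | 0 < u < a] = `]0, a[%classic.
  by apply/seteqP; split=> u /=; rewrite in_itv.
have hD : [set u : R | 0 < u < s / t] `<=` halfline R by move=> u /= /andP[].
have mg : measurable_fun [set u : R | 0 < u < s / t] (EFin \o g).
  apply: (measurable_funS (@measurable_halfline R) hD).
  exact: (noninc_measurable (decreasing_noninc gD)).
rewrite /log_integral -ge0_integral_dilation//; first last.
- move=> u /= /andP[u0 us]; rewrite lee_fin mulr_ge0 ?(proj1 gD)//.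
  by rewrite ln_ge0// ler_pdivlMr// mul1r ltW.
- exact: (emeasurable_funM mg (measurable_ln_div st0 hD)).
- by rewrite iE; exact: measurable_itv.
have -> : (fun u => u / t) @^-1` [set u | 0 < u < s / t] = [set u | 0 < u < s].
  by apply/seteqP; split=> u /=; rewrite ltr_pM2r ?invr_gt0// pmulr_lgt0 ?invr_gt0.
apply: eq_integral => u /set_mem/= /andP[u0 _]; congr (g _ * ln _)%:E.
by field; rewrite !gt_eqF.
Qed.

Lemma decreasing_dilation g t : 0 < t -> decreasing_halfline g ->
  decreasing_halfline (fun u => g (u / t)).
Proof.
move=> t0 [g0 gd]; split=> [u u0|u v u0 uv]; first by rewrite g0 ?divr_gt0.
by apply: gd; rewrite ?divr_gt0// ler_pM2r ?invr_gt0.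
Qed.

Lemma log_integral_dilation_ge g t : 0 < t -> decreasing_halfline g ->
  (forall s, 0 < s -> ((t * ln (1 + s / t))%:E <= log_integral (fun u => g (u / t)%R) s)%E) <->
  (forall s, 0 < s -> ((ln (1 + s))%:E <= log_integral g s)%E).
Proof.
move=> t0 gD; split=> h s s0; last first.
  rewrite log_integral_dilation// EFinM lee_pmul2l//.
  by apply: h; rewrite divr_gt0.
have := h (s * t) (mulr_gt0 s0 t0).
by rewrite log_integral_dilation ?mulr_gt0// mulfK ?gt_eqF// EFinM lee_pmul2l.
Qed.

End Dilation.

Theorem corollary2p5 (R : realType) (phi : R -> R) (c0 : R)
    (phi_qc : quasi_concave phi) (c0_gt0 : 0 < c0)
    (phi_ge : forall t : R, 0 < t -> c0 * (t * ln (1 + 1 / t)) <= phi t) :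
  let cond_i :=
    exists X : ri_function_norm R,
      same_space (Rspace_norm X) (lorentz_norm phi) in
  let cond_ii :=
    exists2 C : R, 0 < C & forall t : R, 0 < t ->
      forall g : R -> R, decreasing_halfline g ->
        (forall s : R, 0 < s ->
           ((t * ln (1 + s / t))%:E <= log_integral g s)%E) ->
        ((C * phi t)%:E <= stieltjes phi (fun u => (g u)%:E))%E in
  let cond_iii :=
    exists2 C : R, 0 < C &
      forall g : R -> R, decreasing_halfline g ->
        (forall s : R, 0 < s ->
           ((ln (1 + s))%:E <= log_integral g s)%E) ->
        forall t : R, 0 < t ->
          ((C * phi t)%:E <= stieltjes phi (fun u => (g (u / t))%:E))%E in
  (cond_i <-> cond_ii) /\ (cond_ii <-> cond_iii).
Proof.
move=> cond_i cond_ii cond_iii; split; split.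
- exact: (stieltjes_ge_of_Rspace_lorentz phi_qc).
- exact: (Rspace_lorentz_of_stieltjes_ge phi_qc c0_gt0 phi_ge).
- move=> [C C0 h]; exists C => // g gD hg t t0.
  apply: (h t t0 _ (decreasing_dilation t0 gD)).
  exact/log_integral_dilation_ge.
- move=> [C C0 h]; exists C => // t t0 g gD hg.
  (* Condition (iii) is applied to u |-> g(t u), the dilation of [g] by [t^-1]; its own dilation by
     [t] gives back [g]. *)
  have gE : (fun u => g (u / t / t^-1)) = g.
    by apply/funext => u; rewrite invrK divfK// gt_eqF.
  have gD' : decreasing_halfline (fun u => g (u / t^-1)).
    by apply: decreasing_dilation => //; rewrite invr_gt0.
  rewrite -[in stieltjes _ _]gE; apply: (h _ gD' _ t t0).
  apply/(log_integral_dilation_ge t0 gD') => s s0.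
  by rewrite [X in log_integral X _](_ : _ = g) ?hg.
Qed.
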